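(* Let $\gamma,\kappa_0,\kappa,\eta,\rho$ be such that $\kappa<\kappa_0<\gamma$, $\gamma+3\kappa>1$, $\eta>1/4$ and $\gamma=\kappa_0+\eta+\rho$. Assume given operator-valued increments $X^\tau$ for all planar binary rooted trees $\tau$ with $2\le d(\tau)\le4$ leaves, satisfying the algebraic relations (i)–(v) listed in the context and the regularity $$X^\tau\in\hat{\mathcal C}_2^{|\tau|\kappa_0}\mathcal L(\mathcal B_\eta^{d(\tau)},\mathcal B_\eta)\quad\text{and}\quad X^\tau\in\hat{\mathcal C}_2^{\gamma+(|\tau|-1)\kappa_0}\mathcal L(\mathcal B_\eta^{d(\tau)},\mathcal B_{-\rho}),\qquad|\tau|=d(\tau)-1.$$ Let $\psi\in\mathcal B_\eta$. Then there exists a strictly positive $T_0=T_0(X^\tau;d(\tau)\le4)$ such that the equation $$y_0=\psi,\qquad\hat\delta y=(\mathrm{Id}-\hat\Lambda\hat\delta)\Big[\sum_{\tau:\,2\le d(\tau)\le4}X^\tau\,y^{\otimes d(\tau)}\Big]$$ (the rough-path formulation of $y_t=S_t\psi+\int_0^tS_{tu}\,dx_u\,B(y_u\otimes y_u)$, $B$ being pointwise multiplication) admits a unique solution $y\in\mathcal Q_{\kappa,X}([0,T_0])$.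
   Context: Setting: $\mathcal B=L^2([0,1])$ ($[0,1]$ identified with the circle), $A=\Delta-\mathrm{Id}$, $(S_t)$ the semigroup generated by $A$, $S_{ts}=S_{t-s}$; $\mathcal B_\alpha$ with norm $|(-A)^\alpha x|_{\mathcal B}$ (domain for $\alpha\ge0$, completion for $\alpha<0$); $\mathcal B_\eta^n=\mathcal B_\eta^{\otimes n}$ (Hilbert tensor product), on which $\mathcal S_n:=S\otimes\cdots\otimes S$ acts. Increments: on the simplices $\{T_0\ge t_1\ge\dots\ge t_n\ge0\}$, $\hat{\mathcal C}_n(V)$ is the space of continuous $V$-valued functions. For $\mathcal B_\alpha$- or $\mathcal B_\eta^n$-valued functions, $(\hat\delta f)_{ts}=f_t-\mathcal S_{ts}f_s$ and $(\hat\delta h)_{tus}=h_{ts}-h_{tu}-\mathcal S_{tu}h_{us}$ ($\mathcal S=S^{\otimes n}$ on $n$-tensors). For $R$ with values in $\mathcal L(\mathcal B_\eta^a,\mathcal B_\alpha)$, $(\tilde\delta R)_{tus}=R_{ts}-R_{tu}(\mathcal S_a)_{us}-S_{tu}R_{us}$. Products are $(gh)_{tus}=g_{tu}h_{us}$, and $(X^\tau y^{\otimes d})_{ts}=X^\tau_{ts}(y_s^{\otimes d})$. $\hat{\mathcal C}_2^\mu(V)$ (or $\hat{\mathcal C}_2^\mu\mathcal L(\cdot,\cdot)$): $g$ with $\sup\|g_{ts}\|/|t-s|^\mu<\infty$. $\hat{\mathcal C}_1^{*,\mu}(V)$: bounded paths $f$ with $\hat\delta f\in\hat{\mathcal C}_2^\mu(V)$.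 For $\mu>1$ and a $\mathcal B_{-\rho}$-valued 3-parameter $h$ in the range of $\hat\delta$ which is a sum of terms bounded by $C|t-u|^{\rho_i}|u-s|^{\mu-\rho_i}$, $0<\rho_i<\mu$, $\hat\Lambda h$ is the unique $M\in\hat{\mathcal C}_2^\mu(\mathcal B_{-\rho})$ with $\hat\delta M=h$. Trees: planar binary rooted trees are built from the trivial tree $\bullet$ by the operation $V(\tau_1,\tau_2)$ joining two trees at a new root; $d(\tau)$ is the number of leaves, $d(\bullet)=1$. Write $\vee=V(\bullet,\bullet)$, $L=V(\vee,\bullet)$, $R=V(\bullet,\vee)$; the trees with four leaves are $V(\vee,\vee),V(L,\bullet),V(R,\bullet),V(\bullet,L),V(\bullet,R)$. $X^\tau$ represents the iterated integral $X^{\bullet}=S$, $X^{V(\tau_1,\tau_2)}_{ts}=\int_s^tS_{tu}\,dx_u\,B(X^{\tau_1}_{us}\otimes X^{\tau_2}_{us})$. Algebraic relations required: (i) $\tilde\delta X^\vee=0$. (ii) $\tilde\delta X^L=X^\vee(X^\vee\otimes S)$, $\ \tilde\delta X^R=X^\vee(S\otimes X^\vee)$. (iii) $\tilde\delta X^{V(\vee,\vee)}=X^\vee(X^\vee\otimes X^\vee)+X^R(X^\vee\otimes\mathcal S_2)+X^L(\mathcal S_2\otimes X^\vee)$. (iv) $\tilde\delta X^{V(L,\bullet)}=X^\vee(X^L\otimes S)+X^L(X^\vee\otimes\mathcal S_2)$, $\ \tilde\delta X^{V(R,\bullet)}=X^\vee(X^R\otimes S)+X^L(S\otimes X^\vee\otimes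 S)$. (v) $\tilde\delta X^{V(\bullet,L)}=X^\vee(S\otimes X^L)+X^R(S\otimes X^\vee\otimes S)$, $\ \tilde\delta X^{V(\bullet,R)}=X^\vee(S\otimes X^R)+X^R(\mathcal S_2\otimes X^\vee)$. Space $\mathcal Q_{\kappa,X}([0,T_0])$: fix $\kappa>\kappa_1>\kappa_2$ with $\kappa-\kappa_1=\kappa_1-\kappa_2$ and $\gamma+3\kappa_2>1$. It is the set of paths $y\in\hat{\mathcal C}_1^{*,\kappa}(\mathcal B_\eta)$ on $[0,T_0]$ with $y_0=\psi$ and $$\hat\delta y=X^\vee(w\otimes w)+X^L(w^\vee\otimes w)+X^R(w\otimes w^\vee)+y^\sharp,$$ where $w\in\hat{\mathcal C}_1^{*,\kappa_1}(\mathcal B_\eta)$, $w^\vee\in\hat{\mathcal C}_1^{*,\kappa_2}(\mathcal B_\eta^2)$, $y^\sharp\in\hat{\mathcal C}_2^{3\kappa_2}(\mathcal B_\eta)$. For a solution of the equation, this decomposition is the one with $w=y$, $w^\vee=y\otimes y$.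
   Formalization: The time T_0 is allowed to depend on ψ as well as on the X^τ; a T_0 depending on X^τ alone is impossible, since for x_t = t and constant ψ = c the equation is y' = −y + y², which blows up at time log(c/(c−1)) → 0 as c → ∞. *)

(* Defs.v *)
From mathcomp Require Import all_boot all_order all_algebra.
From mathcomp Require Import all_classical all_reals all_analysis.
From mathcomp Require Import ring lra.
Import Order.TTheory GRing.Theory Num.Theory.
Import numFieldNormedType.Exports.

Set Implicit Arguments.
Unset Strict Implicit.
Unset Printing Implicit Defensive.

Local Open Scope classical_set_scope.
Local Open Scope ring_scope.

(** * The scale of spaces attached to A = Delta - Id on the circle *)

(** L^2([0,1]) is written in the real Fourier basis [trig k], k in Z, an
    orthonormal basis of eigenvectors of A (see [trig_eigen]).  A vector is
    its family of Fourier coefficients, and a vector of the n-fold Hilbert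
    tensor product is its family of coefficients on the orthonormal basis
    trig k_1 (x) ... (x) trig k_n.  The multi-index (k_1, ..., k_n) is a row
    vector, so that [row_mx], [lsubmx] and [rsubmx] join and split
    multi-indices. *)
Notation coef R n := ('rV[int]_n -> R).

Section Circle.
Context {R : realType}.

Definition trig (k : int) (x : R) : R :=
  match k with
  | Posz 0 => 1
  | Posz m => Num.sqrt 2 * cos (2 * pi * m%:R * x)
  | Negz m => Num.sqrt 2 * sin (2 * pi * m.+1%:R * x)
  end.

Definition ev (k : int) : R := 1 + (2 * pi * k%:~R) ^+ 2.

Lemma trig_periodic (k : int) (x : R) : trig k (x + 1) = trig k x.
Proof.
have E (m : nat) : 2 * pi * m%:R * (x + 1) = 2 * pi * m%:R * x + (pi *+ 2) *+ m.
  by rewrite -[(pi *+ 2) *+ m]mulr_natr; ring.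
case: k => [[|m]|m] //=; rewrite E; congr (_ * _).
  exact: (periodicn (@cosD2pi R)).
exact: (periodicn (@sinD2pi R)).
Qed.

Lemma trig_eigen (k : int) (x : R) :
  ((trig k)^`(2))%classic x - trig k x = - ev k * trig k x.
Proof.
have dcos a c : ((fun x : R => a * cos (c * x))^`())%classic =
    (fun x => - (a * c) * sin (c * x)).
  apply/funext => z; rewrite derive1E; apply: derive_val => /=.
  by apply: is_derive_eq; rewrite /GRing.scale /=; ring.
have dsin a c : ((fun x : R => a * sin (c * x))^`())%classic =
    (fun x => (a * c) * cos (c * x)).
  apply/funext => z; rewrite derive1E; apply: derive_val => /=.
  by apply: is_derive_eq; rewrite /GRing.scale /=; ring.
rewrite !derive1nS derive1n0 /ev; case: k => [[|m]|m] /=.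
- have dcst (a : R) : ((cst a : R -> R)^`())%classic = cst 0.
    by apply/funext => z; rewrite derive1_cst.
  by rewrite (_ : trig 0 = cst 1) // !dcst /cst; ring.
- by rewrite /trig dcos dsin; ring.
- by rewrite /trig dsin dcos NegzE mulrNz -pmulrn; ring.
Qed.

(** The n-fold tensor powers of (-A)^alpha and of exp(tA). *)
Definition powA (alpha : R) n (c : coef R n) : coef R n :=
  fun k => (\prod_(i < n) ev (k ord0 i) `^ alpha) * c k.

Definition sg n (t : R) (c : coef R n) : coef R n :=
  fun k => (\prod_(i < n) expR (- (t * ev (k ord0 i)))) * c k.

Definition tens m n (x : coef R m) (y : coef R n) : coef R (m + n) :=
  fun k => x (lsubmx k) * y (rsubmx k).

Definition tpow n (x : coef R 1) : coef R n :=
  fun k => \prod_(i < n) x (col i k).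

(** Tensor product of operators: Q acts on the second group of variables, then
    P on the first one.  On bounded operators this is the bounded extension of
    x (x) y |-> P x (x) Q y. *)
Definition optens a a' b b' (P : coef R a -> coef R a')
    (Q : coef R b -> coef R b') (z : coef R (a + b)) : coef R (a' + b') :=
  fun k => P (fun i => Q (fun j => z (row_mx i j)) (rsubmx k)) (lsubmx k).

Lemma optens_tens a a' b b' (P : coef R a -> coef R a')
    (Q : coef R b -> coef R b') (x : coef R a) (y : coef R b) :
  (forall r : R, P (r *: x) = r *: P x) ->
  (forall r : R, Q (r *: y) = r *: Q y) ->
  optens P Q (tens x y) = tens (P x) (Q y).
Proof.
move=> HP HQ; apply/funext => k; rewrite /optens /tens.
have -> : (fun i => Q (fun j => x (lsubmx (row_mx i j)) *
    y (rsubmx (row_mx i j))) (rsubmx k)) = Q y (rsubmx k) *: x.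
  apply/funext => i; under eq_fun do rewrite row_mxKl row_mxKr.
  by rewrite (HQ (x i)); exact: mulrC.
by rewrite HP; exact: mulrC.
Qed.

End Circle.
Arguments tpow {R} n x _.

(** * Normed spaces carried by a subset of an ambient space *)

Section NormedSubspaces.
Context {R : realType}.

Record nspace (V : lmodType R) := NSpace { carrier :> V -> Prop; nm : V -> R }.

Definition l2sq n (c : coef R n) : \bar R :=
  (\esum_(k in [set: 'rV[int]_n]) (c k ^+ 2)%:E)%E.

(** B_alpha^{(x) n}.  For alpha >= 0 the carrier is the domain of (-A)^alpha;
    for alpha < 0 it is the completion of l^2(Z^n) for the norm
    |(-A)^alpha x|.  Thus B_alpha is included in B_beta for beta <= alpha. *)
Definition Bsp (alpha : R) (n : nat) : nspace (coef R n) :=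
  @NSpace (coef R n) [set c | (l2sq (powA alpha c) < +oo)%E]
    (fun c => Num.sqrt (fine (l2sq (powA alpha c)))).

(** Bounded operators from E to F with the operator norm; the values outside
    the carrier of E are irrelevant. *)
Definition Lsp (V W : lmodType R) (E : nspace V) (F : nspace W) :
    nspace (V -> W) :=
  @NSpace (V -> W)
    [set P | [/\ forall x, E x -> F (P x),
        forall (a : R) x y, E x -> E y -> P (a *: x + y) = a *: P x + P y &
        exists C, forall x, E x -> nm F (P x) <= C * nm E x]]
    (fun P => sup [set nm F (P x) | x in [set x | E x /\ nm E x <= 1]]).

Definition cont_on (V : lmodType R) (E : nspace V) (U : topologicalType)
    (D : set U) (f : U -> V) : Prop :=
  (forall x, D x -> E (f x)) /\
  (forall x, D x -> nm E (f y - f x) @[y --> within D (nbhs x)] --> (0 : R)).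

Definition simplex2 (T : R) : set (R * R) :=
  [set p | [/\ 0 <= p.2, p.2 <= p.1 & p.1 <= T]].

Definition simplex3 (T : R) : set (R * R * R) :=
  [set p | [/\ 0 <= p.2, p.2 <= p.1.2, p.1.2 <= p.1.1 & p.1.1 <= T]].

Definition C2 (T mu : R) (V : lmodType R) (E : nspace V) (g : R -> R -> V) :=
  cont_on E (simplex2 T) (fun p => g p.1 p.2) /\
  exists C, forall t s, 0 <= s -> s < t -> t <= T ->
    nm E (g t s) <= C * (t - s) `^ mu.

(** * Increments twisted by the semigroup *)

Definition hdelta1 n (f : R -> coef R n) (t s : R) : coef R n :=
  f t - sg (t - s) (f s).

Definition hdelta2 n (h : R -> R -> coef R n) (t u s : R) : coef R n :=
  h t s - h t u - sg (t - u) (h u s).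

Definition tdelta a (P : R -> R -> coef R a -> coef R 1) (t u s : R)
    (z : coef R a) : coef R 1 :=
  P t s z - P t u (sg (u - s) z) - sg (t - u) (P u s z).

Definition C1star (T mu alpha : R) n (f : R -> coef R n) : Prop :=
  [/\ forall t, 0 <= t <= T -> Bsp alpha n (f t),
      exists C, forall t, 0 <= t <= T -> nm (Bsp alpha n) (f t) <= C &
      C2 T mu (Bsp alpha n) (hdelta1 f)].

Definition C3 (T mu alpha : R) n (h : R -> R -> R -> coef R n) : Prop :=
  exists (m : nat) (hh : 'I_m -> R -> R -> R -> coef R n) (r : 'I_m -> R)
      (C : R),
    [/\ forall i, 0 < r i < mu,
        forall i,
          cont_on (Bsp alpha n) (simplex3 T) (fun p => hh i p.1.1 p.1.2 p.2),
        forall i t u s, simplex3 T (t, u, s) ->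
          nm (Bsp alpha n) (hh i t u s) <=
            C * ((t - u) `^ r i * (u - s) `^ (mu - r i)) &
        forall t u s, simplex3 T (t, u, s) ->
          h t u s = \sum_(i < m) hh i t u s].

(** [is_Lambda T alpha h M] means that h is in the domain of the inverse of
    [hdelta2] and that M is its image.  At most one such M exists on the
    simplex, whatever the exponent mu > 1. *)
Definition is_Lambda (T alpha : R) n (h : R -> R -> R -> coef R n)
    (M : R -> R -> coef R n) : Prop :=
  exists mu, [/\ 1 < mu, C3 T mu alpha h, C2 T mu (Bsp alpha n) M &
    forall t u s, simplex3 T (t, u, s) -> hdelta2 M t u s = h t u s].

End NormedSubspaces.

(** * Planar binary trees and the equation *)

Inductive tree := Leaf | Node of tree & tree.

Fixpoint leaves (tau : tree) : nat :=
  if tau is Node tau1 tau2 then (leaves tau1 + leaves tau2)%N else 1.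

Notation vee := (Node Leaf Leaf).
Notation treeL := (Node vee Leaf).
Notation treeR := (Node Leaf vee).

Definition trees : seq tree :=
  [:: vee; treeL; treeR; Node vee vee; Node treeL Leaf; Node treeR Leaf;
      Node Leaf treeL; Node Leaf treeR].

Lemma treesP (tau : tree) : List.In tau trees <-> (2 <= leaves tau <= 4)%N.
Proof.
have pos t : (0 < leaves t)%N by elim: t => //= a Ha b Hb; rewrite addn_gt0 Ha.
split=> [/=|]; first by do 8?[case=> [<- //|]].
have L1 t : leaves t = 1%N -> t = Leaf.
  case: t => [|t1 t2] //=; have := pos t1; have := pos t2.
  by case: (leaves t1) => // ?; case: (leaves t2) => // ?; rewrite addnS.
have L2 t : leaves t = 2%N -> t = vee.
  case: t => [|t1 t2] //=; have := pos t1; have := pos t2.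
  case Ea: (leaves t1) => [|[|?]] //; case Eb: (leaves t2) => [|[|?]] //=;
    rewrite ?addSn ?addnS //.
  by move=> _ _ _; rewrite (L1 _ Ea) (L1 _ Eb).
have L3 t : leaves t = 3%N -> t = treeL \/ t = treeR.
  case: t => [|t1 t2] //=; have := pos t1; have := pos t2.
  case Ea: (leaves t1) => [|[|[|?]]] //; case Eb: (leaves t2) => [|[|[|?]]] //=;
    rewrite ?addSn ?addnS //.
    by move=> _ _ _; rewrite (L1 _ Ea) (L2 _ Eb); right.
  by move=> _ _ _; rewrite (L2 _ Ea) (L1 _ Eb); left.
case: tau => [|a b] //=; have := pos a; have := pos b.
case Ea: (leaves a) => [|[|[|[|?]]]] //; case Eb: (leaves b) => [|[|[|[|?]]]] //=;
  rewrite ?addSn ?addnS // => _ _ _;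
  repeat match goal with
  | H : leaves _ = 1%N |- _ => move/L1: H => ->
  | H : leaves _ = 2%N |- _ => move/L2: H => ->
  | H : leaves _ = 3%N |- _ => case/L3: H => ->
  end; tauto.
Qed.

Section Equation.
Context {R : realType}.

(** The operator X^tau_{ts} is [X tau t s]. *)
Definition treeops := forall tau : tree, R -> R -> coef R (leaves tau) -> coef R 1.

Variables (T eta : R) (X : treeops).
Arguments X : clear implicits.

(** Equality, on B_eta^{(x) n}, of operator-valued 3-parameter families. *)
Definition opeq3 n (P Q : R -> R -> R -> coef R n -> coef R 1) : Prop :=
  forall t u s z, simplex3 T (t, u, s) -> Bsp eta n z -> P t u s z = Q t u s z.

(** (gh)_{tus} = g_{tu} h_{us} *)
Definition prod3 n m (g : R -> R -> coef R m -> coef R 1)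
    (h : R -> R -> coef R n -> coef R m) (t u s : R) (z : coef R n) : coef R 1 :=
  g t u (h u s z).

Definition optens2 a a' b b' (P : R -> R -> coef R a -> coef R a')
    (Q : R -> R -> coef R b -> coef R b') (t s : R) :=
  optens (P t s) (Q t s).

Definition S_ n (t s : R) (z : coef R n) : coef R n := sg (t - s) z.

Local Notation "P ** Q" := (optens2 P Q) (at level 40, left associativity).
Local Notation "g *; h" := (prod3 g h) (at level 45).

Definition algebraic_relations : Prop :=
  opeq3 (tdelta (X vee)) (fun _ _ _ _ => 0) /\
  opeq3 (tdelta (X treeL)) (X vee *; (X vee ** @S_ 1)) /\
  opeq3 (tdelta (X treeR)) (X vee *; (@S_ 1 ** X vee)) /\
  opeq3 (tdelta (X (Node vee vee)))
    (X vee *; (X vee ** X vee) + X treeR *; (X vee ** @S_ 2) +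
     X treeL *; (@S_ 2 ** X vee)) /\
  opeq3 (tdelta (X (Node treeL Leaf)))
    (X vee *; (X treeL ** @S_ 1) + X treeL *; (X vee ** @S_ 2)) /\
  opeq3 (tdelta (X (Node treeR Leaf)))
    (X vee *; (X treeR ** @S_ 1) + X treeL *; (@S_ 1 ** X vee ** @S_ 1)) /\
  opeq3 (tdelta (X (Node Leaf treeL)))
    (X vee *; (@S_ 1 ** X treeL) + X treeR *; (@S_ 1 ** X vee ** @S_ 1)) /\
  opeq3 (tdelta (X (Node Leaf treeR)))
    (X vee *; (@S_ 1 ** X treeR) + X treeR *; (@S_ 2 ** X vee)).

Definition regularity (gamma kappa0 rho : R) : Prop :=
  forall tau, (2 <= leaves tau <= 4)%N ->
    let d := leaves tau in
    C2 T (d.-1%:R * kappa0) (Lsp (Bsp eta d) (Bsp eta 1)) (X tau) /\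
    C2 T (gamma + (d.-1%:R - 1) * kappa0)
      (Lsp (Bsp eta d) (Bsp (- rho) 1)) (X tau).

Definition germ (y : R -> coef R 1) (t s : R) : coef R 1 :=
  \sum_(tau <- trees) X tau t s (tpow (leaves tau) (y s)).

Definition solves (rho : R) (psi : coef R 1) (y : R -> coef R 1) : Prop :=
  y 0 = psi /\
  exists M, is_Lambda T (- rho) (hdelta2 (germ y)) M /\
    forall t s, simplex2 T (t, s) -> hdelta1 y t s = germ y t s - M t s.

Definition Qdecomp (kappa kappa1 kappa2 : R) (psi : coef R 1)
    (y w : R -> coef R 1) (wv : R -> coef R 2) (ysharp : R -> R -> coef R 1) :
    Prop :=
  [/\ y 0 = psi, C1star T kappa eta y,
      [/\ C1star T kappa1 eta w, C1star T kappa2 eta wv &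
          C2 T (3 * kappa2) (Bsp eta 1) ysharp] &
      forall t s, simplex2 T (t, s) ->
        hdelta1 y t s =
          X vee t s (tens (w s) (w s)) + X treeL t s (tens (wv s) (w s)) +
          X treeR t s (tens (w s) (wv s)) + ysharp t s].

Definition Qspace (kappa kappa1 kappa2 : R) (psi : coef R 1) :
    set (R -> coef R 1) :=
  [set y | exists w wv ysharp, Qdecomp kappa kappa1 kappa2 psi y w wv ysharp].

End Equation.

(* Main.v *)
Require Import Defs.
From mathcomp Require Import all_boot all_order all_algebra.
From mathcomp Require Import all_classical all_reals all_analysis.
From mathcomp Require Import ring lra finmap.
Import Order.TTheory GRing.Theory Num.Theory.
Import numFieldNormedType.Exports.
Set Implicit Arguments.
Unset Strict Implicit.
Unset Printing Implicit Defensive.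
Local Open Scope classical_set_scope.
Local Open Scope ring_scope.

(** For small steps the map phi_{ts} x = S_{ts} x + sum_tau X^tau_{ts} x^{(x) d(tau)}
    is almost a flow: by the relations (i)-(v), everything of order at most three
    cancels in phi_{ts} - phi_{tu} o phi_{us}, which is therefore O(|t-s|^{gamma+3 kappa})
    in B_{-rho}, an exponent larger than one.  A solution is a path y whose
    remainder M_{ts} = phi_{ts} y_s - y_t is of that order; then
    M = Lambda delta [sum_tau X^tau y^{(x) d(tau)}].  As in Davie's treatment of
    rough equations, solutions are limits of the Euler schemes
    y_{i+1} = phi y_i on grids.  A sewing estimate controls M in B_{-rho}, and the
    smoothing of the semigroup over the older half of [s,t] turns it into a bound
    in B_eta with a gain of |t-s|^{kappa0}, which closes the a priori and the
    stability estimates on short intervals.  Stability also yields uniqueness,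
    once the remainder of an arbitrary solution has been shown, by the same
    smoothing, to be small enough in B_eta.

    This needs gamma <= 1, which makes kappa and kappa0 positive and
    eta + rho < 1.  For gamma > 1 the exponents of all the X^tau exceed one, so
    that X^tau x^{(x) d(tau)} = 0 and the only solution is S_t psi. *)

(** * Balls of B_alpha^{(x) n} *)

Section WeightedL2.
Context {R : realType}.

(** In B_eta the remainder has exponent 3 kappa, which may well be below one, so its sums over finer
    and finer partitions need not stay bounded; only the exponent gamma + 3 kappa available in
    B_{-rho} can be sewn. Smoothing a B_{-rho} bound over a length L costs L^{-(eta + rho)} =
    L^{kappa0 - gamma}, which leaves exactly L^{kappa0 + 3 kappa}. Existence and uniqueness rest on
    one stability estimate for two paths on the same grid. It asks only for remainder bounds with
    some exponent c and sews with a slightly smaller c1; the spare power 3 (c - c1) of the mesh pays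
    for the discrepancy over single steps. Hence it applies to Euler paths of different grids,
    compared on the nodes of one of them, and to arbitrary solutions sampled on a grid. The
    nonlinearity has degree four, so the length of the interval depends on the size of psi. The
    obstacle to uniqueness is that the remainder of a given solution comes with an unspecified
    exponent mu > 1, in B_{-rho} only, while the cancellation in the defect requires a B_eta bound
    of order three. *)

Definition wt (alpha : R) n (k : 'rV[int]_n) : R :=
  \prod_(i < n) ev (k ord0 i) `^ alpha.

Lemma ev_ge1 (k : int) : 1 <= ev k :> R.
Proof. by rewrite /ev lerDl sqr_ge0. Qed.

Lemma ev_gt0 (k : int) : 0 < ev k :> R.
Proof. exact: lt_le_trans (ev_ge1 k). Qed.

Lemma wt_gt0 (alpha : R) n (k : 'rV[int]_n) : 0 < wt alpha k.
Proof. by apply: prodr_gt0 => i _; rewrite powR_gt0 ?ev_gt0. Qed.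

Lemma wt_ge0 (alpha : R) n (k : 'rV[int]_n) : 0 <= wt alpha k.
Proof. exact/ltW/wt_gt0. Qed.

Lemma le_wt (alpha beta : R) n (k : 'rV[int]_n) :
  alpha <= beta -> wt alpha k <= wt beta k.
Proof.
by move=> ab; apply: ler_prod => i _; rewrite powR_ge0 ler_powR ?ev_ge1.
Qed.

Lemma wt_ge1 (alpha : R) n (k : 'rV[int]_n) : 0 <= alpha -> 1 <= wt alpha k.
Proof.
move=> a0; apply: le_trans (le_wt k a0).
by rewrite /wt big1 // => i _; rewrite powRr0.
Qed.

Definition psum (alpha : R) n (s : seq 'rV[int]_n) (c : coef R n) : R :=
  \sum_(k <- s) (wt alpha k * c k) ^+ 2.

Lemma psum_ge0 (alpha : R) n (s : seq 'rV[int]_n) (c : coef R n) :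
  0 <= psum alpha s c.
Proof. by apply: sumr_ge0 => i _; exact: sqr_ge0. Qed.

Lemma psum_sub (alpha : R) n (s t : seq 'rV[int]_n) (c : coef R n) :
  uniq s -> uniq t -> {subset s <= t} -> psum alpha s c <= psum alpha t c.
Proof.
move=> us ut st; have st' : perm_eq s [seq i <- t | i \in s].
  apply: uniq_perm; rewrite ?filter_uniq // => k; rewrite mem_filter.
  by case: (boolP (k \in s)) => //= /st ->.
rewrite /psum [leRHS](bigID (mem s)) /= -[X in _ <= X + _]big_filter (perm_big _ st') /=.
by rewrite lerDl sumr_ge0 // => k _; exact: sqr_ge0.
Qed.

(** Every estimate is stated as membership in a closed ball of B_alpha^{(x) n}:
    tested on finite sets of frequencies, it carries both the finiteness and the
    size of the norm, and it passes to pointwise limits of coefficients. *)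
Definition ball_ (alpha : R) n (K : R) (c : coef R n) : Prop :=
  0 <= K /\ forall s : seq 'rV[int]_n, uniq s -> psum alpha s c <= K ^+ 2.

Lemma l2sq_le (alpha : R) n (c : coef R n) (K : R) :
  (forall s : seq 'rV[int]_n, uniq s -> psum alpha s c <= K) <->
  (l2sq (powA alpha c) <= K%:E)%E.
Proof.
split=> [H|H s us].
  apply: ge_ereal_sup => _ [A [finA _] <-].
  by rewrite fsbig_finite//= sumEFin lee_fin; apply: H; exact: fset_uniq.
rewrite -lee_fin; apply: le_trans H; apply: esum_ge.
exists [set` s]; first by split => //; exact: finite_seq.
by rewrite -fsbig_seq// sumEFin.
Qed.

Lemma l2sq_ge0 n (c : coef R n) : (0 <= l2sq c)%E.
Proof. by apply: esum_ge0 => k _; rewrite lee_fin sqr_ge0. Qed.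

Lemma ball_Bsp (alpha : R) n K (c : coef R n) :
  ball_ alpha K c -> Bsp alpha n c /\ nm (Bsp alpha n) c <= K.
Proof.
case=> K0 /l2sq_le H; have H0 := l2sq_ge0 (powA alpha c).
split=> /=; first exact: le_lt_trans H (ltry _).
rewrite -[leRHS](ger0_norm K0) -sqrtr_sqr ler_wsqrtr //.
rewrite -lee_fin fineK // ge0_fin_numE //; exact: le_lt_trans H (ltry _).
Qed.

Lemma Bsp_ball (alpha : R) n (c : coef R n) :
  Bsp alpha n c -> ball_ alpha (nm (Bsp alpha n) c) c.
Proof.
move=> /= H; have H0 := l2sq_ge0 (powA alpha c).
split; first exact: sqrtr_ge0.
apply/l2sq_le; rewrite sqr_sqrtr ?fine_ge0 // fineK //.
by rewrite ge0_fin_numE.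
Qed.

Lemma nm_ge0 (alpha : R) n (c : coef R n) : 0 <= nm (Bsp alpha n) c.
Proof. exact: sqrtr_ge0. Qed.

Lemma ball_ge0 (alpha : R) n K (c : coef R n) : ball_ alpha K c -> 0 <= K.
Proof. by case. Qed.

Lemma ballW (alpha : R) n K L (c : coef R n) :
  K <= L -> ball_ alpha K c -> ball_ alpha L c.
Proof.
move=> KL [K0 H]; split; first exact: le_trans KL.
by move=> s us; apply: le_trans (H s us) _; rewrite lerXn2r ?nnegrE ?(le_trans K0).
Qed.

Lemma ballP (alpha : R) n K (c : coef R n) :
  ball_ alpha K c <-> Bsp alpha n c /\ nm (Bsp alpha n) c <= K.
Proof.
split; first exact: ball_Bsp.
by case=> /Bsp_ball cB; move/ballW; exact.
Qed.

Lemma ball_coef (alpha : R) n K (c : coef R n) k :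
  0 <= alpha -> ball_ alpha K c -> `|c k| <= K.
Proof.
move=> a0 [K0 /(_ [:: k] isT)]; rewrite /psum big_seq1 => H.
have : `|wt alpha k * c k| <= K.
  rewrite -(@ler_pXn2r _ 2) ?nnegrE //.
  by rewrite real_normK ?num_real.
apply: le_trans; rewrite normrM ger0_norm ?wt_ge0 //.
by rewrite ler_peMl ?wt_ge1.
Qed.

Lemma ball0_eq0 (alpha : R) n (c : coef R n) : ball_ alpha 0 c -> c = 0.
Proof.
case=> _ H; apply/funext => k; move: (H [:: k] isT).
rewrite /psum big_seq1 expr0n /= => H0.
have /eqP : (wt alpha k * c k) ^+ 2 = 0 by apply/eqP; rewrite eq_le H0 sqr_ge0.
by rewrite sqrf_eq0 mulf_eq0 (gt_eqF (wt_gt0 _ _)) => /eqP.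
Qed.

Lemma ball0 (alpha : R) n K : 0 <= K -> ball_ alpha K (0 : coef R n).
Proof.
move=> K0; split=> // s _; rewrite /psum big1 ?sqr_ge0 // => k _.
by rewrite (_ : (0 : coef R n) k = 0) // mulr0 expr0n.
Qed.

Lemma ballZ (alpha : R) n a K (c : coef R n) :
  ball_ alpha K c -> ball_ alpha (`|a| * K) (a *: c).
Proof.
case=> K0 H; split=> [|s us]; first exact: mulr_ge0.
rewrite exprMn; apply: le_trans (ler_wpM2l (sqr_ge0 _) (H s us)).
rewrite /psum mulr_sumr ler_sum // => k _.
rewrite (_ : (a *: c) k = a * c k) // real_normK ?num_real //.
by rewrite mulrCA exprMn.
Qed.

Lemma ballN (alpha : R) n K (c : coef R n) :
  ball_ alpha K c -> ball_ alpha K (- c).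
Proof. by move/(ballZ (-1)); rewrite normrN1 mul1r scaleN1r. Qed.

(* Minkowski without Cauchy-Schwarz: for positive radii the convexity of the
   square gives (x + y)^2 <= (1 + L/K) x^2 + (1 + K/L) y^2. *)
Lemma ballD (alpha : R) n K L (c d : coef R n) :
  ball_ alpha K c -> ball_ alpha L d -> ball_ alpha (K + L) (c + d).
Proof.
case=> K0 Hc [L0 Hd]; split=> [|s us]; first exact: addr_ge0.
have pos (e : R) : 0 < e -> psum alpha s (c + d) <= (K + L + e + e) ^+ 2.
  move=> e0; set a := K + e; set b := L + e.
  have a0 : 0 < a by rewrite /a ltr_wpDl.
  have b0 : 0 < b by rewrite /b ltr_wpDl.
  have Ha : psum alpha s c <= a ^+ 2.
    by apply: le_trans (Hc s us) _; rewrite lerXn2r ?nnegrE ?(ltW a0) // lerDl ltW.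
  have Hb : psum alpha s d <= b ^+ 2.
    by apply: le_trans (Hd s us) _; rewrite lerXn2r ?nnegrE ?(ltW b0) // lerDl ltW.
  apply: (@le_trans _ _ ((1 + b / a) * psum alpha s c + (1 + a / b) * psum alpha s d)).
    rewrite /psum !mulr_sumr -big_split /= ler_sum // => k _.
    rewrite (_ : (c + d) k = c k + d k) // mulrDr.
    (* With a and b in the ratio of the enlarged radii, the gap between the two sides is a perfect
       square over a b. *)
    set x := wt _ _ * c k; set y := wt _ _ * d k.
    have : 0 <= (b * x - a * y) ^+ 2 / (a * b) by rewrite divr_ge0 ?sqr_ge0 // mulr_ge0 ?ltW.
    suff -> : (b * x - a * y) ^+ 2 / (a * b) =
      (1 + b / a) * x ^+ 2 + (1 + a / b) * y ^+ 2 - (x + y) ^+ 2 by rewrite subr_ge0.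
    by field; rewrite !gt_eqF.
  apply: (@le_trans _ _ ((1 + b / a) * a ^+ 2 + (1 + a / b) * b ^+ 2)).
    by rewrite lerD // ler_wpM2l // addr_ge0 // divr_ge0 // ltW.
  suff -> : (1 + b / a) * a ^+ 2 + (1 + a / b) * b ^+ 2 = (K + L + e + e) ^+ 2 by [].
  by rewrite /a /b; field; rewrite -/a -/b !gt_eqF.
rewrite leNgt; apply/negP => lt.
have := psum_ge0 alpha s (c + d); set P := psum _ _ _ in pos lt * => P0.
have sP : Num.sqrt P ^+ 2 = P by rewrite sqr_sqrtr.
have ltS : K + L < Num.sqrt P.
  rewrite -(@ltr_pXn2r _ 2) ?nnegrE ?sqrtr_ge0 ?addr_ge0 // sP //.
(* A quarter of the gap: even K + L + 2 e stays below the square root of P. *)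
pose e := (Num.sqrt P - (K + L)) / 4.
have e0 : 0 < e by rewrite /e divr_gt0 // subr_gt0.
have := pos e e0; rewrite leNgt => /negP; apply.
have e2 : K + L + e + e < Num.sqrt P by rewrite /e; move: (Num.sqrt P) ltS => S ltS; lra.
rewrite -[ltRHS]sP ltr_pXn2r ?nnegrE ?sqrtr_ge0 //.
by rewrite !addr_ge0 // ltW.
Qed.

Lemma ballB (alpha : R) n K L (c d : coef R n) :
  ball_ alpha K c -> ball_ alpha L d -> ball_ alpha (K + L) (c - d).
Proof. by move=> Hc /ballN; exact: (ballD Hc). Qed.

Lemma ball_le_alpha (alpha beta : R) n K (c : coef R n) :
  alpha <= beta -> ball_ beta K c -> ball_ alpha K c.
Proof.
move=> ab [K0 H]; split=> // s us; apply: le_trans (H s us).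
apply: ler_sum => k _; rewrite !exprMn ler_wpM2r ?sqr_ge0 //.
by rewrite lerXn2r ?nnegrE ?wt_ge0 ?le_wt.
Qed.

Lemma ball_lim (alpha : R) n K (c : nat -> coef R n) (d : coef R n) :
  (forall m, ball_ alpha K (c m)) ->
  (forall k, c m k @[m --> \oo] --> d k) -> ball_ alpha K d.
Proof.
move=> H cd; have K0 : 0 <= K by case: (H 0%N).
split=> // s us.
have cv : psum alpha s (c m) @[m --> \oo] --> psum alpha s d.
  rewrite /psum; elim: s us => [|k s IH] /=.
    by move=> _; under eq_fun do rewrite big_nil; rewrite big_nil; exact: cvg_cst.
  case/andP=> _ us; under eq_fun do rewrite big_cons; rewrite big_cons.
  apply: cvgD; last exact: IH.
  by apply: cvgM; apply: cvgM => //; exact: cvg_cst.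
have <- := cvg_lim (@Rhausdorff R) cv.
apply: limr_le; first by apply/cvg_ex; eexists; exact: cv.
by apply: nearW => m; case: (H m) => _; exact.
Qed.

(* Finite sets of multi-indices sit in products of their projections. *)
Lemma ball_tens (alpha : R) m n K L (x : coef R m) (y : coef R n) :
  ball_ alpha K x -> ball_ alpha L y -> ball_ alpha (K * L) (tens x y).
Proof.
case=> K0 Hx [L0 Hy]; split=> [|s us]; first exact: mulr_ge0.
pose s1 := undup (map lsubmx s); pose s2 := undup (map rsubmx s).
pose t := [seq row_mx i j | i <- s1, j <- s2] : seq 'rV[int]_(m + n).
have ut : uniq t.
  apply: allpairs_uniq; rewrite ?undup_uniq // => -[i j] [i' j'] _ _ /=.
  by move/eq_row_mx => [-> ->].
have st : {subset s <= t}.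
  move=> k ks; apply/allpairsP; exists (lsubmx k, rsubmx k) => /=.
  by rewrite !mem_undup !map_f // hsubmxK.
have Et : psum alpha t (tens x y) = psum alpha s1 x * psum alpha s2 y.
  rewrite /psum /t big_allpairs_dep mulr_suml; apply: eq_bigr => i _.
  rewrite mulr_sumr; apply: eq_bigr => j _.
  rewrite /tens row_mxKl row_mxKr -exprMn; congr (_ ^+ 2).
  rewrite /wt big_split_ord /=.
  under eq_bigr do rewrite row_mxEl; under [X in _ * X * _]eq_bigr do rewrite row_mxEr.
  by rewrite mulrACA.
apply: (@le_trans _ _ (psum alpha t (tens x y))).
  exact: psum_sub.
rewrite Et exprMn; apply: ler_pM; rewrite ?psum_ge0 //.
  by apply: Hx; exact: undup_uniq.
by apply: Hy; exact: undup_uniq.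
Qed.
End WeightedL2.

(** * Semigroup, tensor products and bounded operators *)

Section Semigroup.
Context {R : realType}.

Definition sgw n (t : R) (k : 'rV[int]_n) : R :=
  \prod_(i < n) expR (- (t * ev (k ord0 i))).

Lemma sgw_gt0 n (t : R) (k : 'rV[int]_n) : 0 < sgw t k.
Proof. by apply: prodr_gt0 => i _; exact: expR_gt0. Qed.

Lemma sgw_le1 n (t : R) (k : 'rV[int]_n) : 0 <= t -> sgw t k <= 1.
Proof.
move=> t0; apply: prodr_ile1 => i _; rewrite expR_ge0 /= -expR0 ler_expR oppr_le0.
by rewrite mulr_ge0 // ltW // ev_gt0.
Qed.

Lemma sgw_cvg n (k : 'rV[int]_n) (t0 : R) : sgw t k @[t --> t0] --> sgw t0 k.
Proof.
have E t : sgw t k = expR (- (t * \sum_(i < n) ev (k ord0 i))).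
  rewrite mulr_sumr -sumrN /sgw.
  by rewrite (big_morph expR (@expRD R) (@expR0 R)).
under eq_fun do rewrite E; rewrite E.
apply: continuous_cvg; first exact: continuous_expR.
by apply: cvgN; apply: cvgM; [exact: cvg_id|exact: cvg_cst].
Qed.

Lemma sgE n (t : R) (c : coef R n) k : sg t c k = sgw t k * c k.
Proof. by []. Qed.

Lemma sgD n (t : R) (x y : coef R n) : sg t (x + y) = sg t x + sg t y.
Proof. by apply/funext => k; exact: mulrDr. Qed.

Lemma sgB n (t : R) (x y : coef R n) : sg t (x - y) = sg t x - sg t y.
Proof. by apply/funext => k; exact: mulrBr. Qed.

Lemma sg_zero n (t : R) : sg t (0 : coef R n) = 0.
Proof. by apply/funext => k; exact: mulr0. Qed.

Lemma sg0 n (x : coef R n) : sg 0 x = x.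
Proof.
apply/funext => k; rewrite sgE /sgw big1 ?mul1r // => i _.
by rewrite mul0r oppr0 expR0.
Qed.

Lemma sg_sg n (t s : R) (x : coef R n) : sg t (sg s x) = sg (t + s) x.
Proof.
apply/funext => k; rewrite !sgE mulrA; congr (_ * _).
rewrite /sgw -big_split; apply: eq_bigr => i _ /=.
by rewrite -expRD; congr expR; ring.
Qed.

Lemma sg_tens m n (t : R) (x : coef R m) (y : coef R n) :
  sg t (tens x y) = tens (sg t x) (sg t y).
Proof.
apply/funext => k; rewrite /tens !sgE /sgw big_split_ord /=.
rewrite [RHS]mulrACA; congr (_ * _ * _);
  by apply: eq_bigr => i _; rewrite mxE.
Qed.

Lemma ball_sg (alpha : R) n t K (x : coef R n) :
  0 <= t -> ball_ alpha K x -> ball_ alpha K (sg t x).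
Proof.
move=> t0 [K0 H]; split=> // s us; apply: le_trans (H s us).
apply: ler_sum => k _; rewrite sgE mulrCA [leLHS]exprMn ler_piMl ?sqr_ge0 //.
by rewrite exprn_ile1 ?sgw_le1 // ltW // sgw_gt0.
Qed.

(** Scalar core of the smoothing estimate, used with u = t * [ev k]. Both cases u <= 1 and u > 1
    reduce to 1 + u <= exp u. *)
Lemma powR_le_expR (u e : R) : 0 < u -> 0 <= e <= 1 -> u `^ e <= expR u.
Proof.
move=> u0 /andP[e0 e1]; have eu := expR_ge1Dx u.
have [u1|u1] := leP u 1.
  have : u `^ e <= 1 by have := @ge0_ler_powR R e e0 u 1; rewrite powR1 !nnegrE; apply => //; exact: ltW.
  by move/le_trans; apply; apply: le_trans eu; rewrite lerDl ltW.
apply: (@le_trans _ _ (u `^ 1)); first by rewrite ler_powR // ltW.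
by rewrite powRr1 ?(ltW u0) //; apply: le_trans eu; rewrite lerDr.
Qed.

(** On the eigenvalue u the multiplier is u^e exp(- t u) with e = alpha - beta, and (t u)^e <= exp(t
    u) bounds it by t^{-e}, with constant one. *)
Lemma ball_smooth (alpha beta : R) t K (x : coef R 1) :
  0 < t -> 0 <= alpha - beta <= 1 -> ball_ beta K x ->
  ball_ alpha (t `^ (- (alpha - beta)) * K) (sg t x).
Proof.
move=> t0 e01 [K0 H]; split=> [|s us]; first by rewrite mulr_ge0 ?powR_ge0.
rewrite exprMn; apply: le_trans (ler_wpM2l (sqr_ge0 _) (H s us)).
rewrite /psum mulr_sumr; apply: ler_sum => k _.
rewrite sgE !exprMn [leLHS]mulrA [leRHS]mulrA ler_wpM2r ?sqr_ge0 // -!exprMn.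
rewrite lerXn2r ?nnegrE ?mulr_ge0 ?powR_ge0 ?wt_ge0 ?(ltW (sgw_gt0 _ _)) //.
rewrite /wt /sgw !big_ord1; set u := ev _.
have u0 : 0 < u := ev_gt0 _.
have -> : alpha = (alpha - beta) + beta by ring.
set e := alpha - beta in e01 *; rewrite (_ : e + beta - beta = e); last by ring.
rewrite powRD; last by rewrite (gt_eqF u0) implybT.
rewrite mulrAC ler_wpM2r ?powR_ge0 //.
rewrite expRN ler_pdivrMr ?expR_gt0 // powRN ler_pdivlMl ?powR_gt0 //.
by rewrite -powRM ?(ltW t0) ?(ltW u0) // powR_le_expR // mulr_gt0.
Qed.

(** Strong continuity is not uniform in x: a finite set [s0] of frequencies is taken that carries
    all but e^2 / 2 of the squared norm of x. On it the multipliers converge; off it two multipliers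
    in [0,1] differ by at most one, so the tail of x suffices. *)
Lemma sg_cont (alpha : R) n (x : coef R n) (t0 e : R) :
  Bsp alpha n x -> 0 <= t0 -> 0 < e ->
  \forall t \near t0, 0 <= t -> ball_ alpha e (sg t x - sg t0 x).
Proof.
move=> /Bsp_ball; set K := nm _ _ => -[K0 H] t00 e0.
pose A := [set psum alpha s x | s in [set s : seq 'rV[int]_n | uniq s]].
have hA : has_sup A.
  split; first by exists (psum alpha [::] x); exists [::].
  by exists (K ^+ 2) => _ [s us <-]; exact: H.
have d0 : 0 < e ^+ 2 / 2 by rewrite divr_gt0 ?exprn_gt0.
have [_ [s0 us0 <-] Hs0] := sup_adherent d0 hA.
have tail s : uniq s -> {in s, forall k, k \notin s0} ->
    psum alpha s x <= e ^+ 2 / 2.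
  move=> us dis; have : psum alpha (s ++ s0) x <= sup A.
    apply: ub_le_sup; first by case: hA.
    exists (s ++ s0) => //=; rewrite cat_uniq us us0 andbT /=.
    by apply/hasPn => k ks0; apply: contraL ks0 => /dis.
  by rewrite /psum big_cat /= -!/(psum _ _ _) => h; move: Hs0 h; lra.
have cv : psum alpha s0 (sg t x - sg t0 x) @[t --> t0] --> (0 : R).
  have -> : 0 = psum alpha s0 (sg t0 x - sg t0 x).
    by rewrite subrr /psum big1 // => k _; rewrite (_ : (0 : coef R n) k = 0) // mulr0 expr0n.
  rewrite /psum; elim: (s0) => [|k s IH].
    by under eq_fun do rewrite big_nil; rewrite big_nil; exact: cvg_cst.
  under eq_fun do rewrite big_cons; rewrite big_cons.
  have c : wt alpha k * (sg t x - sg t0 x) k @[t --> t0] -->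
      wt alpha k * (sg t0 x - sg t0 x) k.
    apply: cvgM; first exact: cvg_cst.
    apply: cvgB; last exact: cvg_cst.
    apply: cvgM; last exact: cvg_cst.
    exact: sgw_cvg.
  by apply: cvgD => //; rewrite !expr2; exact: cvgM.
have near0 : \forall t \near t0, psum alpha s0 (sg t x - sg t0 x) <= e ^+ 2 / 2.
  move/cvgrPdist_le: cv => /(_ _ d0); apply: filterS => t.
  by rewrite sub0r normrN ger0_norm ?psum_ge0.
apply: filterS near0 => t Ht t1; split=> [|s us]; first exact: ltW.
rewrite {1}/psum (bigID (mem s0)) /= [leRHS](splitr (e ^+ 2)) lerD //.
  apply: le_trans Ht; rewrite -big_filter; apply: psum_sub => //.
    exact: filter_uniq.
  by move=> k; rewrite mem_filter => /andP[].
rewrite -big_filter; set s1 := seq.filter _ s.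
apply: (@le_trans _ _ (psum alpha s1 x)); last first.
  apply: tail; first exact: filter_uniq.
  by move=> k; rewrite mem_filter => /andP[].
apply: ler_sum => k _.
rewrite (_ : (sg t x - sg t0 x) k = (sgw t k - sgw t0 k) * x k); last first.
  by rewrite mulrBl.
rewrite mulrCA [leLHS]exprMn ler_piMl ?sqr_ge0 //.
rewrite -real_normK ?num_real // exprn_ile1 // ler_norml.
have := sgw_le1 k t00; have := sgw_le1 k t1.
have := sgw_gt0 t k; have := sgw_gt0 t0 k; lra.
Qed.

End Semigroup.

Section Tensors.
Context {R : realType}.

Lemma tensDl m n (x y : coef R m) (z : coef R n) :
  tens (x + y) z = tens x z + tens y z.
Proof. by apply/funext => k; exact: mulrDl. Qed.

Lemma tensDr m n (x y : coef R n) (z : coef R m) :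
  tens z (x + y) = tens z x + tens z y.
Proof. by apply/funext => k; exact: mulrDr. Qed.

Lemma tensBl m n (x y : coef R m) (z : coef R n) :
  tens (x - y) z = tens x z - tens y z.
Proof. by apply/funext => k; exact: mulrBl. Qed.

Lemma tensBr m n (x y : coef R n) (z : coef R m) :
  tens z (x - y) = tens z x - tens z y.
Proof. by apply/funext => k; exact: mulrBr. Qed.

Lemma tpow_add m n (x : coef R 1) :
  tpow (m + n) x = tens (tpow m x) (tpow n x).
Proof.
apply/funext => k; rewrite /tens /tpow big_split_ord /=; congr (_ * _).
  by apply: eq_bigr => i _; congr x; apply/matrixP => a b; rewrite !mxE.
by apply: eq_bigr => i _; congr x; apply/matrixP => a b; rewrite !mxE.
Qed.

Lemma tpow1 (x : coef R 1) : tpow 1 x = x.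
Proof.
apply/funext => k; rewrite /tpow big_ord1; congr x.
by apply/matrixP => a b; rewrite !mxE !ord1.
Qed.

Lemma sg_tpow n t (x : coef R 1) : sg t (tpow n x) = tpow n (sg t x).
Proof.
apply/funext => k; rewrite /tpow sgE /sgw -big_split; apply: eq_bigr => i _ /=.
by rewrite /sg big_ord1 !mxE.
Qed.

Lemma ball_tpow (alpha : R) n K (x : coef R 1) :
  ball_ alpha K x -> ball_ alpha (K ^+ n.+1) (tpow n.+1 x).
Proof.
move=> Hx; elim: n => [|n IH]; first by rewrite tpow1 expr1.
by rewrite exprS -[n.+2]add1n tpow_add tpow1; exact: ball_tens.
Qed.

End Tensors.

Section Operators.
Context {R : realType}.
Variables (alpha beta : R) (n m : nat).
Local Notation E := (Bsp alpha n).
Local Notation F := (Bsp beta m).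
Implicit Types P Q : coef R n -> coef R m.

Lemma Lsp0 P : Lsp E F P -> P 0 = 0.
Proof.
case=> _ lin _; have E0 : E 0 by exact: (ball_Bsp (ball0 _ _ (lexx 0))).1.
have := lin 1 0 0 E0 E0; rewrite !scale1r addr0 => /eqP.
by rewrite -subr_eq subrr => /eqP.
Qed.

Lemma LspZ P a x : Lsp E F P -> E x -> P (a *: x) = a *: P x.
Proof.
move=> HP Ex; have E0 : E 0 by exact: (ball_Bsp (ball0 _ _ (lexx 0))).1.
by case: (HP) => _ lin _; have := lin a x 0 Ex E0; rewrite !addr0 (Lsp0 HP) addr0.
Qed.

Lemma LspD P x y : Lsp E F P -> E x -> E y -> P (x + y) = P x + P y.
Proof. by case=> _ lin _ Ex Ey; have := lin 1 x y Ex Ey; rewrite !scale1r. Qed.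

Lemma LspN P x : Lsp E F P -> E x -> P (- x) = - P x.
Proof. by move=> HP Ex; rewrite -scaleN1r (LspZ _ HP) // scaleN1r. Qed.

Lemma LspB P x y : Lsp E F P -> E x -> E y -> P (x - y) = P x - P y.
Proof.
move=> HP Ex Ey; rewrite (LspD HP) ?(LspN HP) //.
by case: (ball_Bsp (ballN (Bsp_ball Ey))).
Qed.

(** The operator norm is a supremum over the unit ball, so z is normalized first; a vector of norm
    zero is zero and is treated apart. Membership in [Lsp] makes the supremum finite. *)
Lemma Lsp_ball P C K z :
  Lsp E F P -> nm (Lsp E F) P <= C -> ball_ alpha K z -> ball_ beta (C * K) (P z).
Proof.
move=> HP PC Hz; have [Ez zK] := ball_Bsp Hz.
case: (HP) => PF _ [C1 HC1].
have hs : has_ubound [set nm F (P x) | x in [set x | E x /\ nm E x <= 1]].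
  exists (`|C1|) => _ [x [Ex x1] <-]; apply: le_trans (HC1 x Ex) _.
  apply: (@le_trans _ _ (`|C1| * nm E x)).
    by rewrite ler_wpM2r ?nm_ge0 // ler_norm.
  by rewrite ler_piMr.
have C0 : 0 <= C.
  apply: le_trans PC; apply: le_trans (nm_ge0 beta (P 0)) _.
  apply: ub_le_sup => //; exists 0 => //.
  by have := ball_Bsp (ball0 alpha n (ler01)).
have [z0|z0] := eqVneq (nm E z) 0.
  have : z = 0 by apply: (@ball0_eq0 _ alpha); rewrite -z0; exact: Bsp_ball.
  by move=> ->; rewrite (Lsp0 HP); apply: ball0; rewrite mulr_ge0 // (ball_ge0 Hz).
have zp : 0 < nm E z by rewrite lt_neqAle eq_sym z0 nm_ge0.
set w := (nm E z)^-1 *: z.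
have Hw : ball_ alpha 1 w.
  have := ballZ (nm E z)^-1 (Bsp_ball Ez).
  by rewrite ger0_norm ?invr_ge0 ?nm_ge0 // mulVf.
have [Ew w1] := ball_Bsp Hw.
have -> : z = nm E z *: w by rewrite /w scalerA mulfV // scale1r.
rewrite (LspZ _ HP) //.
have Hp : ball_ beta C (P w).
  apply/ballP; split; first exact: PF.
  by apply: le_trans PC; apply: ub_le_sup => //; exists w.
apply: ballW (ballZ _ Hp); rewrite ger0_norm ?nm_ge0 // mulrC.
by rewrite ler_wpM2l.
Qed.

Lemma Lsp_sub P Q : Lsp E F P -> Lsp E F Q -> Lsp E F (P - Q).
Proof.
move=> HP HQ; have [PF Pl [C HC]] := HP; have [QF Ql [D HD]] := HQ.
have bd x : E x -> ball_ beta (C * nm E x + D * nm E x) ((P - Q) x).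
  move=> Ex; apply: ballB; apply/ballP; first by split; [exact: PF|exact: HC].
  by split; [exact: QF|exact: HD].
split=> [x Ex|a x y Ex Ey|].
- by case: (ball_Bsp (bd x Ex)).
- rewrite (_ : (P - Q) (a *: x + y) = P (a *: x + y) - Q (a *: x + y)) //.
  rewrite (_ : (P - Q) x = P x - Q x) // (_ : (P - Q) y = P y - Q y) //.
  by rewrite Pl // Ql // scalerBr opprD addrACA.
- exists (C + D) => x Ex; rewrite mulrDl.
  by case: (ball_Bsp (bd x Ex)).
Qed.

End Operators.

(** * Sewing on grids *)

Section Powers.
Context {R : realType}.
Implicit Types L p q : R.

Definition halfpow p : R := 2^-1 `^ p.

Lemma halfpow_ge0 p : 0 <= halfpow p.
Proof. exact: powR_ge0. Qed.

Lemma powR_half L p : 0 <= L -> (L / 2) `^ p = halfpow p * L `^ p.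
Proof. by move=> L0; rewrite powRM ?invr_ge0 // mulrC. Qed.

Lemma halfpow_lt p q : p < q -> halfpow q < halfpow p.
Proof.
move=> pq; rewrite /halfpow /powR invr_eq0 pnatr_eq0 /= ltr_expR.
by rewrite lnV ?posrE // ltr_nM2r // oppr_lt0 ln_gt0 // ltr1n.
Qed.

Lemma halfpow_lt1 p : 0 < p -> halfpow p < 1.
Proof. by move/halfpow_lt; rewrite {2}/halfpow powRr0. Qed.

Lemma halfpow_lt_half p : 1 < p -> 2 * halfpow p < 1.
Proof.
move/halfpow_lt; rewrite {2}/halfpow powRr1 ?invr_ge0 // => h.
by rewrite mulrC -ltr_pdivlMr // div1r.
Qed.

Lemma powRB_le L p q : 0 < p -> 0 <= L <= 1 -> p <= q -> L `^ q <= L `^ p.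
Proof.
move=> p0 /andP[L0 L1] pq; have [->|Ln0] := eqVneq L 0.
  by rewrite !powR0 // gt_eqF // (lt_le_trans p0).
by apply: ger_powR => //; rewrite L1 lt_neqAle eq_sym Ln0 L0.
Qed.

Lemma powR_mono L M p : 0 <= p -> 0 <= L <= M -> L `^ p <= M `^ p.
Proof.
move=> p0 /andP[L0 LM]; apply: ge0_ler_powR => //.
exact: le_trans LM.
Qed.

Lemma powR_add L p q : 0 < L -> L `^ (p + q) = L `^ p * L `^ q.
Proof. by move=> L0; rewrite powRD // (gt_eqF L0) implybT. Qed.

Lemma powR_add_ge0 L p q : 0 < p -> 0 < q -> 0 <= L -> L `^ (p + q) = L `^ p * L `^ q.
Proof.
move=> p0 q0; rewrite le_eqVlt => /orP[/eqP<-|]; last exact: powR_add.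
by rewrite !powR0 ?mulr0 // gt_eqF // addr_gt0.
Qed.

Lemma geometric_le (x y B r : R) :
  0 <= r < 1 -> (forall n, x <= y + B * r ^+ n) -> x <= y.
Proof.
move=> /andP[r0 r1] H.
have cv : y + B * r ^+ n @[n --> \oo] --> y.
  rewrite -[X in _ --> X]addr0 -(mulr0 B); apply: cvgD; first exact: cvg_cst.
  apply: cvgM; first exact: cvg_cst.
  by apply: cvg_expr; rewrite ger0_norm.
rewrite -(cvg_lim (@Rhausdorff R) cv); apply: limr_ge.
  by apply/cvg_ex; eexists; exact: cv.
exact: nearW.
Qed.

(** Only the younger half is split again. The errors committed along the way form a geometric series
    of ratio 2^{-p}, while the a priori bound is damped by 2^{-q} at each round and disappears in
    the limit, however small q > 0 is. *)
Lemma halving (T B C p q : R) (f : R -> R -> R) :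
  0 < p -> 0 < q -> 0 <= C ->
  (forall t s, 0 <= s -> s < t -> t <= T -> f t s <= B * (t - s) `^ q) ->
  (forall t s, 0 <= s -> s < t -> t <= T ->
    f t s <= f t ((t + s) / 2) + C * (t - s) `^ p) ->
  forall t s, 0 <= s -> s < t -> t <= T ->
    f t s <= C / (1 - halfpow p) * (t - s) `^ p.
Proof.
move=> p0 q0 C0 H1 H2 t s s0 st tT.
set A := C / _; have hp := halfpow_lt1 p0.
have key n : forall t s, 0 <= s -> s < t -> t <= T ->
    f t s <= A * (t - s) `^ p + B * (t - s) `^ q * halfpow q ^+ n.
  elim: n => [|n IH] {s0 st tT}t {}s s0 st tT.
    rewrite expr0 mulr1; apply: le_trans (H1 t s s0 st tT) _.
    by rewrite lerDr mulr_ge0 ?powR_ge0 // divr_ge0 // subr_ge0 ltW.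
  apply: le_trans (H2 t s s0 st tT) _.
  have mid1 : 0 <= (t + s) / 2 by lra.
  have mid2 : (t + s) / 2 < t by lra.
  apply: le_trans (lerD (IH _ _ mid1 mid2 tT) (lexx _)) _.
  have -> : t - (t + s) / 2 = (t - s) / 2 by field.
  have L0 : 0 <= t - s by rewrite subr_ge0 ltW.
  rewrite !powR_half // exprS.
  rewrite le_eqVlt; apply/orP; left; apply/eqP.
  by rewrite /A; field; rewrite subr_eq0 gt_eqF.
apply: (@geometric_le _ _ (B * (t - s) `^ q) (halfpow q)).
  by rewrite halfpow_ge0 halfpow_lt1.
by move=> n; exact: key.
Qed.

(** The uniqueness half of sewing: after n halvings there are 2^n pieces, each of size 2^{-n mu},
    and mu > 1. *)
Lemma halving0 (T C mu : R) (f : R -> R -> R) :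
  1 < mu ->
  (forall t s, 0 <= s -> s < t -> t <= T -> f t s <= C * (t - s) `^ mu) ->
  (forall t s, 0 <= s -> s < t -> t <= T ->
    f t s <= f t ((t + s) / 2) + f ((t + s) / 2) s) ->
  forall t s, 0 <= s -> s < t -> t <= T -> f t s <= 0.
Proof.
move=> mu1 H1 H2 t s s0 st tT.
have key n : forall t s, 0 <= s -> s < t -> t <= T ->
    f t s <= 0 + C * (t - s) `^ mu * (2 * halfpow mu) ^+ n.
  elim: n => [|n IH] {s0 st tT}t {}s s0 st tT.
    by rewrite expr0 mulr1 add0r; exact: H1.
  apply: le_trans (H2 t s s0 st tT) _.
  have mid1 : 0 <= (t + s) / 2 by lra.
  have mid2 : (t + s) / 2 < t by lra.
  have mid3 : s < (t + s) / 2 by lra.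
  have mid4 : (t + s) / 2 <= T by lra.
  apply: le_trans (lerD (IH _ _ mid1 mid2 tT) (IH _ _ s0 mid3 mid4)) _.
  have -> : t - (t + s) / 2 = (t - s) / 2 by field.
  have -> : (t + s) / 2 - s = (t - s) / 2 by field.
  have L0 : 0 <= t - s by rewrite subr_ge0 ltW.
  rewrite !powR_half // exprS.
  by rewrite le_eqVlt; apply/orP; left; apply/eqP; ring.
apply: (@geometric_le _ _ (C * (t - s) `^ mu) (2 * halfpow mu)).
  by rewrite mulr_ge0 ?halfpow_ge0 // halfpow_lt_half.
by move=> n; exact: key.
Qed.

(** [m1] and [m2] stand for the norms in B_{-rho} and B_eta of a two-parameter
    family on the grid [tau].  The first obeys a plain sewing estimate; the
    second is recovered from the first by the smoothing of the semigroup over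
    the older half of the interval, which gains the factor [Tl `^ a]. *)
Lemma discrete_sewing (N : nat) (tau : nat -> R) (m1 m2 : nat -> nat -> R)
    (mu a b e nu H Cs K1 K Tl : R) :
  (forall j i, (j < i <= N)%N -> tau j < tau i) ->
  tau N - tau 0%N <= Tl ->
  1 < mu -> 0 < a -> 0 < b -> 0 <= e -> mu = a + b + e ->
  0 <= H -> 0 <= Cs -> 0 <= nu -> 0 <= K1 -> 0 <= K ->
  (forall i, (i < N)%N -> m1 i.+1 i <= nu * (tau i.+1 - tau i) `^ mu /\
    m2 i.+1 i <= nu * (tau i.+1 - tau i) `^ b) ->
  (forall i k j, (j < k)%N -> (k < i <= N)%N ->
    m2 k j <= K * (tau k - tau j) `^ b ->
    [/\ m1 i j <= m1 i k + m1 k j + H * (tau i - tau j) `^ mu,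
        m2 i j <= m2 i k + m2 k j + H * (tau i - tau j) `^ (a + b) &
        m2 i j <= m2 i k + Cs * (tau i - tau k) `^ (- e) * m1 k j +
                  H * (tau i - tau j) `^ (a + b)]) ->
  nu + 2 * H <= (1 - 2 * halfpow mu) * K1 ->
  nu + (2 * H + Cs * 2 `^ e * K1) * Tl `^ a <= (1 - halfpow b) * K ->
  forall i j, (j < i <= N)%N ->
    m1 i j <= K1 * (tau i - tau j) `^ mu /\
    m2 i j <= K * (tau i - tau j) `^ b.
Proof.
move=> mono TN mu1 a0 b0 e0 mue H0 Cs0 nu0 K10 K0 nbr split_ cst1 cst2 i j.
(* Induction on a bound for the number of grid steps between j and i. *)
move: {2}(i - j)%N (leqnn (i - j)) => n.
elim: n i j => [|n IH] i j; first by rewrite leqn0 subn_eq0 => /leq_gtF ->.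
move=> ijn /andP[ji iN].
have mu0 : 0 < mu by rewrite (lt_trans _ mu1).
have hb := halfpow_lt1 b0; have hb0 := halfpow_ge0 b.
have hm0 := halfpow_ge0 mu.
have mono' (p q : nat) : (p <= q <= N)%N -> tau p <= tau q.
  case/andP; rewrite leq_eqVlt => /orP[/eqP->//|pq qN].
  by apply/ltW/mono; rewrite pq.
set L := tau i - tau j.
have L0 : 0 < L by rewrite subr_gt0 mono // ji.
have LT : L <= Tl.
  apply: le_trans TN; rewrite lerB ?mono' ?iN ?leqnn //=.
  by rewrite (leq_trans (ltnW ji)).
(* Choice of the cut: [k.+1] will be the first index lying in the younger half, so that [j, k] and
   [k.+1, i] are both at most half as long as [j, i]. *)
have exk : exists k, tau i - tau k <= L / 2.
  by exists i; rewrite subrr divr_ge0 // ltW.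
case: (ex_minnP exk) => k Hk mink.
have ki : (k <= i)%N by apply: mink; rewrite subrr divr_ge0 // ltW.
have jk : (j < k)%N.
  rewrite ltnNge; apply/negP => kj; move: Hk; apply/negP; rewrite -ltNge.
  have := mono' k j; rewrite kj (leq_trans (ltnW ji) iN) => /(_ isT).
  by rewrite /L in L0 *; lra.
case: k => // k in Hk mink ki jk exk *.
rewrite ltnS in jk.
have Hk' : L / 2 < tau i - tau k.
  by rewrite ltNge; apply/negP => /mink; rewrite ltnn.
have kN : (k < N)%N by rewrite (leq_trans ki).
have [nb1 nb2] := nbr k kN.
have lt_kk : tau k < tau k.+1 by rewrite mono // ltnSn.
have le_jk : tau j <= tau k by rewrite mono' // jk ltnW.
have le_ki : tau k.+1 <= tau i by rewrite mono' // ki.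
have Tla : 0 <= Tl `^ a := powR_ge0 _ _.
have Q0 : 0 <= Cs * 2 `^ e * K1 by rewrite !mulr_ge0 ?powR_ge0.
(* The splitting of [k, i] at [k.+1] asks for the target bound on the single step [k, k.+1]. *)
have nuK : nu <= K.
  have : (1 - halfpow b) * K <= K by rewrite ler_piMl // lerBlDr lerDl.
  have : 0 <= (2 * H + Cs * 2 `^ e * K1) * Tl `^ a.
    by rewrite mulr_ge0 // addr_ge0 // mulr_ge0.
  lra.
have Lmu0 : 0 <= L `^ mu := powR_ge0 _ _.
have Lb0 : 0 <= L `^ b := powR_ge0 _ _.
have Lab : L `^ (a + b) <= Tl `^ a * L `^ b.
  rewrite powR_add // ler_wpM2r //.
  by apply: powR_mono; [exact: ltW|rewrite LT ltW].
have pw p x : 0 < p -> 0 <= x <= L -> x `^ p <= L `^ p.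
  by move=> /ltW p0 xL; rewrite powR_mono.
have ab0 : 0 < a + b by rewrite addr_gt0.
(* [k] and [k.+1] straddle the midpoint, so the step between them is the only
   piece whose length is not halved. *)
have [B1 B2] : m1 i k <= (K1 * halfpow mu + nu + H) * L `^ mu /\
    m2 i k <= (K * halfpow b + nu + H * Tl `^ a) * L `^ b.
  have xk : 0 <= tau k.+1 - tau k <= L by rewrite /L; lra.
  have [E|ki'] := eqVneq k.+1 i.
    rewrite -E; split.
      apply: le_trans nb1 _; apply: (@le_trans _ _ (nu * L `^ mu)).
        by rewrite ler_wpM2l // pw // xk.
      rewrite ler_wpM2r // -[leLHS]addr0 -addrA addrCA lerD2l.
      by rewrite addr_ge0 // mulr_ge0.
    apply: le_trans nb2 _; apply: (@le_trans _ _ (nu * L `^ b)).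
      by rewrite ler_wpM2l // pw // xk.
    rewrite ler_wpM2r // -[leLHS]addr0 -addrA addrCA lerD2l.
    by rewrite addr_ge0 // mulr_ge0.
  have ki2 : (k.+1 < i)%N by rewrite ltn_neqAle ki'.
  have kiN : (k.+1 < i <= N)%N by rewrite ki2.
  have nbK : m2 k.+1 k <= K * (tau k.+1 - tau k) `^ b.
    by apply: le_trans nb2 _; rewrite ler_wpM2r ?powR_ge0.
  have [s1 s2 _] := split_ i k.+1 k (ltnSn k) kiN nbK.
  have ikn : (i - k.+1 <= n)%N.
    move: ijn; rewrite !leq_subLR addSnnS => /leq_trans; apply.
    by rewrite leq_add2r.
  have [h1 h2] := IH i k.+1 ikn kiN.
  have hik : 0 <= tau i - tau k.+1 <= L / 2 by rewrite subr_ge0 le_ki Hk.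
  have h1' : (tau i - tau k.+1) `^ mu <= halfpow mu * L `^ mu.
    by rewrite -powR_half ?(ltW L0) // powR_mono // ltW.
  have h2' : (tau i - tau k.+1) `^ b <= halfpow b * L `^ b.
    by rewrite -powR_half ?(ltW L0) // powR_mono // ltW.
  have x1 : 0 <= tau k.+1 - tau k <= L by rewrite /L; lra.
  have x2 : 0 <= tau i - tau k <= L by rewrite /L; lra.
  split.
    apply: le_trans s1 _; rewrite !mulrDl; apply: lerD; last first.
      by rewrite ler_wpM2l // pw.
    apply: lerD.
      by apply: le_trans h1 _; rewrite -mulrA ler_wpM2l.
    by apply: le_trans nb1 _; rewrite ler_wpM2l // pw.
  apply: le_trans s2 _; rewrite !mulrDl; apply: lerD; last first.
    rewrite -mulrA ler_wpM2l //; apply: le_trans Lab; exact: pw.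
  apply: lerD.
    by apply: le_trans h2 _; rewrite -mulrA ler_wpM2l.
  by apply: le_trans nb2 _; rewrite ler_wpM2l // pw.
have [E|jk'] := eqVneq k j.
  rewrite E in B1 B2; split.
    apply: le_trans B1 _; rewrite -/L ler_wpM2r //.
    have := mulr_ge0 hm0 K10; lra.
  apply: le_trans B2 _; rewrite -/L ler_wpM2r //.
  have := mulr_ge0 H0 Tla; have := mulr_ge0 Q0 Tla; lra.
have jk2 : (j < k)%N by rewrite ltn_neqAle eq_sym jk'.
have ki3 : (k < i <= N)%N by rewrite ki.
have kjn : (k - j <= n)%N.
  move: ijn; rewrite !leq_subLR addnS => h.
  by rewrite -ltnS (leq_trans ki).
have kjN : (j < k <= N)%N by rewrite jk2 (leq_trans (ltnW ki)).
have [h1 h2] := IH k j kjn kjN.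
have [s1 _ s3] := split_ i k j jk2 ki3 h2.
have hkj : 0 <= tau k - tau j <= L / 2 by rewrite subr_ge0 le_jk /=; move: Hk'; rewrite /L; lra.
have h1' : (tau k - tau j) `^ mu <= halfpow mu * L `^ mu.
  by rewrite -powR_half ?(ltW L0) // powR_mono // ltW.
split.
  apply: le_trans s1 _; rewrite -/L.
  have h3 : m1 k j <= K1 * halfpow mu * L `^ mu.
    by apply: le_trans h1 _; rewrite -mulrA ler_wpM2l.
  have := ler_wpM2r Lmu0 cst1; lra.
apply: le_trans s3 _; rewrite -/L.
have h3 : m1 k j <= K1 * L `^ mu.
  apply: le_trans h1 _; rewrite ler_wpM2l // pw //; move: hkj; rewrite /L; lra.
(* The smoothing acts over [k, i], which is longer than L / 2; hence the factor 2^e. *)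
have sm : (tau i - tau k) `^ (- e) <= 2 `^ e * L `^ (- e).
  rewrite !powRN ler_pdivlMr ?powR_gt0 //.
  rewrite ler_pdivrMl ?powR_gt0 //; last by apply: lt_trans Hk'; rewrite divr_gt0.
  rewrite -powRM //; last by apply: ltW; apply: lt_trans Hk'; rewrite divr_gt0.
  apply: powR_mono => //; rewrite ltW //=; move: Hk'; lra.
have h4 : Cs * (tau i - tau k) `^ (- e) * m1 k j <= Cs * 2 `^ e * K1 * (Tl `^ a * L `^ b).
  apply: (@le_trans _ _ (Cs * (2 `^ e * L `^ (- e)) * (K1 * L `^ mu))).
    apply: (@le_trans _ _ (Cs * (tau i - tau k) `^ (- e) * (K1 * L `^ mu))).
      by rewrite ler_wpM2l // mulr_ge0 ?powR_ge0.
    by rewrite ler_wpM2r ?mulr_ge0 // ler_wpM2l.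
  have -> : Cs * (2 `^ e * L `^ (- e)) * (K1 * L `^ mu) =
      Cs * 2 `^ e * K1 * (L `^ (- e) * L `^ mu) by ring.
  rewrite -powR_add // (_ : - e + mu = a + b); last by rewrite mue; ring.
  exact: ler_wpM2l.
have h5 : H * L `^ (a + b) <= H * (Tl `^ a * L `^ b) by rewrite ler_wpM2l.
by have := ler_wpM2r Lb0 cst2; move: B2 h4 h5; lra.
Qed.

End Powers.

(** * The defect of the approximate flow *)

Section TreeAlgebra.
Context {R : realType}.

Lemma optens2_tens a a' b b' (P : R -> R -> coef R a -> coef R a')
    (Q : R -> R -> coef R b -> coef R b') t s (x : coef R a) (y : coef R b) :
  (forall r : R, P t s (r *: x) = r *: P t s x) ->
  (forall r : R, Q t s (r *: y) = r *: Q t s y) ->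
  optens2 P Q t s (tens x y) = tens (P t s x) (Q t s y).
Proof. exact: optens_tens. Qed.

Lemma S_Z n t s (r : R) (x : coef R n) : S_ t s (r *: x) = r *: S_ t s x.
Proof. by apply/funext => k; exact: mulrCA. Qed.

(* [coef R 3] receives both parenthesizations: 1 + 1 + 1 and 1 + (1 + 1)
   are convertible. *)
Lemma tensA3 (a b c : coef R 1) :
  (tens a (tens b c : coef R 2) : coef R 3) = (tens (tens a b : coef R 2) c : coef R 3).
Proof.
apply/funext => k; rewrite /tens mulrA; congr (_ * _ * _).
- congr a; apply/matrixP => i j; rewrite !mxE; congr (k _ _).
  by apply: val_inj; rewrite /= !ord1.
- congr b; apply/matrixP => i j; rewrite !mxE; congr (k _ _).
  by apply: val_inj; rewrite /= !ord1.
- congr c; apply/matrixP => i j; rewrite !mxE; congr (k _ _).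
  by apply: val_inj; rewrite /= !ord1.
Qed.

Lemma tpow2 (x : coef R 1) : tpow 2 x = tens x x.
Proof. by rewrite -{2 3}(tpow1 x) -tpow_add. Qed.

Lemma tpow3 (x : coef R 1) : tpow 3 x = tens (tens x x : coef R 2) x.
Proof. by rewrite -tpow2 -{3}(tpow1 x) -tpow_add. Qed.

Lemma tpow4 (x : coef R 1) : tpow 4 x = tens (tens x x : coef R 2) (tens x x : coef R 2).
Proof. by rewrite -tpow2 -tpow_add. Qed.

Lemma tensZl m n (a : R) (x : coef R m) (y : coef R n) :
  tens (a *: x) y = a *: tens x y.
Proof. by apply/funext => k; rewrite /tens [RHS]mulrA. Qed.

Variables (T eta : R) (X : treeops (R := R)).
Arguments X : clear implicits.
Hypothesis alg : algebraic_relations T eta X.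
Hypothesis XL : forall tau t s, (2 <= leaves tau <= 4)%N -> simplex2 T (t, s) ->
  Lsp (Bsp eta (leaves tau)) (Bsp eta 1) (X tau t s).

Lemma Bsp_tens m n (x : coef R m) (y : coef R n) :
  Bsp eta m x -> Bsp eta n y -> Bsp eta (m + n) (tens x y).
Proof. by move=> /Bsp_ball Hx /Bsp_ball Hy; case: (ball_Bsp (ball_tens Hx Hy)). Qed.

Lemma Bsp_tens2 (x y : coef R 1) :
  Bsp eta 1 x -> Bsp eta 1 y -> Bsp eta 2 (tens x y).
Proof. exact: (@Bsp_tens 1 1). Qed.

Lemma Bsp_tens3 (x : coef R 2) (y : coef R 1) :
  Bsp eta 2 x -> Bsp eta 1 y -> Bsp eta 3 (tens x y).
Proof. exact: (@Bsp_tens 2 1). Qed.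

Lemma Bsp_tens4 (x y : coef R 2) :
  Bsp eta 2 x -> Bsp eta 2 y -> Bsp eta 4 (tens x y).
Proof. exact: (@Bsp_tens 2 2). Qed.

Lemma BspD n (x y : coef R n) : Bsp eta n x -> Bsp eta n y -> Bsp eta n (x + y).
Proof. by move=> /Bsp_ball Hx /Bsp_ball Hy; case: (ball_Bsp (ballD Hx Hy)). Qed.

Lemma BspB n (x y : coef R n) : Bsp eta n x -> Bsp eta n y -> Bsp eta n (x - y).
Proof. by move=> /Bsp_ball Hx /Bsp_ball Hy; case: (ball_Bsp (ballB Hx Hy)). Qed.

Lemma Bsp_sg n t (x : coef R n) : 0 <= t -> Bsp eta n x -> Bsp eta n (sg t x).
Proof. by move=> t0 /Bsp_ball /(ball_sg t0) /ball_Bsp[]. Qed.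

Variables (t u s : R) (x : coef R 1).
Hypothesis tus : simplex3 T (t, u, s).
Hypothesis xE : Bsp eta 1 x.

Let us2 : simplex2 T (u, s).
Proof. by case: tus => /= s0 su ut tT; split => //=; exact: le_trans tT. Qed.

(** The expansion of the flow from s to u at x, by order: p has order zero, v order one, l and r
    order two. The four-leaf terms, of order three, need no name. *)
Let p := sg (u - s) x.
Let v := X vee u s (tpow 2 x).
Let l := X treeL u s (tpow 3 x).
Let r := X treeR u s (tpow 3 x).
Let pp : coef R 2 := tens p p.

Let x2E : Bsp eta 2 (tpow 2 x).
Proof. by rewrite tpow2; exact: Bsp_tens2. Qed.

Let x3E : Bsp eta 3 (tpow 3 x).
Proof. by rewrite tpow3; apply: Bsp_tens3 => //; exact: Bsp_tens2. Qed.

Let x4E : Bsp eta 4 (tpow 4 x).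
Proof. by rewrite tpow4; apply: Bsp_tens4; exact: Bsp_tens2. Qed.

Let vZ (a : R) : X vee u s (a *: tpow 2 x) = a *: v.
Proof. exact: (LspZ _ (XL (tau := vee) isT us2)). Qed.

Let lZ (a : R) : X treeL u s (a *: tpow 3 x) = a *: l.
Proof. exact: (LspZ _ (XL (tau := treeL) isT us2)). Qed.

Let rZ (a : R) : X treeR u s (a *: tpow 3 x) = a *: r.
Proof. exact: (LspZ _ (XL (tau := treeR) isT us2)). Qed.

(** This lemma and the next seven evaluate (i)-(v) on tensor powers of x, where the tensor products
    of operators factor into tensors of p, v, l and r. *)
Lemma rel_vee : tdelta (X vee) t u s (tpow 2 x) = 0.
Proof. by case: alg => + _; exact. Qed.

Lemma rel_L : tdelta (X treeL) t u s (tpow 3 x) = X vee t u (tens v p).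
Proof.
case: alg => _ [/(_ t u s (tpow 3 x) tus x3E) -> _]; rewrite /prod3; congr (X _ _ _ _).
rewrite (tpow_add 2 1 x) optens2_tens ?tpow1 //; try exact: vZ.
by move=> a; exact: S_Z.
Qed.

Lemma rel_R : tdelta (X treeR) t u s (tpow 3 x) = X vee t u (tens p v).
Proof.
case: alg => _ [_ [/(_ t u s (tpow 3 x) tus x3E) -> _]]; rewrite /prod3; congr (X _ _ _ _).
rewrite (tpow_add 1 2 x) optens2_tens ?tpow1 //; try exact: vZ.
by move=> a; exact: S_Z.
Qed.

Lemma rel_VV : tdelta (X (Node vee vee)) t u s (tpow 4 x) =
  X vee t u (tens v v) + X treeR t u (tens v pp) + X treeL t u (tens pp v).
Proof.
case: alg => _ [_ [_ [/(_ t u s (tpow 4 x) tus x4E) -> _]]].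
have spp : S_ u s (tpow 2 x) = pp by rewrite /S_ sg_tpow tpow2.
congr (_ + _ + _); rewrite /prod3; congr (X _ _ _ _);
  rewrite (tpow_add 2 2 x) optens2_tens ?spp //; try exact: vZ;
  by move=> a; rewrite S_Z spp.
Qed.

Lemma rel_4L : tdelta (X (Node treeL Leaf)) t u s (tpow 4 x) =
  X vee t u (tens l p) + X treeL t u (tens v pp).
Proof.
case: alg => _ [_ [_ [_ [/(_ t u s (tpow 4 x) tus x4E) -> _]]]].
have spp : S_ u s (tpow 2 x) = pp by rewrite /S_ sg_tpow tpow2.
congr (_ + _); rewrite /prod3; congr (X _ _ _ _).
  rewrite (tpow_add 3 1 x) optens2_tens ?tpow1 //; try exact: lZ.
  by move=> a; exact: S_Z.
rewrite (tpow_add 2 2 x) optens2_tens ?spp //; try exact: vZ.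
by move=> a; rewrite S_Z spp.
Qed.

Let SVS : optens2 (optens2 (@S_ R 1) (X vee)) (@S_ R 1) u s (tpow 4 x) =
  tens (tens p v : coef R 2) p.
Proof.
have E : optens2 (@S_ R 1) (X vee) u s (tpow 3 x) = tens p v.
  rewrite (tpow_add 1 2 x) optens2_tens ?tpow1 //; try exact: vZ.
  by move=> a; exact: S_Z.
rewrite (tpow_add 3 1 x) optens2_tens ?E ?tpow1 //; last by move=> a; exact: S_Z.
move=> a; rewrite -E (tpow_add 1 2 x) -tensZl !optens2_tens //; try exact: vZ.
- by rewrite S_Z tensZl.
- by move=> b; exact: S_Z.
- by move=> b; exact: S_Z.
Qed.

Lemma rel_4R : tdelta (X (Node treeR Leaf)) t u s (tpow 4 x) =
  X vee t u (tens r p) + X treeL t u (tens (tens p v : coef R 2) p).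
Proof.
case: alg => _ [_ [_ [_ [_ [/(_ t u s (tpow 4 x) tus x4E) -> _]]]]].
congr (_ + _); rewrite /prod3; congr (X _ _ _ _); last exact: SVS.
rewrite (tpow_add 3 1 x) optens2_tens ?tpow1 //; try exact: rZ.
by move=> a; exact: S_Z.
Qed.

Lemma rel_L4 : tdelta (X (Node Leaf treeL)) t u s (tpow 4 x) =
  X vee t u (tens p l) + X treeR t u (tens (tens p v : coef R 2) p).
Proof.
case: alg => _ [_ [_ [_ [_ [_ [/(_ t u s (tpow 4 x) tus x4E) -> _]]]]]].
congr (_ + _); rewrite /prod3; congr (X _ _ _ _); last exact: SVS.
rewrite (tpow_add 1 3 x) optens2_tens ?tpow1 //; try exact: lZ.
by move=> a; exact: S_Z.
Qed.

Lemma rel_R4 : tdelta (X (Node Leaf treeR)) t u s (tpow 4 x) =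
  X vee t u (tens p r) + X treeR t u (tens pp v).
Proof.
case: alg => _ [_ [_ [_ [_ [_ [_ /(_ t u s (tpow 4 x) tus x4E) ->]]]]]].
have spp : S_ u s (tpow 2 x) = pp by rewrite /S_ sg_tpow tpow2.
congr (_ + _); rewrite /prod3; congr (X _ _ _ _).
  rewrite (tpow_add 1 3 x) optens2_tens ?tpow1 //; try exact: rZ.
  by move=> a; exact: S_Z.
rewrite (tpow_add 2 2 x) optens2_tens ?spp //; try exact: vZ.
by move=> a; rewrite S_Z spp.
Qed.

(** [germ] as a function of a vector rather than of a path. *)
Definition incr (t s : R) (y : coef R 1) : coef R 1 :=
  \sum_(tau <- trees) X tau t s (tpow (leaves tau) y).

Variable q : coef R 1.
Hypothesis qE : Bsp eta 1 q.

(** The second tensor power of p + v + (l + r), truncated at order two, minus that of q. It has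
    order three once q agrees with the flow up to order three. *)
Definition coefV : coef R 2 :=
  tens v p + tens p v + tens v v + tens (l + r) p + tens p (l + r) + tens p p -
  tens q q.

(** The analogue for third tensor powers, truncated at order one, hence itself of order two. Order
    by order, two leaves call for three cancellations, three leaves for two, four leaves for one. *)
Definition coefLR : coef R 3 :=
  tens (tens v p : coef R 2) p + tens (tens p v : coef R 2) p +
  tens (tens p p : coef R 2) v + tens (tens p p : coef R 2) p -
  tens (tens q q : coef R 2) q.

(** Each X^tau_{ts} is split at u by its relation. The parts transported by the semigroup cancel
    against the last term on the left, and the others all have the form X^sigma_{tu} applied to a
    tensor; collecting them by sigma produces the two coefficients above. *)
Lemma incr_defect :
  incr t s x - incr t u q - sg (t - u) (incr u s x) =
  X vee t u coefV + X treeL t u coefLR + X treeR t u coefLR +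
  (X (Node vee vee) t u (tpow 4 p - tpow 4 q) +
   X (Node treeL Leaf) t u (tpow 4 p - tpow 4 q) +
   X (Node treeR Leaf) t u (tpow 4 p - tpow 4 q) +
   X (Node Leaf treeL) t u (tpow 4 p - tpow 4 q) +
   X (Node Leaf treeR) t u (tpow 4 p - tpow 4 q)).
Proof.
have tu2 : simplex2 T (t, u).
  by case: tus => /= s0 su ut tT; split => //=; exact: le_trans su.
have us0 : 0 <= u - s by case: tus => /= ? ? ? ?; rewrite subr_ge0.
have pE : Bsp eta 1 p by exact: Bsp_sg.
have vE : Bsp eta 1 v by case: (XL (tau := vee) isT us2) => + _ _; exact.
have lE : Bsp eta 1 l by case: (XL (tau := treeL) isT us2) => + _ _; exact.
have rE : Bsp eta 1 r by case: (XL (tau := treeR) isT us2) => + _ _; exact.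
have spl tau : X tau t s (tpow (leaves tau) x) =
    tdelta (X tau) t u s (tpow (leaves tau) x) +
    X tau t u (tpow (leaves tau) p) + sg (t - u) (X tau u s (tpow (leaves tau) x)).
  by rewrite /tdelta sg_tpow addrAC !subrK.
have LV := XL (tau := vee) isT tu2.
have LL := XL (tau := treeL) isT tu2.
have LR := XL (tau := treeR) isT tu2.
have L4 tau : leaves tau = 4%N -> X tau t u (tpow (leaves tau) p - tpow (leaves tau) q) =
    X tau t u (tpow (leaves tau) p) - X tau t u (tpow (leaves tau) q).
  move=> e; have lt : (2 <= leaves tau <= 4)%N by rewrite e.
  apply: (LspB (XL lt tu2)); rewrite e tpow4; apply: Bsp_tens4; exact: Bsp_tens2.
have := L4 (Node vee vee) erefl; have := L4 (Node treeL Leaf) erefl.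
have := L4 (Node treeR Leaf) erefl; have := L4 (Node Leaf treeL) erefl.
have := L4 (Node Leaf treeR) erefl => /= -> -> -> -> ->.
rewrite /incr /trees !big_cons !big_nil !addr0.
rewrite !spl /= rel_vee rel_L rel_R rel_VV rel_4L rel_4R rel_L4 rel_R4.
rewrite !sgD /coefV /coefLR tensDl tensDr.
have -> : tens v pp = tens (tens v p : coef R 2) p :> coef R 3 by exact: tensA3.
have ppE : Bsp eta 2 (tens p p) by exact: Bsp_tens2.
have pvE : Bsp eta 2 (tens p v) by exact: Bsp_tens2.
have vpE : Bsp eta 2 (tens v p) by exact: Bsp_tens2.
have vvE : Bsp eta 2 (tens v v) by exact: Bsp_tens2.
have qqE : Bsp eta 2 (tens q q) by exact: Bsp_tens2.
have lpE : Bsp eta 2 (tens l p) by exact: Bsp_tens2.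
have plE : Bsp eta 2 (tens p l) by exact: Bsp_tens2.
have rpE : Bsp eta 2 (tens r p) by exact: Bsp_tens2.
have prE : Bsp eta 2 (tens p r) by exact: Bsp_tens2.
have T3 (y : coef R 2) z : Bsp eta 2 y -> Bsp eta 1 z -> Bsp eta 3 (tens y z).
  exact: Bsp_tens3.
have XV : X vee t u (tens v p + tens p v + tens v v + (tens l p + tens r p) +
    (tens p l + tens p r) + tens p p - tens q q) =
  X vee t u (tens v p) + X vee t u (tens p v) + X vee t u (tens v v) +
  (X vee t u (tens l p) + X vee t u (tens r p)) +
  (X vee t u (tens p l) + X vee t u (tens p r)) +
  X vee t u (tens p p) - X vee t u (tens q q).
  rewrite (LspB LV) ?(LspD LV) //; repeat first [assumption | apply: BspD].
have XX (P : coef R 3 -> coef R 1) : Lsp (Bsp eta 3) (Bsp eta 1) P ->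
    P (tens (tens v p : coef R 2) p + tens (tens p v : coef R 2) p +
      tens (tens p p : coef R 2) v + tens (tens p p : coef R 2) p -
      tens (tens q q : coef R 2) q) =
    P (tens (tens v p : coef R 2) p) + P (tens (tens p v : coef R 2) p) +
    P (tens (tens p p : coef R 2) v) + P (tens (tens p p : coef R 2) p) -
    P (tens (tens q q : coef R 2) q).
  move=> LP.
  have := T3 _ _ vpE pE; have := T3 _ _ pvE pE; have := T3 _ _ ppE vE.
  have := T3 _ _ ppE pE; have := T3 _ _ qqE qE.
  move: (tens (tens v p : coef R 2) p : coef R 3) => a.
  move: (tens (tens p v : coef R 2) p : coef R 3) => b.
  move: (tens (tens p p : coef R 2) v : coef R 3) => c.
  move: (tens (tens p p : coef R 2) p : coef R 3) => d.
  move: (tens (tens q q : coef R 2) q : coef R 3) => e He Hd Hc Hb Ha.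
  have Hab : Bsp eta 3 (a + b) by exact: BspD.
  have Habc : Bsp eta 3 (a + b + c) by exact: BspD.
  have Habcd : Bsp eta 3 (a + b + c + d) by exact: BspD.
  by rewrite (LspB LP Habcd He) (LspD LP Habc Hd) (LspD LP Hab Hc) (LspD LP Ha Hb).
rewrite XV (XX (X treeL t u) LL) (XX (X treeR t u) LR).
have tp2 y : tpow (1 + 1) y = tens y y :> coef R 2 by exact: tpow2.
have tp3 y : tpow (1 + 1 + 1) y = tens (tens y y : coef R 2) y by exact: tpow3.
have tp3' y : tpow (1 + (1 + 1)) y = tens (tens y y : coef R 2) y by exact: tpow3.
rewrite !tp2 !tp3 ?tp3'.
rewrite /pp.
(* The values of the operators become opaque atoms; what is left is an additive identity, checked
   coefficient by coefficient. *)
repeat match goal with |- context [sg ?a (X ?b ?c ?d ?z)] => generalize (sg a (X b c d z)) end.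
repeat match goal with |- context [X ?b ?c ?d ?z] => generalize (X b c d z) end.
clear; move=> *; rewrite add0r; apply/funext => k; rewrite !fctE.
ring.
Qed.
End TreeAlgebra.

(** * Bounds on pairs of vectors *)

Section PairBounds.
Context {R : realType}.

Lemma ball_small (alpha : R) n (c : coef R n) :
  (forall e, 0 < e -> ball_ alpha e c) -> c = 0.
Proof.
move=> H; apply: (@ball0_eq0 _ alpha); split=> // s us; rewrite expr0n /=.
rewrite leNgt; apply/negP => P0.
have S0 : 0 < Num.sqrt (psum alpha s c) by rewrite sqrtr_gt0.
have e0 : 0 < Num.sqrt (psum alpha s c) / 2 by rewrite divr_gt0.
have [_ /(_ s us)] := H _ e0.
rewrite exprMn sqr_sqrtr ?(ltW P0) // leNgt => /negP; apply.
by rewrite gtr_pMr // exprn_ilt1 // ?invr_ge0 // invf_lt1 // ltr1n.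
Qed.

Lemma powR_small (p e : R) : 0 < p -> 0 < e ->
  exists2 d : R, 0 < d & forall x, 0 <= x <= d -> x `^ p <= e.
Proof.
move=> p0 e0; exists (e `^ p^-1); first exact: powR_gt0.
move=> x xd; apply: le_trans (powR_mono (ltW p0) xd) _.
by rewrite -powRrM mulVf ?gt_eqF // powRr1 // ltW.
Qed.

(** A bound [A] on two vectors together with the bound [A * zeta] on their
    difference: such pairs multiply like dual numbers, so that growth and
    Lipschitz estimates are obtained in one computation. *)
Definition lip (alpha : R) n (A zeta : R) (x x' : coef R n) : Prop :=
  [/\ ball_ alpha A x, ball_ alpha A x' & ball_ alpha (A * zeta) (x - x')].

Lemma lipW (alpha : R) n A B z y (x x' : coef R n) :
  A <= B -> 0 <= z <= y -> lip alpha A z x x' -> lip alpha B y x x'.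
Proof.
move=> AB /andP[z0 zy] [h1 h2 h3]; have A0 := ball_ge0 h1.
split; [exact: ballW h1|exact: ballW h2|apply: ballW h3].
by rewrite ler_pM.
Qed.

Lemma lipD (alpha : R) n A B z (x x' y y' : coef R n) :
  lip alpha A z x x' -> lip alpha B z y y' -> lip alpha (A + B) z (x + y) (x' + y').
Proof.
move=> [a1 a2 a3] [b1 b2 b3]; split; [exact: ballD|exact: ballD|].
by rewrite mulrDl opprD addrACA; exact: ballD.
Qed.

Lemma lipN (alpha : R) n A z (x x' : coef R n) :
  lip alpha A z x x' -> lip alpha A z (- x) (- x').
Proof.
move=> [a1 a2 a3]; split; [exact: ballN|exact: ballN|].
by rewrite -opprD; exact: ballN.
Qed.

Lemma lipB (alpha : R) n A B z (x x' y y' : coef R n) :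
  lip alpha A z x x' -> lip alpha B z y y' -> lip alpha (A + B) z (x - y) (x' - y').
Proof. by move=> Hx /lipN; exact: lipD. Qed.

Lemma lip_tens (alpha : R) m n A B z w (x x' : coef R m) (y y' : coef R n) :
  0 <= z -> 0 <= w ->
  lip alpha A z x x' -> lip alpha B w y y' ->
  lip alpha (A * B) (z + w) (tens x y) (tens x' y').
Proof.
move=> z0 w0 [a1 a2 a3] [b1 b2 b3]; split; [exact: ball_tens|exact: ball_tens|].
have -> : tens x y - tens x' y' = tens (x - x') y + tens x' (y - y').
  by rewrite tensBl tensBr addrA subrK.
have -> : A * B * (z + w) = A * z * B + A * (B * w) by ring.
by apply: ballD; exact: ball_tens.
Qed.

Lemma lip_sg (alpha : R) n t A z (x x' : coef R n) :
  0 <= t -> lip alpha A z x x' -> lip alpha A z (sg t x) (sg t x').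
Proof.
move=> t0 [a1 a2 a3]; split; [exact: ball_sg|exact: ball_sg|].
by rewrite -sgB; exact: ball_sg.
Qed.

(** Linearity is read off in B_alpha and the size is supplied separately, so that the same linearity
    serves for the estimates in B_eta and in B_{-rho}. *)
Lemma lip_op (alpha beta : R) n m (P : coef R n -> coef R m) C A z (x x' : coef R n) :
  (forall K y, ball_ alpha K y -> ball_ beta (C * K) (P y)) ->
  Lsp (Bsp alpha n) (Bsp alpha m) P ->
  lip alpha A z x x' -> lip beta (C * A) z (P x) (P x').
Proof.
move=> H LP [a1 a2 a3]; split; [exact: H|exact: H|].
rewrite -(LspB LP); [|exact: (ball_Bsp a1).1|exact: (ball_Bsp a2).1].
by rewrite -mulrA; exact: H.
Qed.

End PairBounds.

(** * Uniform bounds on the operators *)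

Section StepEstimate.
Context {R : realType}.
Variables (T eta rho gamma kappa0 : R) (X : treeops (R := R)).
Arguments X : clear implicits.

(** One constant for all trees, valid on the diagonal too. The first factor keeps its exact
    exponent, kappa0 or gamma, and each leaf beyond the second counts for a weaker exponent c, so
    that the same bounds serve at every order c at which the remainders are measured. *)
Definition Xbound (c C : R) : Prop := 0 <= C /\
  forall tau t s, (2 <= leaves tau <= 4)%N -> simplex2 T (t, s) ->
  forall K z, ball_ eta K z ->
    ball_ eta (C * ((t - s) `^ kappa0 * ((t - s) `^ c) ^+ (leaves tau - 2)) * K)
      (X tau t s z) /\
    ball_ (- rho) (C * ((t - s) `^ gamma * ((t - s) `^ c) ^+ (leaves tau - 2)) * K)
      (X tau t s z).

Hypothesis reg : regularity T eta X gamma kappa0 rho.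

Lemma reg_Lsp tau t s : (2 <= leaves tau <= 4)%N -> simplex2 T (t, s) ->
  Lsp (Bsp eta (leaves tau)) (Bsp eta 1) (X tau t s).
Proof. by move=> /reg[[[H _] _] _] ts; exact: (H (t, s)). Qed.

Lemma reg_Lsp_rho tau t s : (2 <= leaves tau <= 4)%N -> simplex2 T (t, s) ->
  Lsp (Bsp eta (leaves tau)) (Bsp (- rho) 1) (X tau t s).
Proof. by move=> /reg[_ [[H _] _]] ts; exact: (H (t, s)). Qed.

(** The bound in [C2] concerns s < t only. On the diagonal the value is recovered from continuity in
    operator norm and from the bound at nearby points off the diagonal, which tends to zero. *)
Lemma X_diag tau t z : 0 < T -> 0 < kappa0 -> (2 <= leaves tau <= 4)%N ->
  0 <= t <= T -> Bsp eta (leaves tau) z -> X tau t t z = 0.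
Proof.
move=> T0 k0 lt /andP[t0 tT] /Bsp_ball; set K := nm _ z => Hz.
have K0 := ball_ge0 Hz.
have tt : simplex2 T (t, t) by split.
have := reg lt; set d := leaves tau in z K Hz K0 lt *.
move=> -[[[_ ct] [C HC]] _].
set mu := d.-1%:R * kappa0 in HC.
have mu0 : 0 < mu by rewrite mulr_gt0 // ltr0n -subn1 subn_gt0; case/andP: lt.
apply: (@ball_small _ eta) => e e0.
have e1 : 0 < e / 2 / (K + 1) by rewrite !divr_gt0 // ltr_wpDl.
have /cvgrPdist_le /(_ _ e1) := ct (t, t) tt.
rewrite near_withinE => /nbhs_ballP[r /= r0 Hr].
have e2 : 0 < e / 2 / (K + 1) / (`|C| + 1) by rewrite !divr_gt0 // ltr_wpDl.
have [r' r'0 Hr'] := powR_small mu0 e2.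
pose dl := Num.min (Num.min (r / 2) r') T.
have dl0 : 0 < dl by rewrite !lt_min r'0 T0 divr_gt0.
have dlr : dl < r.
  by rewrite (@le_lt_trans _ _ (r / 2)) ?ge_min ?lexx //; lra.
have dlr' : dl <= r' by rewrite !ge_min lexx orbT.
have dlT : dl <= T by rewrite ge_min lexx orbT.
(* These points satisfy a - b = dl and stay in [0,T] wherever t lies, endpoints included. *)
pose a := t + dl * ((T - t) / T); pose b := t - dl * (t / T).
have f1 : 0 <= (T - t) / T <= 1.
  by rewrite divr_ge0 ?subr_ge0 ?(ltW T0) //= ler_pdivrMr // mul1r gerBl.
have f2 : 0 <= t / T <= 1.
  by rewrite divr_ge0 ?(ltW T0) //= ler_pdivrMr // mul1r.
have f3 : (T - t) / T + t / T = 1 by field; rewrite gt_eqF.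
have ab : a - b = dl by rewrite /a /b opprB addrC addrA subrK addrC -mulrDr f3 mulr1.
have aT : a <= T.
  have : dl * ((T - t) / T) <= T * ((T - t) / T) by apply: ler_wpM2r; case/andP: f1.
  rewrite [leRHS]mulrCA divff ?gt_eqF // mulr1 /a; lra.
have b0 : 0 <= b.
  have : dl * (t / T) <= T * (t / T) by apply: ler_wpM2r; case/andP: f2.
  rewrite [leRHS]mulrCA divff ?gt_eqF // mulr1 /b; lra.
have sab : simplex2 T (a, b) by split => //=; rewrite -subr_ge0 ab ltW.
have near_ab : ball (t, t) r (a, b).
  split; rewrite /ball /= /ball_.
    rewrite /a opprD addrA subrr sub0r normrN normrM (ger0_norm (ltW dl0)).
    rewrite ger0_norm; last by case/andP: f1.
    by apply: le_lt_trans dlr; rewrite ler_piMr ?(ltW dl0) //; case/andP: f1.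
  rewrite /b opprB addrCA subrr addr0 normrM (ger0_norm (ltW dl0)).
  rewrite ger0_norm; last by case/andP: f2.
  by apply: le_lt_trans dlr; rewrite ler_piMr ?(ltW dl0) //; case/andP: f2.
have Lab := reg_Lsp lt sab; have Ltt := reg_Lsp lt tt.
have N1 := Hr _ near_ab sab; rewrite /= sub0r normrN in N1.
have N1' : nm (Lsp (Bsp eta d) (Bsp eta 1)) (X tau a b - X tau t t) <= e / 2 / (K + 1).
  exact: le_trans (ler_norm _) N1.
have N2 : nm (Lsp (Bsp eta d) (Bsp eta 1)) (X tau a b) <= e / 2 / (K + 1).
  apply: le_trans (HC a b b0 _ aT) _; first by rewrite -subr_gt0 ab.
  rewrite ab; apply: (@le_trans _ _ ((`|C| + 1) * (e / 2 / (K + 1) / (`|C| + 1)))).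
    apply: (@le_trans _ _ ((`|C| + 1) * dl `^ mu)).
      by rewrite ler_wpM2r ?powR_ge0 // (le_trans (ler_norm _)) // lerDl.
    by rewrite ler_wpM2l ?addr_ge0 // Hr' // (ltW dl0) dlr'.
  by rewrite mulrC divfK // gt_eqF // ltr_wpDl.
have B1 := Lsp_ball (Lsp_sub Lab Ltt) N1' Hz.
have B2 := Lsp_ball Lab N2 Hz.
have -> : X tau t t z = X tau a b z - (X tau a b - X tau t t) z.
  by rewrite (_ : (X tau a b - X tau t t) z = X tau a b z - X tau t t z) // subKr.
apply: ballW (ballB B2 B1).
have : e / 2 / (K + 1) * K <= e / 2.
  rewrite mulrAC ler_pdivrMr ?ltr_wpDl // ler_wpM2l ?divr_ge0 ?(ltW e0) //.
  by rewrite lerDl.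
lra.
Qed.

End StepEstimate.

(** * One-step estimate of the defect *)

Section StepEstimate.
Context {R : realType}.
Variables (T eta rho gamma kappa0 : R) (X : treeops (R := R)).
Arguments X : clear implicits.
Hypothesis reg : regularity T eta X gamma kappa0 rho.

Lemma powR_powR_nat (L p : R) n : (L `^ p) ^+ n = L `^ (p * n%:R).
Proof. by rewrite -powR_mulrn ?powR_ge0 // -powRrM. Qed.

(** Lengths are at most one, so exponents may be lowered from kappa0 to c; the constants of the
    eight trees are added up. *)
Lemma Xbound_exists c : 0 < T <= 1 -> 0 < kappa0 -> 0 < gamma -> 0 < c <= kappa0 ->
  exists C, Xbound T eta rho gamma kappa0 X c C.
Proof.
move=> /andP[T0 T1] k0 g0 /andP[c0 ck].
pose P tau C := forall t s, simplex2 T (t, s) ->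
  forall K z, ball_ eta K z ->
    ball_ eta (C * ((t - s) `^ kappa0 * ((t - s) `^ c) ^+ (leaves tau - 2)) * K)
      (X tau t s z) /\
    ball_ (- rho) (C * ((t - s) `^ gamma * ((t - s) `^ c) ^+ (leaves tau - 2)) * K)
      (X tau t s z).
have P1 tau : (2 <= leaves tau <= 4)%N -> exists2 C, 0 <= C & P tau C.
  move=> lt; have [[_ [C1 HC1]] [_ [C2 HC2]]] := reg lt.
  exists (`|C1| + `|C2|); first exact: addr_ge0.
  move=> t s ts K z Hz; have K0 := ball_ge0 Hz.
  have [s0 st tT] := ts; rewrite /= in s0 st tT.
  have L0 : 0 <= t - s by rewrite subr_ge0.
  have [E|ts'] := eqVneq t s.
    subst s; rewrite (X_diag reg T0 k0 lt _ (ball_Bsp Hz).1); last by rewrite s0 tT.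
    by split; apply: ball0; rewrite !mulr_ge0 ?addr_ge0 ?exprn_ge0 ?powR_ge0.
  have lts : s < t by rewrite lt_neqAle eq_sym ts' st.
  have Lp : 0 < t - s by rewrite subr_gt0.
  have L1 : 0 < t - s <= 1 by rewrite Lp /=; lra.
  have dE : ((leaves tau).-1)%:R = (leaves tau - 2)%:R + 1 :> R.
    case: (leaves tau) lt => [|[|d]] //= _.
    by rewrite subSS subSS subn0 -[RHS](natrD _ d 1) addn1.
  have dk : c * (leaves tau - 2)%:R <= kappa0 * (leaves tau - 2)%:R.
    by rewrite ler_wpM2r.
  have bd (p q C D : R) : q + c * (leaves tau - 2)%:R <= p -> `|C| <= D ->
      C * (t - s) `^ p <= D * ((t - s) `^ q * ((t - s) `^ c) ^+ (leaves tau - 2)).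
    move=> qp CD; rewrite powR_powR_nat -powR_add //.
    apply: (@le_trans _ _ (D * (t - s) `^ p)).
      by rewrite ler_wpM2r ?powR_ge0 // (le_trans (ler_norm _)).
    by rewrite ler_wpM2l ?(le_trans (normr_ge0 _) CD) // ger_powR.
  split.
    apply: (Lsp_ball (reg_Lsp reg lt ts)) => //.
    apply: le_trans (HC1 t s s0 lts tT) _; apply: bd; rewrite ?lerDl //.
    by rewrite dE mulrDl mul1r [leRHS]addrC lerD2l [leRHS]mulrC.
  apply: (Lsp_ball (reg_Lsp_rho reg lt ts)) => //.
  apply: le_trans (HC2 t s s0 lts tT) _; apply: bd; rewrite ?lerDr //.
  by rewrite dE addrK lerD2l [leRHS]mulrC.
have [C C0 HC] : exists2 C, 0 <= C & forall tau, List.In tau trees -> P tau C.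
  have : forall tau, List.In tau trees -> exists2 C, 0 <= C & P tau C.
    by move=> tau /treesP; exact: P1.
  elim: trees => [|tau l IH] H; first by exists 0.
  have [|C1 C10 HC1] := IH; first by move=> t ht; apply: H; right.
  have [C2 C20 HC2] := H tau (or_introl erefl).
  exists (C1 + C2); first exact: addr_ge0.
  have mon t C D : C <= D -> P t C -> P t D.
    move=> CD HP a b ab K z Hz; have [h1 h2] := HP a b ab K z Hz.
    have K0 := ball_ge0 Hz.
    split; [apply: ballW h1|apply: ballW h2];
      by rewrite !ler_wpM2r ?mulr_ge0 ?exprn_ge0 ?powR_ge0.
  move=> t [<-|/HC1]; first by apply: mon HC2; rewrite lerDr.
  by apply: mon; rewrite lerDl.
exists C; split=> // tau t s lt ts K z Hz.
by apply: HC => //; exact/treesP.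
Qed.

Hypothesis alg : algebraic_relations T eta X.

Definition flow (t s : R) (x : coef R 1) : coef R 1 := sg (t - s) x + incr X t s x.

(** For q = phi_{us} x this is the flow defect phi_{ts} x - phi_{tu} phi_{us} x. A general q allows
    for the value at u of a path that follows the flow only approximately. *)
Definition defect (t u s : R) (x q : coef R 1) : coef R 1 :=
  flow t s x - flow t u q - sg (t - u) (flow u s x - q).

Lemma defectE t u s x q :
  defect t u s x q = incr X t s x - incr X t u q - sg (t - u) (incr X u s x).
Proof.
rewrite /defect /flow !sgB sgD sg_sg (_ : t - u + (u - s) = t - s); last by ring.
by apply/funext => k; rewrite !fctE; ring.
Qed.

Variables (c C : R).
Hypotheses (T1 : 0 < T <= 1) (k00 : 0 < kappa0) (g0 : 0 < gamma) (ck : 0 < c <= kappa0).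
Hypothesis HX : Xbound T eta rho gamma kappa0 X c C.

(** A common bound for the pieces of the expansion of q: r for the semigroup term, C r^2 for the
    two-leaf tree, 2 C r^3 for the pair of three-leaf trees, and 5 C r^4 + K for the five four-leaf
    trees together with the remainder. *)
Definition sizeB (r K : R) : R := r + C * r ^+ 2 + 2 * (C * r ^+ 3) + (5 * (C * r ^+ 4) + K).

(** The coefficients come from [lip_coefV], [lip_coefLR] and [lip_coef4]: 7 for the single two-leaf
    tree, 66 = 2 * 33 for the three-leaf trees, 60 = 5 * 12 for the four-leaf ones. *)
Definition stepB (r K : R) : R :=
  C * (7 * sizeB r K ^+ 2 + 66 * sizeB r K ^+ 3 + 60 * sizeB r K ^+ 4).

Lemma stepB_ge0 r K : 0 <= r -> 0 <= K -> 0 <= stepB r K.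
Proof.
case: HX => C0 _ r0 K0.
have B0 : 0 <= sizeB r K by rewrite /sizeB !addr_ge0 ?mulr_ge0 ?exprn_ge0.
by rewrite /stepB mulr_ge0 // !addr_ge0 // mulr_ge0 ?exprn_ge0.
Qed.

Lemma lip_tpow n A z (x x' : coef R 1) : 0 <= z ->
  lip eta A z x x' -> lip eta (A ^+ n.+1) (n.+1%:R * z) (tpow n.+1 x) (tpow n.+1 x').
Proof.
move=> z0 H; elim: n => [|n IH]; first by rewrite !tpow1 expr1 mul1r.
rewrite exprS -[n.+2]add1n !tpow_add !tpow1 natrD mulrDl mul1r.
by apply: lip_tens => //; rewrite mulr_ge0.
Qed.

(** With p, v, w, e of orders 0, 1, 2, 3, only products of total order at least three survive. *)
Lemma coefV_expand (p v w q e : coef R 1) : q = p + v + w + e ->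
  tens v p + tens p v + tens v v + tens w p + tens p w + tens p p - tens q q =
  - (tens v w + tens w v + tens w w + tens e q + tens (p + v + w) e).
Proof. by move=> ->; apply/funext => k; rewrite /tens !fctE; ring. Qed.

(** Here d has order one and f order two, so that every surviving product has order at least two. *)
Lemma coefLR_expand (p v f q d : coef R 1) : q = p + d -> v = d - f ->
  tens (tens v p : coef R 2) p + tens (tens p v : coef R 2) p +
  tens (tens p p : coef R 2) v + tens (tens p p : coef R 2) p -
  tens (tens q q : coef R 2) q =
  - (tens (tens f p : coef R 2) p + tens (tens p f : coef R 2) p +
     tens (tens p p : coef R 2) f + tens (tens d d : coef R 2) q +
     tens (tens d p : coef R 2) d + tens (tens p d : coef R 2) d).
Proof. by move=> -> ->; apply/funext => k; rewrite /tens !fctE; ring. Qed.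

Lemma tpow4_sub (p q d : coef R 1) : q = p + d ->
  tpow 4 p - tpow 4 q =
  - (tens (tens d q + tens p d : coef R 2) (tens q q : coef R 2) +
     tens (tens p p : coef R 2) (tens d q + tens p d : coef R 2)).
Proof. by move=> ->; rewrite !tpow4; apply/funext => k; rewrite /tens !fctE; ring. Qed.

Section Coefficients.
Variables (B m y : R) (p p' v v' w w' e e' q q' : coef R 1).
Hypotheses (m01 : 0 <= m <= 1) (y0 : 0 <= y) (B0 : 0 <= B).
Hypotheses (Hp : lip eta B y p p') (Hv : lip eta (B * m) y v v')
  (Hw : lip eta (B * m ^+ 2) y w w') (He : lip eta (B * m ^+ 3) y e e')
  (Hq : lip eta B y q q').

Let m0 : 0 <= m. Proof. by case/andP: m01. Qed.
Let pow_le i j : (i <= j)%N -> B ^+ 2 * m ^+ j <= B ^+ 2 * m ^+ i.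
Proof. by move=> ij; rewrite ler_wpM2l ?exprn_ge0 // ler_wiXn2l //; case/andP: m01. Qed.
Let powB_le i j : (i <= j)%N -> B * m ^+ j <= B * m ^+ i.
Proof. by move=> ij; rewrite ler_wpM2l // ler_wiXn2l //; case/andP: m01. Qed.
Let yy : 0 <= y + y <= 2 * y.
Proof. by rewrite addr_ge0 //= mulr_natl mulr2n. Qed.

(** The constant is 1 + 1 + 1 + 1 + 3, the last term containing the sum of three pieces. *)
Lemma lip_coefV : lip eta (7 * B ^+ 2 * m ^+ 3) (2 * y)
  (- (tens v w + tens w v + tens w w + tens e q + tens (p + v + w) e))
  (- (tens v' w' + tens w' v' + tens w' w' + tens e' q' + tens (p' + v' + w') e')).
Proof.
have s3 : lip eta (3 * B) y (p + v + w) (p' + v' + w').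
  apply: lipW (lipD (lipD Hp Hv) Hw); last by rewrite y0 lexx.
  by have := @powB_le 0 1 isT; have := @powB_le 0 2 isT; rewrite expr0 expr1; lra.
have h1 := lipW _ yy (lip_tens y0 y0 Hv Hw).
have h2 := lipW _ yy (lip_tens y0 y0 Hw Hv).
have h3 := lipW _ yy (lip_tens y0 y0 Hw Hw).
have h4 := lipW _ yy (lip_tens y0 y0 He Hq).
have h5 := lipW _ yy (lip_tens y0 y0 s3 He).
apply: lipN.
have {}h1 := h1 (B ^+ 2 * m ^+ 3) ltac:(lra).
have {}h2 := h2 (B ^+ 2 * m ^+ 3) ltac:(lra).
have {}h3 := h3 (B ^+ 2 * m ^+ 3) ltac:(have := @pow_le 3 4 isT; lra).
have {}h4 := h4 (B ^+ 2 * m ^+ 3) ltac:(lra).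
have {}h5 := h5 (3 * (B ^+ 2 * m ^+ 3)) ltac:(lra).
apply: lipW (lipD (lipD (lipD (lipD h1 h2) h3) h4) h5); last by rewrite lexx mulr_ge0.
lra.
Qed.

Lemma lip_incr_first : lip eta (3 * B * m) y (v + w + e) (v' + w' + e').
Proof.
apply: lipW (lipD (lipD Hv Hw) He); last by rewrite y0 lexx.
by have := @powB_le 1 2 isT; have := @powB_le 1 3 isT; rewrite expr1; lra.
Qed.

Lemma lip_incr_second : lip eta (2 * B * m ^+ 2) y (w + e) (w' + e').
Proof.
apply: lipW (lipD Hw He); last by rewrite y0 lexx.
by have := @powB_le 2 3 isT; lra.
Qed.

Let tens3 A1 A2 A3 (a a' b b' g g' : coef R 1) D :
  A1 * A2 * A3 <= D ->
  lip eta A1 y a a' -> lip eta A2 y b b' -> lip eta A3 y g g' ->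
  lip eta D (3 * y) (tens (tens a b : coef R 2) g : coef R 3)
    (tens (tens a' b' : coef R 2) g' : coef R 3).
Proof.
move=> AD Ha Hb Hc; have Hab := lip_tens y0 y0 Ha Hb.
have y2 : 0 <= y + y by rewrite addr_ge0.
by apply: lipW (lip_tens y2 y0 Hab Hc) => //; apply/andP; split; lra.
Qed.

Variables (d d' f f' : coef R 1).
Hypotheses (Hd : lip eta (3 * B * m) y d d') (Hf : lip eta (2 * B * m ^+ 2) y f f').

(** The constant is 3 * 2 + 3 * 9: three products with one factor of order two, three with two
    factors of order one. *)
Lemma lip_coefLR :
  lip eta (33 * B ^+ 3 * m ^+ 2) (3 * y)
  (- (tens (tens f p : coef R 2) p + tens (tens p f : coef R 2) p +
     tens (tens p p : coef R 2) f + tens (tens d d : coef R 2) q +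
     tens (tens d p : coef R 2) d + tens (tens p d : coef R 2) d) : coef R 3)
  (- (tens (tens f' p' : coef R 2) p' + tens (tens p' f' : coef R 2) p' +
     tens (tens p' p' : coef R 2) f' + tens (tens d' d' : coef R 2) q' +
     tens (tens d' p' : coef R 2) d' + tens (tens p' d' : coef R 2) d') : coef R 3).
Proof.
have e1 : 2 * B * m ^+ 2 * B * B <= 2 * B ^+ 3 * m ^+ 2 by lra.
have e2 : B * (2 * B * m ^+ 2) * B <= 2 * B ^+ 3 * m ^+ 2 by lra.
have e3 : B * B * (2 * B * m ^+ 2) <= 2 * B ^+ 3 * m ^+ 2 by lra.
have e4 : 3 * B * m * (3 * B * m) * B <= 9 * B ^+ 3 * m ^+ 2 by lra.
have e5 : 3 * B * m * B * (3 * B * m) <= 9 * B ^+ 3 * m ^+ 2 by lra.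
have e6 : B * (3 * B * m) * (3 * B * m) <= 9 * B ^+ 3 * m ^+ 2 by lra.
have h1 := tens3 e1 Hf Hp Hp.
have h2 := tens3 e2 Hp Hf Hp.
have h3 := tens3 e3 Hp Hp Hf.
have h4 := tens3 e4 Hd Hd Hq.
have h5 := tens3 e5 Hd Hp Hd.
have h6 := tens3 e6 Hp Hd Hd.
apply: lipN.
apply: lipW (lipD (lipD (lipD (lipD (lipD h1 h2) h3) h4) h5) h6); first by lra.
by rewrite lexx mulr_ge0.
Qed.

Lemma lip_coef4 :
  lip eta (12 * B ^+ 4 * m) (4 * y)
  (- (tens (tens d q + tens p d : coef R 2) (tens q q : coef R 2) +
     tens (tens p p : coef R 2) (tens d q + tens p d : coef R 2)) : coef R 4)
  (- (tens (tens d' q' + tens p' d' : coef R 2) (tens q' q' : coef R 2) +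
     tens (tens p' p' : coef R 2) (tens d' q' + tens p' d' : coef R 2)) : coef R 4).
Proof.
have h1 := lipD (lip_tens y0 y0 Hd Hq) (lip_tens y0 y0 Hp Hd).
have y2 : 0 <= y + y by rewrite addr_ge0.
have h2 := lip_tens y2 y2 h1 (lip_tens y0 y0 Hq Hq).
have h3 := lip_tens y2 y2 (lip_tens y0 y0 Hp Hp) h1.
have e4 : 0 <= y + y + (y + y) <= 4 * y by apply/andP; split; lra.
apply: lipN; apply: lipW e4 (lipD h2 h3); lra.
Qed.

End Coefficients.

(** The hypothesis on the remainder makes q agree with the expansion of the flow up to order three.
    Tensor powers multiply the relative Lipschitz factor by at most four, hence the uniform 4 z, and
    the coefficients are themselves of degree two, three and four in such pieces. *)
Lemma coef_lip t u s x x' q q' r K z :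
  simplex3 T (t, u, s) -> 0 <= z -> 0 <= K ->
  lip eta r z x x' -> lip eta r z q q' ->
  lip eta (K * ((u - s) `^ c) ^+ 3) z (flow u s x - q) (flow u s x' - q') ->
  let B := sizeB r K in let lam := (u - s) `^ c in
  [/\ lip eta (7 * B ^+ 2 * lam ^+ 3) (2 * (4 * z)) (coefV X u s x q) (coefV X u s x' q'),
      lip eta (33 * B ^+ 3 * lam ^+ 2) (3 * (4 * z)) (coefLR X u s x q) (coefLR X u s x' q') &
      lip eta (12 * B ^+ 4 * lam) (4 * (4 * z))
        (tpow 4 (sg (u - s) x) - tpow 4 q) (tpow 4 (sg (u - s) x') - tpow 4 q')].
Proof.
move=> tus z0 K0 Hx Hq Hm B lam; have [C0 HXb] := HX.
have [/= s0 su ut tT] := tus.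
have us2 : simplex2 T (u, s) by split => //=; exact: le_trans tT.
have XL := fun tau t s => @reg_Lsp _ _ _ _ _ _ _ reg tau t s.
have [c0 ck0] := andP ck; have [T0 T1'] := andP T1.
have lam0 : 0 <= lam := powR_ge0 _ _.
have lam1 : lam <= 1.
  by have := @powR_mono R (u - s) 1 c; rewrite powR1; apply; [exact: ltW|apply/andP; split; lra].
have klam : (u - s) `^ kappa0 <= lam.
  by apply: powRB_le => //; apply/andP; split; lra.
have r0 : 0 <= r by case: Hx => /ball_ge0.
have B0 : 0 <= B by rewrite /B /sizeB !addr_ge0 ?mulr_ge0 ?exprn_ge0.
have Xus tau A w a a' : (2 <= leaves tau <= 4)%N -> 0 <= w -> lip eta A w a a' ->
    lip eta (C * lam ^+ (leaves tau - 2).+1 * A) w (X tau u s a) (X tau u s a').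
  move=> lt w0 Ha; have A0 : 0 <= A by case: Ha => /ball_ge0.
  have h : lip eta (C * ((u - s) `^ kappa0 * lam ^+ (leaves tau - 2)) * A) w
      (X tau u s a) (X tau u s a').
    apply: (lip_op _ (XL tau u s lt us2) Ha) => L b Hb.
    by case: (HXb tau u s lt us2 L b Hb).
  apply: lipW h; last by rewrite w0 lexx.
  by rewrite ler_wpM2r // ler_wpM2l // exprS ler_wpM2r ?exprn_ge0.
pose p_ (a : coef R 1) : coef R 1 := sg (u - s) a.
pose v_ (a : coef R 1) : coef R 1 := X vee u s (tpow 2 a).
pose w_ (a : coef R 1) : coef R 1 := X treeL u s (tpow 3 a) + X treeR u s (tpow 3 a).
pose g_ (a : coef R 1) : coef R 1 :=
  X (Node vee vee) u s (tpow 4 a) + X (Node treeL Leaf) u s (tpow 4 a) +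
  X (Node treeR Leaf) u s (tpow 4 a) + X (Node Leaf treeL) u s (tpow 4 a) +
  X (Node Leaf treeR) u s (tpow 4 a).
(* The last piece is defined as whatever makes the expansion of b exact: four-leaf terms minus the
   remainder, both of order three. *)
pose e_ (a b : coef R 1) : coef R 1 := g_ a - (flow u s a - b).
have qE (a b : coef R 1) : b = p_ a + v_ a + w_ a + e_ a b.
  have iE : incr X u s a = v_ a + (X treeL u s (tpow 3 a) + (X treeR u s (tpow 3 a) +
      (X (Node vee vee) u s (tpow 4 a) + (X (Node treeL Leaf) u s (tpow 4 a) +
      (X (Node treeR Leaf) u s (tpow 4 a) + (X (Node Leaf treeL) u s (tpow 4 a) +
      X (Node Leaf treeR) u s (tpow 4 a))))))).
    by rewrite /incr /trees !big_cons big_nil addr0.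
  rewrite /e_ /flow iE /p_ /w_ /g_; move: (v_ a).
  repeat match goal with |- context [X ?b ?c ?d ?z] => generalize (X b c d z) end.
  by move=> *; apply/funext => k; rewrite !fctE; ring.
have y4 : 0 <= 4 * z by rewrite mulr_ge0.
have n4 n : (n <= 4)%N -> 0 <= n%:R * z <= 4 * z.
  by move=> n4; rewrite mulr_ge0 //= ler_wpM2r // ler_nat.
have n0 n : 0 <= n%:R * z by rewrite mulr_ge0.
have Cr n : 0 <= C * r ^+ n by rewrite mulr_ge0 ?exprn_ge0.
have Cr2 := Cr 2%N; have Cr3 := Cr 3%N; have Cr4 := Cr 4%N.
have lB i D : D <= B -> 0 <= D -> D * lam ^+ i <= B * lam ^+ i.
  by move=> DB D0; rewrite ler_wpM2r ?exprn_ge0.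
have Hp : lip eta B (4 * z) (p_ x) (p_ x').
  apply: lipW (lip_sg _ Hx); rewrite ?subr_ge0 //; last by rewrite z0 /=; lra.
  by rewrite /B /sizeB; lra.
have Hq' : lip eta B (4 * z) q q'.
  apply: lipW Hq; last by rewrite z0 /=; lra.
  by rewrite /B /sizeB; lra.
have Hv : lip eta (B * lam) (4 * z) (v_ x) (v_ x').
  apply: lipW (@Xus vee _ _ _ _ isT (n0 2%N) (lip_tpow 1 z0 Hx)); last exact: n4.
  rewrite /= expr1 mulrAC; apply: (lB 1%N); last by [].
  by rewrite /B /sizeB; lra.
have Hw : lip eta (B * lam ^+ 2) (4 * z) (w_ x) (w_ x').
  apply: lipW (lipD (@Xus treeL _ _ _ _ isT (n0 3%N) (lip_tpow 2 z0 Hx))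
    (@Xus treeR _ _ _ _ isT (n0 3%N) (lip_tpow 2 z0 Hx))); last exact: n4.
  apply: (@le_trans _ _ (2 * (C * r ^+ 3) * lam ^+ 2)); first by rewrite /=; lra.
  by apply: lB; rewrite ?mulr_ge0 ?exprn_ge0 // /B /sizeB; lra.
have He : lip eta (B * lam ^+ 3) (4 * z) (e_ x q) (e_ x' q').
  have H4 tau : leaves tau = 4%N ->
      lip eta (C * lam ^+ 3 * r ^+ 4) (4 * z) (X tau u s (tpow (leaves tau) x))
        (X tau u s (tpow (leaves tau) x')).
    move=> lt; have lt' : (2 <= leaves tau <= 4)%N by rewrite lt.
    have hp : lip eta (r ^+ 4) (4 * z) (tpow (leaves tau) x) (tpow (leaves tau) x').
      by rewrite lt; exact: (lip_tpow 3 z0 Hx).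
    by have := Xus tau _ _ _ _ lt' y4 hp; rewrite [(leaves tau - 2)%N](_ : _ = 2%N) // lt.
  have Hm' : lip eta (K * lam ^+ 3) (4 * z) (flow u s x - q) (flow u s x' - q').
    by apply: lipW Hm => //; rewrite z0 /=; lra.
  apply: lipW (lipB (lipD (lipD (lipD (lipD (H4 (Node vee vee) erefl)
    (H4 (Node treeL Leaf) erefl)) (H4 (Node treeR Leaf) erefl))
    (H4 (Node Leaf treeL) erefl)) (H4 (Node Leaf treeR) erefl)) Hm');
    last by rewrite y4 lexx.
  apply: (@le_trans _ _ ((5 * (C * r ^+ 4) + K) * lam ^+ 3)); first by lra.
  by apply: lB; rewrite ?addr_ge0 ?mulr_ge0 ?exprn_ge0 // /B /sizeB; lra.
have m01 : 0 <= lam <= 1 by rewrite lam0.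
have Hd := lip_incr_first m01 y4 B0 Hv Hw He.
have Hf := lip_incr_second m01 y4 B0 Hw He.
have A1 := lip_coefV m01 y4 B0 Hp Hv Hw He Hq'.
have A3 := lip_coefLR y4 Hp Hq' Hd Hf.
have A4 := lip_coef4 y4 Hp Hq' Hd.
have E1 (a b : coef R 1) : coefV X u s a b =
    - (tens (v_ a) (w_ a) + tens (w_ a) (v_ a) + tens (w_ a) (w_ a) +
       tens (e_ a b) b + tens (p_ a + v_ a + w_ a) (e_ a b)).
  by apply: coefV_expand; exact: qE.
have qE' (a b : coef R 1) : b = p_ a + (v_ a + w_ a + e_ a b).
  by rewrite (addrA (p_ a) (v_ a + w_ a)) (addrA (p_ a) (v_ a)); exact: qE.
have vE (a b : coef R 1) : v_ a = v_ a + w_ a + e_ a b - (w_ a + e_ a b).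
  by rewrite -(addrA (v_ a)) addrK.
have E3 (a b : coef R 1) := coefLR_expand (qE' a b) (vE a b).
have E4 (a b : coef R 1) := tpow4_sub (qE' a b).
split.
- by rewrite !E1.
- have -> : coefLR X u s x q = _ := E3 x q.
  by have -> : coefLR X u s x' q' = _ := E3 x' q'.
- by rewrite !E4.
Qed.

(** The orders always add up to three: X^vee meets a coefficient of order three, the three-leaf
    trees bring one extra power and meet order two, the four-leaf trees bring two and meet order
    one. Taking x = x' and z = 0 yields the size estimate, and distinct vectors the stability
    estimate. *)
Lemma step_lip t u s x x' q q' r K z :
  simplex3 T (t, u, s) -> 0 <= z -> 0 <= K ->
  lip eta r z x x' -> lip eta r z q q' ->
  lip eta (K * ((u - s) `^ c) ^+ 3) z (flow u s x - q) (flow u s x' - q') ->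
  lip eta (stepB r K * ((t - s) `^ kappa0 * ((t - s) `^ c) ^+ 3)) (16 * z)
    (defect t u s x q) (defect t u s x' q') /\
  lip (- rho) (stepB r K * ((t - s) `^ gamma * ((t - s) `^ c) ^+ 3)) (16 * z)
    (defect t u s x q) (defect t u s x' q').
Proof.
move=> tus z0 K0 Hx Hq Hm; have [C0 HXb] := HX.
have [/= s0 su ut tT] := tus.
have tu2 : simplex2 T (t, u) by split => //=; exact: le_trans su.
have XL := fun tau t s => @reg_Lsp _ _ _ _ _ _ _ reg tau t s.
have [c0 ck0] := andP ck; have [T0 T1'] := andP T1.
have [A1 A3 A4] := coef_lip tus z0 K0 Hx Hq Hm.
set B := sizeB r K in A1 A3 A4; set lam := (u - s) `^ c in A1 A3 A4.
set sig := (t - u) `^ c; set Lam := (t - s) `^ c.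
have lam0 : 0 <= lam := powR_ge0 _ _.
have sig0 : 0 <= sig := powR_ge0 _ _.
have lamL : lam <= Lam by apply: powR_mono; [exact: ltW|rewrite subr_ge0 su lerB].
have sigL : sig <= Lam by apply: powR_mono; [exact: ltW|rewrite subr_ge0 ut lerB].
have Lam0 : 0 <= Lam := powR_ge0 _ _.
have r0 : 0 <= r by case: Hx => /ball_ge0.
have B0 : 0 <= B by rewrite /B /sizeB !addr_ge0 ?mulr_ge0 ?exprn_ge0.
have y4 : 0 <= 4 * z by rewrite mulr_ge0.
have ED (a b : coef R 1) : Bsp eta 1 a -> Bsp eta 1 b -> defect t u s a b =
    X vee t u (coefV X u s a b) + X treeL t u (coefLR X u s a b) +
    X treeR t u (coefLR X u s a b) +
  (X (Node vee vee) t u (tpow 4 (sg (u - s) a) - tpow 4 b) +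
   X (Node treeL Leaf) t u (tpow 4 (sg (u - s) a) - tpow 4 b) +
   X (Node treeR Leaf) t u (tpow 4 (sg (u - s) a) - tpow 4 b) +
   X (Node Leaf treeL) t u (tpow 4 (sg (u - s) a) - tpow 4 b) +
   X (Node Leaf treeR) t u (tpow 4 (sg (u - s) a) - tpow 4 b)).
  by move=> Ha Hb; rewrite defectE (incr_defect alg XL tus Ha Hb).
(* The two target spaces differ only by the leading power [Pw], so the summation over the trees is
   carried out once. *)
have fin beta Pw : 0 <= Pw ->
    (forall tau A w a a', (2 <= leaves tau <= 4)%N -> 0 <= w -> lip eta A w a a' ->
      lip beta (C * (Pw * Lam ^+ (leaves tau - 2)) * A) w (X tau t u a) (X tau t u a')) ->
    lip beta (stepB r K * (Pw * Lam ^+ 3)) (16 * z) (defect t u s x q) (defect t u s x' q').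
  move=> P0 HP; case: (Hx) => /ball_Bsp[ex _] /ball_Bsp[ex' _] _.
  case: (Hq) => /ball_Bsp[eq _] /ball_Bsp[eq' _] _.
  rewrite (ED _ _ ex eq) (ED _ _ ex' eq').
  have y2 : 0 <= 2 * (4 * z) by rewrite mulr_ge0.
  have y3 : 0 <= 3 * (4 * z) by rewrite mulr_ge0.
  have y5 : 0 <= 4 * (4 * z) by rewrite mulr_ge0.
  have k1 := HP vee _ _ _ _ isT y2 A1.
  have k2 := HP treeL _ _ _ _ isT y3 A3.
  have k3 := HP treeR _ _ _ _ isT y3 A3.
  have k4 := HP (Node vee vee) _ _ _ _ isT y5 A4.
  have k5 := HP (Node treeL Leaf) _ _ _ _ isT y5 A4.
  have k6 := HP (Node treeR Leaf) _ _ _ _ isT y5 A4.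
  have k7 := HP (Node Leaf treeL) _ _ _ _ isT y5 A4.
  have k8 := HP (Node Leaf treeR) _ _ _ _ isT y5 A4.
  have z16 : 0 <= 4 * (4 * z) <= 16 * z by rewrite y5 /=; lra.
  have z8 : 0 <= 2 * (4 * z) <= 4 * (4 * z) by rewrite y2 /=; lra.
  have z12 : 0 <= 3 * (4 * z) <= 4 * (4 * z) by rewrite y3 /=; lra.
  have {}k1 := lipW (lexx _) z8 k1.
  have {}k2 := lipW (lexx _) z12 k2.
  have {}k3 := lipW (lexx _) z12 k3.
  apply: lipW z16 (lipD (lipD (lipD k1 k2) k3) (lipD (lipD (lipD (lipD k4 k5) k6) k7) k8)).
  rewrite /= {k1 k2 k3 k4 k5 k6 k7 k8}.
  set D := C * Pw.
  have D0 : 0 <= D by rewrite mulr_ge0.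
  have P1 : lam ^+ 3 <= Lam ^+ 3 by rewrite lerXn2r ?nnegrE.
  have P2 : Lam * lam ^+ 2 <= Lam ^+ 3.
    by rewrite [leRHS]exprS ler_wpM2l // lerXn2r ?nnegrE.
  have P3 : Lam ^+ 2 * lam <= Lam ^+ 3.
    by rewrite [leRHS]exprSr ler_wpM2l ?exprn_ge0.
  have Q1 := ler_wpM2l (mulr_ge0 D0 (exprn_ge0 2 B0)) P1.
  have Q2 := ler_wpM2l (mulr_ge0 D0 (exprn_ge0 3 B0)) P2.
  have Q3 := ler_wpM2l (mulr_ge0 D0 (exprn_ge0 4 B0)) P3.
  rewrite /stepB -/B !expr0 !expr1; move: Q1 Q2 Q3; rewrite /D.
  by rewrite ?subnn ?expr0 ?expr1; lra.
split; apply: fin.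
- exact: powR_ge0.
- move=> tau A w a a' lt w0 Ha; have A0 : 0 <= A by case: Ha => /ball_ge0.
  have h : lip eta (C * ((t - u) `^ kappa0 * sig ^+ (leaves tau - 2)) * A) w
      (X tau t u a) (X tau t u a').
    apply: (lip_op _ (XL tau t u lt tu2) Ha) => L b Hb.
    by case: (HXb tau t u lt tu2 L b Hb).
  apply: lipW h; last by rewrite w0 lexx.
  rewrite ler_wpM2r // ler_wpM2l // ler_pM ?powR_ge0 ?exprn_ge0 //.
    by apply: powR_mono; [exact: ltW|rewrite subr_ge0 ut lerB].
  by rewrite lerXn2r ?nnegrE.
- exact: powR_ge0.
- move=> tau A w a a' lt w0 Ha; have A0 : 0 <= A by case: Ha => /ball_ge0.
  have h : lip (- rho) (C * ((t - u) `^ gamma * sig ^+ (leaves tau - 2)) * A) w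
      (X tau t u a) (X tau t u a').
    have HH L b : ball_ eta L b ->
        ball_ (- rho) (C * ((t - u) `^ gamma * sig ^+ (leaves tau - 2)) * L) (X tau t u b).
      by move=> Hb; case: (HXb tau t u lt tu2 L b Hb).
    exact: (lip_op HH (XL tau t u lt tu2) Ha).
  apply: lipW h; last by rewrite w0 lexx.
  rewrite ler_wpM2r // ler_wpM2l // ler_pM ?powR_ge0 ?exprn_ge0 //.
    by apply: powR_mono; [exact: ltW|rewrite subr_ge0 ut lerB].
  by rewrite lerXn2r ?nnegrE.
Qed.

End StepEstimate.

(** * Euler schemes *)

Section Schemes.
Context {R : realType}.
Variables (T eta rho gamma kappa0 : R) (X : treeops (R := R)).
Arguments X : clear implicits.
Hypotheses (reg : regularity T eta X gamma kappa0 rho)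
  (alg : algebraic_relations T eta X).
Hypotheses (T1 : 0 < T <= 1) (k00 : 0 < kappa0) (g1 : gamma <= 1)
  (kg : kappa0 < gamma) (Hg : gamma = kappa0 + eta + rho).

Local Notation flow := (flow X).
Local Notation defect := (defect X).

Let g0 : 0 < gamma. Proof. exact: lt_trans kg. Qed.

(** There are eight trees, and (1 + r)^4 dominates every power of r that occurs. *)
Lemma lip_incr c C t s x x' r z :
  Xbound T eta rho gamma kappa0 X c C -> 0 < c <= kappa0 ->
  simplex2 T (t, s) -> 0 <= z -> lip eta r z x x' ->
  lip eta (8 * C * (1 + r) ^+ 4 * (t - s) `^ kappa0) (4 * z) (incr X t s x) (incr X t s x').
Proof.
move=> [C0 HX] /andP[c0 ck] ts z0 Hx; have [/= s0 st tT] := ts.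
have r0 : 0 <= r by case: Hx => /ball_ge0.
have L1 : 0 <= t - s <= 1.
  by case/andP: T1 => _ T1'; rewrite subr_ge0 st /= lerBlDr (le_trans tT) // (le_trans T1') // lerDl.
have Lc : (t - s) `^ c <= 1.
  by have := powR_mono (ltW c0) L1; rewrite powR1.
set A := C * (1 + r) ^+ 4 * (t - s) `^ kappa0.
have A0 : 0 <= A by rewrite !mulr_ge0 ?powR_ge0 ?exprn_ge0 ?addr_ge0.
have H1 tau : List.In tau trees ->
    lip eta A (4 * z) (X tau t s (tpow (leaves tau) x)) (X tau t s (tpow (leaves tau) x')).
  move=> /treesP lt.
  have : exists2 n, leaves tau = n.+1 & (n <= 3)%N.
    by case: (leaves tau) lt => // n /andP[_]; exists n.
  case=> n En n3.
  have hp : lip eta (r ^+ n.+1) (n.+1%:R * z) (tpow (leaves tau) x) (tpow (leaves tau) x').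
    by rewrite En; exact: lip_tpow.
  have h : lip eta (C * ((t - s) `^ kappa0 * ((t - s) `^ c) ^+ (leaves tau - 2)) * r ^+ n.+1)
      (n.+1%:R * z) (X tau t s (tpow (leaves tau) x)) (X tau t s (tpow (leaves tau) x')).
    apply: (lip_op _ (reg_Lsp reg lt ts) hp) => L b Hb.
    by case: (HX tau t s lt ts L b Hb).
  apply: lipW h; last by rewrite mulr_ge0 //= ler_wpM2r // ler_nat.
  have -> : A = C * (t - s) `^ kappa0 * (1 + r) ^+ 4 by rewrite /A; ring.
  rewrite mulrA -[leLHS]mulrA; apply: ler_wpM2l; first by rewrite mulr_ge0 ?powR_ge0.
  apply: (@le_trans _ _ (1 * (1 + r) ^+ n.+1)).
    apply: ler_pM; rewrite ?exprn_ge0 ?powR_ge0 // ?exprn_ile1 ?powR_ge0 //.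
    by rewrite lerXn2r ?nnegrE ?addr_ge0 // lerDr.
  by rewrite mul1r; apply: ler_weXn2l; rewrite ?lerDl.
have : lip eta ((size trees)%:R * A) (4 * z) (incr X t s x) (incr X t s x').
  rewrite /incr; elim: trees H1 => [|tau l IH] H1.
    rewrite !big_nil mul0r; split; rewrite ?mul0r ?subrr; exact: ball0.
  rewrite !big_cons [size _]/= -[(size l).+1]add1n natrD mulrDl mul1r.
  apply: lipD; first by apply: H1; left.
  by apply: IH => t' ht'; apply: H1; right.
by rewrite /A !mulrA.
Qed.

Lemma ball_flow c C t s x r :
  Xbound T eta rho gamma kappa0 X c C -> 0 < c <= kappa0 ->
  simplex2 T (t, s) -> ball_ eta r x ->
  ball_ eta (r + 8 * C * (1 + r) ^+ 4 * (t - s) `^ kappa0) (flow t s x).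
Proof.
move=> HX ck ts Hx; have [/= s0 st tT] := ts.
apply: ballD; first by apply: ball_sg => //; rewrite subr_ge0.
have r0 := ball_ge0 Hx.
have l0 : lip eta r 0 x x by split=> //; rewrite subrr mulr0; exact: ball0.
by case: (lip_incr HX ck ts (lexx 0) l0).
Qed.

Lemma Bsp_flow t s x : simplex2 T (t, s) -> Bsp eta 1 x -> Bsp eta 1 (flow t s x).
Proof.
move=> ts /Bsp_ball Hx.
have ck : 0 < kappa0 <= kappa0 by rewrite k00 lexx.
have [C HX] := Xbound_exists reg T1 k00 g0 ck.
by case: (ball_Bsp (ball_flow HX ck ts Hx)).
Qed.

(** Serves both for the remainder of one path and for the difference of the remainders of two. The
    defect h may be estimated under the very bound on [D k j] that is being proved, since the
    induction on the number of steps has already reached [j, k]. *)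
Lemma grid_sewing (N : nat) (tau : nat -> R) (D : nat -> nat -> coef R 1)
    (h : nat -> nat -> nat -> coef R 1) (b nu H K Tl : R) :
  0 <= tau 0%N -> tau N <= T -> (forall j i, (j < i <= N)%N -> tau j < tau i) ->
  tau N - tau 0%N <= Tl -> 0 < b -> 1 < gamma + b -> 0 <= nu -> 0 <= H -> 0 <= K ->
  (forall i j, (j < i <= N)%N -> Bsp eta 1 (D i j)) ->
  (forall i, (i < N)%N ->
    ball_ eta (nu * (tau i.+1 - tau i) `^ b) (D i.+1 i) /\
    ball_ (- rho) (nu * (tau i.+1 - tau i) `^ (gamma + b)) (D i.+1 i)) ->
  (forall i k j, (j < k)%N -> (k < i <= N)%N ->
    D i j = D i k + sg (tau i - tau k) (D k j) + h i k j) ->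
  (forall i k j, (j < k)%N -> (k < i <= N)%N ->
    ball_ eta (K * (tau k - tau j) `^ b) (D k j) ->
    ball_ eta (H * (tau i - tau j) `^ (kappa0 + b)) (h i k j) /\
    ball_ (- rho) (H * (tau i - tau j) `^ (gamma + b)) (h i k j)) ->
  let th := (1 - 2 * halfpow (gamma + b))^-1 in
  nu + (2 * H + 2 * ((nu + 2 * H) * th)) * Tl `^ kappa0 <= (1 - halfpow b) * K ->
  forall i j, (j < i <= N)%N ->
    ball_ eta (K * (tau i - tau j) `^ b) (D i j) /\
    ball_ (- rho) ((nu + 2 * H) * th * (tau i - tau j) `^ (gamma + b)) (D i j).
Proof.
move=> tau0 tauN mono lenT b0 gb nu0 H0 K0 DE nbr split_ hbd th cst i j ij.
set e := gamma - kappa0.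
have e0 : 0 <= e by rewrite subr_ge0 ltW.
have hg := halfpow_lt_half gb.
have th0 : 0 < th by rewrite invr_gt0 subr_gt0.
have er : - rho <= eta by rewrite -subr_ge0; move: kg; rewrite Hg; lra.
have nbd al K' (x : coef R 1) : ball_ al K' x -> nm (Bsp al 1) x <= K'.
  by move/ball_Bsp => [].
have DEr i' j' : (j' < i' <= N)%N -> Bsp (- rho) 1 (D i' j').
  by move/DE/Bsp_ball/(ball_le_alpha er)/ball_Bsp => [].
have e1 : 0 <= eta - - rho <= 1.
  rewrite opprK (_ : eta + rho = e); last by rewrite /e Hg; ring.
  by rewrite e0 /= /e lerBlDr (le_trans g1) // lerDl ltW.
have := @discrete_sewing R N tau (fun i j => nm (Bsp (- rho) 1) (D i j))
  (fun i j => nm (Bsp eta 1) (D i j)) (gamma + b) kappa0 b e nu H 1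
  ((nu + 2 * H) * th) K Tl mono lenT gb k00 b0 e0.
have -> : gamma + b = kappa0 + b + e by rewrite /e; ring.
move/(_ erefl H0 ler01 nu0); rewrite (_ : kappa0 + b + e = gamma + b); last by rewrite /e; ring.
have K10 : 0 <= (nu + 2 * H) * th by rewrite mulr_ge0 ?(ltW th0) // addr_ge0 // mulr_ge0.
move/(_ K10 K0) => ds.
suff [d1 d2] : nm (Bsp (- rho) 1) (D i j) <=
      (nu + 2 * H) * th * (tau i - tau j) `^ (gamma + b) /\
    nm (Bsp eta 1) (D i j) <= K * (tau i - tau j) `^ b.
  by split; apply/ballP; split => //; [exact: DE|exact: DEr].
apply: ds ij.
- by move=> k kN; have [n1 n2] := nbr k kN; split; exact: nbd.
- move=> i' k' j' jk ki; rewrite -/(nm _ _) => Hk.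
  have jkN : (j' < k' <= N)%N.
    by rewrite jk; case/andP: ki => ki iN; exact: leq_trans (ltnW ki) iN.
  have kiN : (k' < i' <= N)%N := ki.
  have Hk' : ball_ eta (K * (tau k' - tau j') `^ b) (D k' j').
    by apply/ballP; split=> //; exact: DE.
  have [h1 h2] := hbd i' k' j' jk ki Hk'.
  have L0 : 0 < tau i' - tau k' by rewrite subr_gt0 mono.
  have Be := Bsp_ball (DE _ _ kiN); have Br := Bsp_ball (DEr _ _ kiN).
  have Ce := Bsp_ball (DE _ _ jkN); have Cr := Bsp_ball (DEr _ _ jkN).
  rewrite (split_ i' k' j' jk ki); split; apply: nbd.
  + by apply: ballD => //; apply: ballD => //; apply: ball_sg => //; exact: ltW.
  + by apply: ballD => //; apply: ballD => //; apply: ball_sg => //; exact: ltW.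
  + apply: ballD => //; apply: ballD => //; rewrite mul1r.
    have -> : - e = - (eta - - rho) by rewrite /e Hg; ring.
    exact: ball_smooth.
- by rewrite mulrCA divff ?mulr1 // gt_eqF // subr_gt0.
(* The smoothing constant 2^e of [discrete_sewing] is at most 2, because e = gamma - kappa0 <= 1. *)
- apply: le_trans cst; rewrite lerD2l ler_wpM2r ?powR_ge0 // lerD2l mul1r ler_wpM2r //.
  rewrite -[leRHS](@powRr1 _ 2) // ler_powR // ?ler1n //.
  by move: g1 k00; rewrite /e; lra.
Qed.

End Schemes.

(** * A priori bound for the Euler schemes *)

Section Grids.
Context {R : realType}.
Variables (T eta rho gamma kappa0 : R) (X : treeops (R := R)).
Arguments X : clear implicits.
Hypotheses (reg : regularity T eta X gamma kappa0 rho)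
  (alg : algebraic_relations T eta X).
Hypotheses (T1 : 0 < T <= 1) (k00 : 0 < kappa0) (g1 : gamma <= 1)
  (kg : kappa0 < gamma) (Hg : gamma = kappa0 + eta + rho).

Local Notation flow := (flow X).
Local Notation defect := (defect X).

Let g0 : 0 < gamma. Proof. exact: lt_trans kg. Qed.

Lemma powR_mul_cube (L c p : R) : 0 < L -> L `^ p * (L `^ c) ^+ 3 = L `^ (p + 3 * c).
Proof. by move=> L0; rewrite powR_powR_nat -powR_add // (mulrC c). Qed.

Lemma powR_cube (L c : R) : (L `^ c) ^+ 3 = L `^ (3 * c).
Proof. by rewrite powR_powR_nat (mulrC c). Qed.

Definition remainder (tau : nat -> R) (y : nat -> coef R 1) (i j : nat) : coef R 1 :=
  flow (tau i) (tau j) (y j) - y i.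

Lemma remainder_split tau y i k j :
  remainder tau y i j = remainder tau y i k + sg (tau i - tau k) (remainder tau y k j) +
    defect (tau i) (tau k) (tau j) (y j) (y k).
Proof.
rewrite /remainder /defect; move: (sg _ (_ - _)) => a.
by apply/funext => n; rewrite !fctE; ring.
Qed.

Lemma lip_refl n r (x : coef R n) : ball_ eta r x -> lip eta r 0 x x.
Proof. by move=> Hx; split=> //; rewrite subrr mulr0; exact: ball0. Qed.

Definition euler (tau : nat -> R) (N : nat) (y : nat -> coef R 1) : Prop :=
  forall i, (i < N)%N -> y i.+1 = flow (tau i.+1) (tau i) (y i).

(** Over one step of a scheme the remainder vanishes, so the sewing starts from [nu] = 0. The length
    [Tl] makes the sewing constant small enough to keep the B_eta constant equal to 1, and leaves
    1/2 each to the increment and to the remainder, so that the path does not leave the ball of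
    radius r0 + 1. *)
Lemma euler_bound c r0 : 0 < c <= kappa0 -> 1 < gamma + 3 * c -> 0 <= r0 ->
  exists Tl K1, [/\ 0 < Tl <= T, 0 <= K1 & forall (N : nat) (tau : nat -> R) y,
    0 <= tau 0%N -> tau N <= T -> (forall j i, (j < i <= N)%N -> tau j < tau i) ->
    tau N - tau 0%N <= Tl -> euler tau N y -> ball_ eta r0 (y 0%N) ->
    (forall i, (i <= N)%N -> ball_ eta (r0 + 1) (y i)) /\
    (forall i j, (j < i <= N)%N ->
      ball_ eta (1 * (tau i - tau j) `^ (3 * c)) (remainder tau y i j) /\
      ball_ (- rho) (K1 * (tau i - tau j) `^ (gamma + 3 * c)) (remainder tau y i j))].
Proof.
move=> ck gc r00; have [c0 ck0] := andP ck; have [T0 T1'] := andP T1.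
have [C HX] := Xbound_exists reg T1 k00 g0 ck; have [C0 _] := HX.
set r := r0 + 1.
have rp : 0 <= r by rewrite addr_ge0.
set H := stepB C r 1.
have H0 : 0 <= H by exact: (stepB_ge0 HX).
have b0 : 0 < 3 * c by rewrite mulr_gt0.
set th := (1 - 2 * halfpow (gamma + 3 * c))^-1.
have th0 : 0 < th by rewrite invr_gt0 subr_gt0 halfpow_lt_half.
set w := 1 - halfpow (3 * c).
have w0 : 0 < w by rewrite subr_gt0 halfpow_lt1.
set Q := 2 * H + 2 * (2 * H * th).
have th0' : 0 <= th := ltW th0.
have H02 : 0 <= 2 * H by rewrite mulr_ge0.
have Q0 : 0 <= Q by rewrite addr_ge0 // mulr_ge0 // mulr_ge0.
set I := 8 * C * (1 + r0) ^+ 4.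
have I0 : 0 <= I by rewrite !mulr_ge0 ?exprn_ge0 ?addr_ge0.
have e1 : 0 < w / (Q + 1) by rewrite divr_gt0 // ltr_wpDl.
have [d1 d10 Hd1] := powR_small k00 e1.
have e2 : 0 < 2^-1 / (I + 1) by rewrite divr_gt0 ?ltr_wpDl ?invr_gt0.
have [d2 d20 Hd2] := powR_small k00 e2.
have half0 : 0 < 2^-1 :> R by rewrite invr_gt0.
have [d3 d30 Hd3] := powR_small b0 half0.
pose Tl := Num.min T (Num.min d1 (Num.min d2 d3)).
have Tl0 : 0 < Tl by rewrite !lt_min T0 d10 d20 d30.
have TlT : Tl <= T by rewrite ge_min lexx.
have Tld1 : Tl <= d1 by rewrite !ge_min lexx !orbT.
have Tld2 : Tl <= d2 by rewrite !ge_min lexx !orbT.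
have Tld3 : Tl <= d3 by rewrite !ge_min lexx !orbT.
have cst : 0 + (2 * H + 2 * ((0 + 2 * H) * th)) * Tl `^ kappa0 <= w * 1.
  rewrite !add0r mulr1 -/Q.
  have /Hd1 h : 0 <= Tl <= d1 by rewrite (ltW Tl0).
  apply: (@le_trans _ _ ((Q + 1) * (w / (Q + 1)))).
    by apply: ler_pM; rewrite ?powR_ge0 // lerDl.
  by rewrite mulrCA divff ?mulr1 // gt_eqF // ltr_wpDl.
exists Tl, ((0 + 2 * H) * th); split.
- by rewrite Tl0.
- by rewrite mulr_ge0 ?(ltW th0) // add0r mulr_ge0.
move=> N tau y tau0 tauN mono lenT Ey Hy0.
have mono' i j : (j <= i <= N)%N -> tau j <= tau i.
  case/andP; rewrite leq_eqVlt => /orP[/eqP->//|ji iN].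
  by apply/ltW/mono; rewrite ji.
have sx i j : (j <= i <= N)%N -> simplex2 T (tau i, tau j).
  move=> ji; have [ji' iN] := andP ji; split => /=.
  - by apply: le_trans tau0 _; apply: mono'; rewrite (leq_trans ji').
  - exact: mono'.
  - by apply: le_trans tauN; apply: mono'; rewrite iN leqnn.
(* Sewing up to M uses the radius r only at nodes before M: the defect never involves the last node.
   This prevents the induction on M from being circular. *)
have sew M : (M <= N)%N -> (forall i, (i < M)%N -> ball_ eta r (y i)) ->
    forall i j, (j < i <= M)%N ->
      ball_ eta (1 * (tau i - tau j) `^ (3 * c)) (remainder tau y i j) /\
      ball_ (- rho) ((0 + 2 * H) * th * (tau i - tau j) `^ (gamma + 3 * c))
        (remainder tau y i j).
  move=> MN Hy.
  have sxM i j : (j <= i <= M)%N -> simplex2 T (tau i, tau j).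
    by case/andP=> ji iM; apply: sx; rewrite ji (leq_trans iM).
  have HyM i : (i <= M)%N -> Bsp eta 1 (y i).
    rewrite leq_eqVlt => /orP[/eqP->|/Hy/ball_Bsp[]//].
    case: M MN Hy sxM => [|M] MN Hy sxM; first by case: (ball_Bsp Hy0).
    rewrite Ey //; apply: (Bsp_flow reg T1 k00 kg).
      by apply: sxM; rewrite leqnSn leqnn.
    by case: (ball_Bsp (Hy M (ltnSn M))).
  have HyB i : (i < M)%N -> ball_ eta r (y i) by exact: Hy.
  move=> i j; apply: (@grid_sewing R T eta rho gamma kappa0 k00 g1 kg Hg M tau
    (remainder tau y) (fun i k j => defect (tau i) (tau k) (tau j) (y j) (y k))
    (3 * c) 0 H 1 Tl tau0) => //.
  - by case: (sx M 0%N).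
  - by move=> j' i' /andP[ji iM]; apply: mono; rewrite ji (leq_trans iM).
  - by apply: le_trans lenT; rewrite lerB // mono' // MN leqnn.
  - move=> i' j' /andP[ji iM]; apply: BspB; last exact: HyM.
    apply: (Bsp_flow reg T1 k00 kg); first by apply: sxM; rewrite (ltnW ji) iM.
    by apply: HyM; rewrite (leq_trans (ltnW ji)).
  - move=> i' iM; rewrite /remainder Ey ?(leq_trans iM) // subrr !mul0r.
    by split; exact: ball0.
  - by move=> i' k' j' jk /andP[ki iM]; exact: remainder_split.
  - move=> i' k' j' jk /andP[ki iM]; rewrite mul1r => Hkj.
    have yj : ball_ eta r (y j') by apply: HyB; rewrite (leq_trans jk) // (leq_trans (ltnW ki)).
    have yk : ball_ eta r (y k') by apply: HyB; rewrite (leq_trans ki).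
    have tij : 0 < tau i' - tau j'.
      by rewrite subr_gt0; apply: mono; rewrite (ltn_trans jk ki) (leq_trans iM).
    have [h1 h2] : simplex2 T (tau i', tau k') /\ simplex2 T (tau k', tau j').
      split; apply: sxM; first by rewrite (ltnW ki) iM.
      by rewrite (ltnW jk) (leq_trans (ltnW ki)).
    have tus : simplex3 T (tau i', tau k', tau j').
      by case: h1 => /= ? ? ?; case: h2 => /= ? ? ?; split.
    have Hm : lip eta (1 * ((tau k' - tau j') `^ c) ^+ 3) 0
        (flow (tau k') (tau j') (y j') - y k') (flow (tau k') (tau j') (y j') - y k').
      by apply: lip_refl; rewrite mul1r powR_cube.
    have [[s1 _ _] [s2 _ _]] := step_lip reg alg T1 k00 g0 ck HX tus (lexx 0) ler01
      (lip_refl yj) (lip_refl yk) Hm.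
    by rewrite !powR_mul_cube // in s1 s2.
have step M : (M <= N)%N -> forall i, (i <= M)%N -> ball_ eta r (y i).
  elim: M => [|M IH] MN i.
    by rewrite leqn0 => /eqP ->; apply: ballW Hy0; rewrite lerDl.
  have {}IH := IH (ltnW MN).
  rewrite leq_eqVlt => /orP[/eqP->|]; last by rewrite ltnS; exact: IH.
  have [|sM _] := sew M.+1 MN IH M.+1 0%N; first by rewrite leqnn.
  have s2 : simplex2 T (tau M.+1, tau 0%N) by exact: sx.
  have L0 : 0 <= tau M.+1 - tau 0%N <= Tl.
    rewrite subr_ge0 mono' //=; apply: le_trans lenT; rewrite lerB // mono' //.
    by rewrite MN leqnn.
  have [L1 L2] := andP L0.
  have -> : y M.+1 = flow (tau M.+1) (tau 0%N) (y 0%N) - remainder tau y M.+1 0.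
    by rewrite /remainder subKr.
  apply: ballW (ballB (ball_flow reg T1 HX ck s2 Hy0) sM).
  rewrite /r mul1r -addrA lerD2l [leRHS](_ : 1 = 2^-1 + 2^-1); last by lra.
  apply: lerD; last by apply: Hd3; rewrite L1 (le_trans L2).
  apply: (@le_trans _ _ ((I + 1) * (2^-1 / (I + 1)))).
    rewrite -/I; apply: ler_pM; rewrite ?powR_ge0 // ?lerDl //.
    by apply: Hd2; rewrite L1 (le_trans L2).
  by rewrite mulrCA divff ?mulr1 // gt_eqF // ltr_wpDl.
split=> [i iN|i j ij]; first exact: (step N).
by apply: (sew N) => // k kN; apply: (step N) => //; exact: ltnW.
Qed.

End Grids.

(** * Stability of controlled paths on a grid *)

Section Stability.
Context {R : realType}.
Variables (T eta rho gamma kappa0 : R) (X : treeops (R := R)).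
Arguments X : clear implicits.
Hypotheses (reg : regularity T eta X gamma kappa0 rho)
  (alg : algebraic_relations T eta X).
Hypotheses (T1 : 0 < T <= 1) (k00 : 0 < kappa0) (g1 : gamma <= 1)
  (kg : kappa0 < gamma) (Hg : gamma = kappa0 + eta + rho).

Local Notation flow := (flow X).
Local Notation defect := (defect X).
Local Notation remainder := (remainder X).

Let g0 : 0 < gamma. Proof. exact: lt_trans kg. Qed.

Definition controlled (c r K : R) (N : nat) (tau : nat -> R) (y : nat -> coef R 1) :=
  (forall i, (i <= N)%N -> ball_ eta r (y i)) /\
  (forall i j, (j < i <= N)%N ->
    ball_ eta (K * (tau i - tau j) `^ (3 * c)) (remainder tau y i j) /\
    ball_ (- rho) (K * (tau i - tau j) `^ (gamma + 3 * c)) (remainder tau y i j)).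

(** Neither path has to be an Euler scheme. Over one step the two remainders are of order 3 c2, and
    reading them at order 3 c1 leaves a factor dl^{3 (c2 - c1)}; this replaces the vanishing of
    one-step remainders. The distance of the paths is bounded by itself with factor 1/2 and then
    absorbed. *)
Lemma stability c1 c2 r K :
  0 < c1 -> c1 < c2 -> c2 <= kappa0 -> 1 < gamma + 3 * c1 -> 1 <= r -> 1 <= K ->
  exists Tl Cs, [/\ 0 < Tl <= T, 0 <= Cs & forall (N : nat) (tau : nat -> R) y y' dl z0,
    0 <= tau 0%N -> tau N <= T -> (forall j i, (j < i <= N)%N -> tau j < tau i) ->
    tau N - tau 0%N <= Tl -> (forall i, (i < N)%N -> tau i.+1 - tau i <= dl) ->
    controlled c2 r K N tau y -> controlled c2 r K N tau y' ->
    ball_ eta z0 (y 0%N - y' 0%N) ->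
    forall i, (i <= N)%N -> ball_ eta (Cs * (z0 + dl `^ (3 * (c2 - c1)))) (y i - y' i)].
Proof.
move=> c10 c12 c2k gc r1 K1; have [T0 T1'] := andP T1.
have ck1 : 0 < c1 <= kappa0 by rewrite c10 ltW // (lt_le_trans c12).
have [C HX] := Xbound_exists reg T1 k00 g0 ck1; have [C0 _] := HX.
have r0 : 0 <= r := le_trans ler01 r1.
have K0 : 0 <= K := le_trans ler01 K1.
set b := 3 * c1; have b0 : 0 < b by rewrite mulr_gt0.
set th := (1 - 2 * halfpow (gamma + b))^-1.
have th0 : 0 <= th by rewrite invr_ge0 subr_ge0 ltW // halfpow_lt_half.
set w := 1 - halfpow b.
have w0 : 0 < w by rewrite subr_gt0 halfpow_lt1.
set Hs := 16 * stepB C r K.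
have Hs0 : 0 <= Hs by rewrite mulr_ge0 // (stepB_ge0 HX).
set Q := Hs * (2 + 4 * th).
have Q0 : 0 <= Q by rewrite mulr_ge0 // addr_ge0 // mulr_ge0.
set I := 8 * C * (1 + r) ^+ 4.
have I0 : 0 <= I.
  by rewrite mulr_ge0 ?exprn_ge0 ?addr_ge0 // mulr_ge0.
have e1 : 0 < w / 2 / (Q + 1) by rewrite !divr_gt0 // ltr_wpDl.
have [d1 d10 Hd1] := powR_small k00 e1.
have half0 : 0 < 2^-1 :> R by rewrite invr_gt0.
have [d3 d30 Hd3] := powR_small b0 half0.
pose Tl := Num.min T (Num.min d1 d3).
have Tl0 : 0 < Tl by rewrite !lt_min T0 d10 d30.
have TlT : Tl <= T by rewrite ge_min lexx.
have Tld1 : Tl <= d1 by rewrite !ge_min lexx !orbT.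
have Tld3 : Tl <= d3 by rewrite !ge_min lexx !orbT.
have QT : Q * Tl `^ kappa0 <= w / 2.
  have /Hd1 h : 0 <= Tl <= d1 by rewrite (ltW Tl0).
  apply: (@le_trans _ _ ((Q + 1) * (w / 2 / (Q + 1)))).
    by apply: ler_pM; rewrite ?powR_ge0 // lerDl.
  by rewrite mulrCA divff ?mulr1 // gt_eqF // ltr_wpDl.
have P1 : Tl `^ kappa0 <= 1.
  have := @powR_mono R Tl 1 kappa0 (ltW k00); rewrite powR1; apply.
  by rewrite (ltW Tl0) (le_trans TlT).
have P0 : 0 <= Tl `^ kappa0 := powR_ge0 _ _.
set E := (1 + 2 * th) / w.
have E0 : 0 <= E by rewrite divr_ge0 ?(ltW w0) // addr_ge0 // mulr_ge0.
have I4 : 0 <= 1 + 4 * I by rewrite addr_ge0 // mulr_ge0.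
exists Tl, (2 * (1 + 4 * I) + 4 * K * E); split.
- by rewrite Tl0.
- by rewrite addr_ge0 // mulr_ge0 // mulr_ge0.
move=> N tau y y' dl z0 tau0 tauN mono lenT mesh [Hy HM] [Hy' HM'] Hz0.
have z00 := ball_ge0 Hz0.
have mono' i j : (j <= i <= N)%N -> tau j <= tau i.
  case/andP; rewrite leq_eqVlt => /orP[/eqP->//|ji iN].
  by apply/ltW/mono; rewrite ji.
have sx i j : (j <= i <= N)%N -> simplex2 T (tau i, tau j).
  move=> ji; have [ji' iN] := andP ji; split => /=.
  - by apply: le_trans tau0 _; apply: mono'; rewrite (leq_trans ji').
  - exact: mono'.
  - by apply: le_trans tauN; apply: mono'; rewrite iN leqnn.
have len i j : (j < i <= N)%N -> 0 < tau i - tau j <= Tl.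
  move=> ij; rewrite subr_gt0 mono //=; apply: le_trans lenT.
  have [ji iN] := andP ij; apply: lerB; apply: mono'; first by rewrite iN leqnn.
  by rewrite leq0n (leq_trans (ltnW ji)).
have len1 i j : (j < i <= N)%N -> 0 <= tau i - tau j <= 1.
  by move=> /len/andP[/ltW -> /= h]; apply: le_trans h (le_trans TlT T1').
(* Largest distance of the paths over the grid; it is finite beforehand, which permits the
   absorption at the end. *)
pose Z := \big[Num.max/0]_(i < N.+1) nm (Bsp eta 1) (y i - y' i).
have Z0 : 0 <= Z.
  by rewrite /Z; elim/big_ind: _ => // [u v u0 v0|i _]; [rewrite le_max u0|exact: nm_ge0].
have yE i : (i <= N)%N -> Bsp eta 1 (y i - y' i).
  by move=> iN; case: (ball_Bsp (ballB (Hy i iN) (Hy' i iN))).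
have yZ i : (i <= N)%N -> ball_ eta Z (y i - y' i).
  move=> iN; apply/ballP; split; first exact: yE.
  by rewrite /Z -ltnS in iN *; apply: (le_bigmax 0 (fun i : 'I_N.+1 => nm _ (y i - y' i)) (Ordinal iN)).
set th' := 3 * (c2 - c1).
have th'0 : 0 < th' by rewrite mulr_gt0 // subr_gt0.
have D0 : 0 <= dl `^ th' := powR_ge0 _ _.
set nu := 2 * K * dl `^ th'.
have nu0 : 0 <= nu by rewrite mulr_ge0 // mulr_ge0.
(* Solves the closing condition of the sewing with equality: w KD = (w / 2) (Z + KD) + w E nu. The
   first term pays for the defects, by the choice of [Tl], and w E nu = nu + 2 nu th for the single
   steps. *)
set KD := Z + 2 * E * nu.
have KD0 : 0 <= KD by rewrite addr_ge0 // mulr_ge0 // mulr_ge0.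
(* One relative Lipschitz factor for both the paths and their remainders; r >= 1 and K >= 1 make it
   admissible for each. *)
set z := Z + KD.
have zz0 : 0 <= z by rewrite addr_ge0.
have Zz : Z <= r * z.
  by rewrite -[leLHS]mul1r; apply: ler_pM => //; rewrite lerDl.
have KDz : KD <= K * z.
  by rewrite -[leLHS]mul1r; apply: ler_pM => //; rewrite lerDr.
have ly i : (i <= N)%N -> lip eta r z (y i) (y' i).
  move=> iN; split; [exact: Hy|exact: Hy'|].
  exact: ballW Zz (yZ i iN).
have HD i j : (j < i <= N)%N ->
  ball_ eta (KD * (tau i - tau j) `^ b) (remainder tau y i j - remainder tau y' i j) /\
  ball_ (- rho) ((nu + 2 * (Hs * z)) * th * (tau i - tau j) `^ (gamma + b))
    (remainder tau y i j - remainder tau y' i j).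
  apply: (@grid_sewing R T eta rho gamma kappa0 k00 g1 kg Hg N tau
    (fun i j => remainder tau y i j - remainder tau y' i j)
    (fun i k j => defect (tau i) (tau k) (tau j) (y j) (y k) -
                  defect (tau i) (tau k) (tau j) (y' j) (y' k))
    b nu (Hs * z) KD Tl tau0) => //.
  - by rewrite mulr_ge0.
  - move=> i' j' ij; apply: BspB.
      by case: (ball_Bsp (HM i' j' ij).1).
    by case: (ball_Bsp (HM' i' j' ij).1).
  - move=> i' iN; have ij : (i' < i'.+1 <= N)%N by rewrite ltnSn.
    have [h1 h2] := HM _ _ ij; have [h1' h2'] := HM' _ _ ij.
    have [L0 _] := andP (len _ _ ij).
    have Ld : (tau i'.+1 - tau i') `^ th' <= dl `^ th'.
      by apply: powR_mono; [exact: ltW|rewrite (ltW L0) mesh].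
    have pw p : K * (tau i'.+1 - tau i') `^ (p + 3 * c2) +
        K * (tau i'.+1 - tau i') `^ (p + 3 * c2) <= nu * (tau i'.+1 - tau i') `^ (p + b).
      have -> : p + 3 * c2 = th' + (p + b) by rewrite /th' /b; ring.
      rewrite [_ `^ (th' + _)]powR_add // -mulr2n -mulr_natl !mulrA.
      rewrite ler_wpM2r ?powR_ge0 // /nu ler_wpM2l // mulr_ge0 //.
    split; last exact: ballW (pw gamma) (ballB h2 h2').
    by have := pw 0; rewrite !add0r => /ballW; apply; exact: ballB.
  - move=> i' k' j' jk ki; rewrite !(remainder_split X tau _ i' k' j').
    rewrite sgB; move: (sg _ _) (sg _ _) (defect _ _ _ _ _) (defect _ _ _ _ _).
    by move=> *; apply/funext => n; rewrite !fctE; ring.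
  - move=> i' k' j' jk ki Hkj; have [ki' iN] := andP ki.
    have jkN : (j' < k' <= N)%N by rewrite jk (leq_trans (ltnW ki')).
    have ijN : (j' < i' <= N)%N by rewrite (ltn_trans jk ki').
    have [tij _] := andP (len _ _ ijN).
    have tus : simplex3 T (tau i', tau k', tau j').
      have := sx i' k'; rewrite (ltnW ki') iN => /(_ isT) [/= _ ? ?].
      have := sx k' j'; rewrite (ltnW jk) (leq_trans (ltnW ki')) // => /(_ isT) [/= ? ? _].
      by split.
    have [tkj _] := andP (len _ _ jkN).
    have c21 : (tau k' - tau j') `^ (3 * c2) <= (tau k' - tau j') `^ b.
      apply: powRB_le => //; first exact: len1.
      by rewrite /b ler_pM2l // ltW.
    have Hm : lip eta (K * ((tau k' - tau j') `^ c1) ^+ 3) z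
        (flow (tau k') (tau j') (y j') - y k') (flow (tau k') (tau j') (y' j') - y' k').
      rewrite powR_cube -/b; split.
      - by apply: ballW (HM _ _ jkN).1; rewrite ler_wpM2l.
      - by apply: ballW (HM' _ _ jkN).1; rewrite ler_wpM2l.
      - by apply: ballW Hkj; rewrite mulrAC ler_wpM2r ?powR_ge0.
    have kN : (k' <= N)%N by rewrite (leq_trans (ltnW ki')).
    have jN : (j' <= N)%N by rewrite (leq_trans (ltnW jk)).
    have [[_ _ s1] [_ _ s2]] := step_lip reg alg T1 k00 g0 ck1 HX tus zz0 K0
      (ly _ jN) (ly _ kN) Hm.
    rewrite !powR_mul_cube // -/b in s1 s2.
    have re p : stepB C r K * p * (16 * z) = Hs * z * p by rewrite /Hs; ring.
    by rewrite !re in s1 s2.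
  - rewrite -/th -/w; set P := Tl `^ kappa0 in QT P1 P0 *.
    have -> : nu + (2 * (Hs * z) + 2 * ((nu + 2 * (Hs * z)) * th)) * P =
      nu + 2 * nu * th * P + Q * P * z by rewrite /Q; ring.
    have n1 : 2 * nu * th * P <= 2 * nu * th by rewrite ler_piMr // !mulr_ge0.
    have n2 : Q * P * z <= w / 2 * z by rewrite ler_wpM2r.
    have n3 : w * (E * nu) = nu + 2 * nu * th.
      by rewrite /E; field; rewrite gt_eqF.
    have n4 : w * KD = w / 2 * z + w * (E * nu).
      by rewrite /z /KD; field.
    by rewrite n4 n3; move: n1 n2; lra.
pose A := (1 + 4 * I) * z0 + E * nu.
have A0 : 0 <= A by rewrite addr_ge0 // mulr_ge0.
have key i : (i <= N)%N -> nm (Bsp eta 1) (y i - y' i) <= A + Z / 2.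
  case: i => [_|i iN].
    apply: le_trans (ball_Bsp Hz0).2 _.
    have := mulr_ge0 I0 z00; have := mulr_ge0 E0 nu0.
    by move: Z0; rewrite /A; lra.
  have ij : (0 < i.+1 <= N)%N by [].
  have [L0 LT] := andP (len _ _ ij).
  have l0 : lip eta r z0 (y 0%N) (y' 0%N).
    split; [exact: Hy|exact: Hy'|apply: ballW Hz0].
    by rewrite ler_peMl.
  have s2 : simplex2 T (tau i.+1, tau 0%N) by exact: sx.
  have [_ _ hI] := lip_incr reg T1 HX ck1 s2 z00 l0.
  have hS : ball_ eta z0 (sg (tau i.+1 - tau 0%N) (y 0%N - y' 0%N)).
    by apply: ball_sg => //; exact: ltW.
  have [hD _] := HD _ _ ij.
  have -> : y i.+1 - y' i.+1 = sg (tau i.+1 - tau 0%N) (y 0%N - y' 0%N) +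
      (incr X (tau i.+1) (tau 0%N) (y 0%N) - incr X (tau i.+1) (tau 0%N) (y' 0%N)) -
      (remainder tau y i.+1 0 - remainder tau y' i.+1 0).
    rewrite /remainder /flow sgB; move: (sg _ _) (sg _ _) (incr _ _ _ _) (incr _ _ _ _).
    by move=> *; apply/funext => n; rewrite !fctE; ring.
  apply: le_trans (ball_Bsp (ballB (ballD hS hI) hD)).2 _.
  have q1 : (tau i.+1 - tau 0%N) `^ b <= 2^-1.
    by apply: Hd3; rewrite (ltW L0) (le_trans LT).
  have q2 : (tau i.+1 - tau 0%N) `^ kappa0 <= 1.
    have := @powR_mono R (tau i.+1 - tau 0%N) 1 kappa0 (ltW k00); rewrite powR1; apply.
    exact: len1.
  have q3 : KD * (tau i.+1 - tau 0%N) `^ b <= KD * 2^-1 by rewrite ler_wpM2l.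
  have q4 : I * (tau i.+1 - tau 0%N) `^ kappa0 * (4 * z0) <= I * 1 * (4 * z0).
    by rewrite ler_wpM2r ?mulr_ge0 // ler_wpM2l.
  have q5 : KD * 2^-1 = Z / 2 + E * nu by rewrite /KD; field.
  by move: q3 q4; rewrite q5 /A -/I; lra.
have ZA : Z <= 2 * A.
  suff : Z <= A + Z / 2 by lra.
  rewrite /Z; apply: bigmax_le; first by rewrite addr_ge0 // divr_ge0.
  by move=> i _; apply: key; rewrite -ltnS.
move=> i iN; apply: ballW (yZ i iN); apply: le_trans ZA _.
have := mulr_ge0 (mulr_ge0 K0 E0) z00.
have := mulr_ge0 I0 D0.
by rewrite /A /nu; lra.
Qed.

End Stability.

(** * Existence *)

Section Refinement.
Context {R : realType}.

Definition is_grid (T : R) (N : nat) (tau : nat -> R) : Prop :=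
  [/\ tau 0%N = 0, tau N <= T & forall j i, (j < i <= N)%N -> tau j < tau i].

Lemma is_grid_le T N tau : is_grid T N tau ->
  forall j i, (j <= i <= N)%N -> tau j <= tau i.
Proof.
case=> _ _ mono j i /andP[]; rewrite leq_eqVlt => /orP[/eqP->//|ji iN].
by apply/ltW/mono; rewrite ji.
Qed.

(** The merged nodes are sorted without repetition, and f1, f2 return the rank of an old node. The
    two grids may end at different times. *)
Lemma common_refinement T N1 tau1 N2 tau2 :
  is_grid T N1 tau1 -> is_grid T N2 tau2 ->
  exists N tau (f1 f2 : nat -> nat), [/\ is_grid T N tau,
    [/\ f1 0%N = 0%N, forall i, (i <= N1)%N -> (f1 i <= N)%N /\ tau (f1 i) = tau1 i &
        forall j i, (j < i <= N1)%N -> (f1 j < f1 i)%N] &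
    [/\ f2 0%N = 0%N, forall i, (i <= N2)%N -> (f2 i <= N)%N /\ tau (f2 i) = tau2 i &
        forall j i, (j < i <= N2)%N -> (f2 j < f2 i)%N]].
Proof.
move=> G1 G2.
pose l0 := undup (map tau1 (iota 0 N1.+1) ++ map tau2 (iota 0 N2.+1)).
pose l := sort <=%R l0; pose tau i := nth 0 l i; pose N := (size l).-1.
have ml x : (x \in l) = (x \in map tau1 (iota 0 N1.+1)) || (x \in map tau2 (iota 0 N2.+1)).
  by rewrite mem_sort mem_undup mem_cat.
have memi (s : nat -> R) M i : (i <= M)%N -> s i \in map s (iota 0 M.+1).
  by move=> iM; apply: map_f; rewrite mem_iota.
have ml1 i : (i <= N1)%N -> tau1 i \in l by move=> h; rewrite ml memi.
have ml2 i : (i <= N2)%N -> tau2 i \in l by move=> h; rewrite ml [X in _ || X]memi ?orbT.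
have sl : sorted <%R l by rewrite sort_lt_sorted undup_uniq.
have bnd x : x \in l -> 0 <= x <= T.
  have aux M s : is_grid T M s -> x \in map s (iota 0 M.+1) -> 0 <= x <= T.
    move=> G /mapP[i]; rewrite mem_iota /= add0n ltnS => iM ->.
    have [s0 sT _] := G.
    rewrite -{1}s0 (is_grid_le G) //= (le_trans _ sT) // (is_grid_le G) //.
    by rewrite iM leqnn.
  by rewrite ml => /orP[]; apply: aux.
have zl : 0 \in l by have [<- _ _] := G1; exact: ml1.
have sz : (0 < size l)%N by case: (l) zl.
have lt_nth i j : (i < j)%N -> (j < size l)%N -> nth 0 l i < nth 0 l j.
  move=> ij jl; apply: (sorted_ltn_nth lt_trans) => //; rewrite inE //.
  exact: ltn_trans jl.
have i0 : index 0 l = 0%N.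
  case E : (index 0 l) => [//|n]; have il : (index (0%R : R) l < size l)%N by rewrite index_mem.
  have := lt_nth 0%N (index (0 : R) l); rewrite {1}E => /(_ isT il).
  rewrite nth_index // => h; have := bnd l`_0 (mem_nth 0 sz).
  by rewrite leNgt h.
have tau0 : tau 0%N = 0 by rewrite /tau -[in LHS]i0 nth_index.
have NS : N.+1 = size l by rewrite prednK.
have G : is_grid T N tau.
  split=> //; first by rewrite /tau; have := @mem_nth _ 0 l N; rewrite -NS => /(_ (leqnn _)) /bnd /andP[].
  by move=> j i /andP[ji iN]; apply: lt_nth => //; rewrite -NS ltnS.
have aux M s : is_grid T M s -> (forall i, (i <= M)%N -> s i \in l) ->
  [/\ index (s 0%N) l = 0%N,
      forall i, (i <= M)%N -> (index (s i) l <= N)%N /\ tau (index (s i) l) = s i &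
      forall j i, (j < i <= M)%N -> (index (s j) l < index (s i) l)%N].
  move=> Gs ms; have [s0 _ mono] := Gs; split; first by rewrite s0.
    move=> i iM; rewrite /tau nth_index ?ms //; split=> //.
    by rewrite -ltnS NS index_mem ms.
  move=> j i ji; have [ji' iM] := andP ji; rewrite ltnNge; apply/negP => le.
  have := mono j i ji; rewrite ltNge => /negP; apply.
  have jM : (j <= M)%N by rewrite (leq_trans (ltnW ji')).
  rewrite -[leLHS](nth_index 0 (ms i iM)) -[leRHS](nth_index 0 (ms j jM)).
  move: le; rewrite leq_eqVlt => /orP[/eqP->//|lt]; apply/ltW/lt_nth => //.
  by rewrite index_mem ms.
exists N, tau, (fun i => index (tau1 i) l), (fun i => index (tau2 i) l).
by split=> //; apply: aux.
Qed.

(** The intervals [u m - a m, u m + a m] meet pairwise, so the supremum of their left ends lies in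
    all of them. This yields a limit together with its rate. *)
Lemma squeeze_sup (u a : nat -> R) :
  (forall n m, `|u n - u m| <= a n + a m) ->
  forall n, `|u n - sup [set u m - a m | m in [set: nat]]| <= a n.
Proof.
move=> H n; set A := [set _ | _ in _].
have ub m : ubound A (u m + a m).
  by move=> _ [p _ <-]; have := H p m; rewrite ler_norml; lra.
have hA : has_sup A by split; [exists (u 0%N - a 0%N), 0%N|exists (u 0%N + a 0%N); exact: ub].
have h1 : u n - a n <= sup A by apply: ub_le_sup; [case: hA|exists n].
have h2 : sup A <= u n + a n by apply: ge_sup; [case: hA|exact: ub].
by rewrite ler_norml; apply/andP; split; lra.
Qed.

Lemma ball_eps (alpha : R) n K (c : coef R n) : 0 <= K ->
  (forall e, 0 < e -> ball_ alpha (K + e) c) -> ball_ alpha K c.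
Proof.
move=> K0 H; split=> // s us.
have P0 := psum_ge0 alpha s c.
rewrite -[leLHS](sqr_sqrtr P0) lerXn2r ?nnegrE ?sqrtr_ge0 //.
apply/ler_addgt0Pr => e e0; have [_ /(_ s us) h] := H e e0.
rewrite -(@ler_pXn2r _ 2) ?nnegrE ?sqrtr_ge0 ?sqr_sqrtr // addr_ge0 //.
exact: ltW.
Qed.

Definition gap (th : R) (n : nat) : R := (n.+1%:R^-1) `^ th.

Lemma gap_ge0 th n : 0 <= gap th n.
Proof. exact: powR_ge0. Qed.

Lemma gap_small th (e : R) : 0 < th -> 0 < e -> \forall n \near \oo, gap th n <= e.
Proof.
move=> th0 e0; have [d d0 Hd] := powR_small th0 e0.
have := near_infty_natSinv_lt (PosNum d0); apply: filterS => n /= h.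
by apply: Hd; rewrite invr_ge0 ler0n ltW.
Qed.

Lemma gap_exists th (A e : R) : 0 < th -> 0 <= A -> 0 < e -> exists n, A * gap th n <= e.
Proof.
move=> th0 A0 e0; have e1 : 0 < e / (A + 1) by rewrite divr_gt0 // ltr_wpDl.
have [n _ Hn] := gap_small th0 e1; exists n.
apply: (@le_trans _ _ ((A + 1) * (e / (A + 1)))); last first.
  by rewrite mulrCA divff ?mulr1 // gt_eqF // ltr_wpDl.
by apply: ler_pM; rewrite ?gap_ge0 // ?lerDl //; exact: (Hn n (leqnn n)).
Qed.

Definition uniform_grid (s t : R) (n i : nat) : R := s + (t - s) * (i%:R / n.+1%:R).

Lemma uniform_grid_end s t n : uniform_grid s t n n.+1 = t.
Proof. by rewrite /uniform_grid divff ?pnatr_eq0 // mulr1 addrC subrK. Qed.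

Lemma uniform_grid0 s t n : uniform_grid s t n 0 = s.
Proof. by rewrite /uniform_grid mul0r mulr0 addr0. Qed.

Lemma uniform_grid_lt s t n j i : s < t -> (j < i)%N ->
  uniform_grid s t n j < uniform_grid s t n i.
Proof.
move=> st ji; rewrite /uniform_grid ltrD2l ltr_pM2l ?subr_gt0 //.
by rewrite ltr_pM2r ?invr_gt0 ?ltr0n // ltr_nat.
Qed.

Lemma uniform_grid_mesh s t n i :
  uniform_grid s t n i.+1 - uniform_grid s t n i = (t - s) / n.+1%:R.
Proof. by rewrite /uniform_grid -addn1 natrD; ring. Qed.

End Refinement.

(** * Limit of the Euler schemes *)

Section Existence.
Context {R : realType}.
Variables (T eta rho gamma kappa0 : R) (X : treeops (R := R)).
Arguments X : clear implicits.
Hypotheses (reg : regularity T eta X gamma kappa0 rho)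
  (alg : algebraic_relations T eta X).
Hypotheses (T1 : 0 < T <= 1) (k00 : 0 < kappa0) (g1 : gamma <= 1)
  (kg : kappa0 < gamma) (Hg : gamma = kappa0 + eta + rho) (eta0 : 0 <= eta).

Local Notation flow := (flow X).
Local Notation remainder := (remainder X).

Let g0 : 0 < gamma. Proof. exact: lt_trans kg. Qed.
Let er : - rho <= eta.
Proof. by rewrite -subr_ge0; move: kg; rewrite Hg; lra. Qed.

Fixpoint euler_path (psi : coef R 1) (tau : nat -> R) (i : nat) : coef R 1 :=
  if i is j.+1 then flow (tau j.+1) (tau j) (euler_path psi tau j) else psi.

Lemma path_exists c psi : 0 < c <= kappa0 -> 1 < gamma + 3 * c -> Bsp eta 1 psi ->
  exists T0 r K y, [/\ 0 < T0 <= T, y 0 = psi,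
    forall t, 0 <= t <= T0 -> ball_ eta r (y t) &
    forall t s, 0 <= s -> s < t -> t <= T0 ->
      ball_ eta (K * (t - s) `^ (3 * c)) (flow t s (y s) - y t) /\
      ball_ (- rho) (K * (t - s) `^ (gamma + 3 * c)) (flow t s (y s) - y t)].
Proof.
move=> ck gc /Bsp_ball Hpsi; have [c0 ck0] := andP ck.
have r00 := ball_ge0 Hpsi; set r0 := nm _ psi in Hpsi r00.
have [Tl1 [K1 [T10 K10 HE]]] := euler_bound reg alg T1 k00 g1 kg Hg ck gc r00.
set r := r0 + 1 in HE; have r1 : 1 <= r by rewrite lerDr.
have rp : 0 <= r := le_trans ler01 r1.
(* Midpoint between c and the critical value (1 - gamma) / 3, so that c1 < c while gamma + 3 c1 > 1
   still holds; gamma <= 1 makes it positive. *)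
pose c1 := ((1 - gamma) / 3 + c) / 2.
have c10 : 0 < c1 by move: g1; rewrite /c1; lra.
have c1c : c1 < c by rewrite /c1; lra.
have gc1 : 1 < gamma + 3 * c1 by rewrite /c1; lra.
have K11 : 1 <= K1 + 1 by rewrite lerDr.
have [Tl2 [Cs [T20 Cs0 HS]]] := stability reg alg T1 k00 g1 kg Hg c10 c1c ck0 gc1 r1 K11.
set K := K1 + 1 in HS K11; set th := 3 * (c - c1) in HS.
have th0 : 0 < th by rewrite mulr_gt0 // subr_gt0.
pose T0 := Num.min Tl1 Tl2.
have T00 : 0 < T0 by case/andP: T10 => ? _; case/andP: T20 => ? _; rewrite lt_min; apply/andP.
have T0T : T0 <= T by case/andP: T10 => _ h; rewrite ge_min h.
have T01 : T0 <= 1 by case/andP: T1 => _; exact: le_trans.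
have T0l1 : T0 <= Tl1 by rewrite ge_min lexx.
have T0l2 : T0 <= Tl2 by rewrite ge_min lexx orbT.
pose eul := euler_path psi.
have ctl N tau : is_grid T0 N tau -> controlled eta rho gamma X c r K N tau (eul tau).
  case=> tau0 tauN mono.
  have tauT : tau N <= T by apply: le_trans T0T.
  have len : tau N - tau 0%N <= Tl1 by rewrite tau0 subr0 (le_trans tauN).
  have Et : euler X tau N (eul tau) by [].
  have tau00 : 0 <= tau 0%N by rewrite tau0.
  have [h1 h2] := HE N tau (eul tau) tau00 tauT mono len Et Hpsi.
  split=> // i j ij; have [a b] := h2 i j ij; split.
    by apply: ballW a; rewrite ler_wpM2r ?powR_ge0.
  by apply: ballW b; rewrite ler_wpM2r ?powR_ge0 // lerDl.
(* The Euler path of a finer grid, read at the nodes of the coarser one, is controlled with the same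
   constants, since a remainder involves only the two times at its ends. Both paths start at psi, so
   the mesh term alone remains. *)
have compare N tau N' tau' f dl : is_grid T0 N tau -> is_grid T0 N' tau' ->
    (forall i, (i < N)%N -> tau i.+1 - tau i <= dl) ->
    f 0%N = 0%N -> (forall i, (i <= N)%N -> (f i <= N')%N /\ tau' (f i) = tau i) ->
    (forall j i, (j < i <= N)%N -> (f j < f i)%N) ->
    forall i, (i <= N)%N -> ball_ eta (Cs * dl `^ th) (eul tau i - eul tau' (f i)).
  move=> G G' mesh f0 fN fm; have [tau0 tauN mono] := G.
  have [h1 h2] := ctl _ _ G; have [h1' h2'] := ctl _ _ G'.
  have ctl' : controlled eta rho gamma X c r K N tau (fun i => eul tau' (f i)).
    split=> [i iN|i j ij]; first by apply: h1'; case: (fN i iN).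
    have [ji iN] := andP ij.
    have jN : (j <= N)%N by rewrite (leq_trans (ltnW ji)).
    have [fi ti] := fN i iN; have [_ tj] := fN j jN.
    have := h2' (f i) (f j); rewrite fm // fi => /(_ isT).
    by rewrite /remainder ti tj.
  have z0 : ball_ eta 0 (eul tau 0%N - eul tau' (f 0%N)).
    by rewrite f0 subrr; exact: ball0.
  move=> i iN; rewrite -[dl `^ th]add0r.
  apply: (HS N tau (eul tau) (fun i => eul tau' (f i)) dl 0) => //.
  - by rewrite tau0.
  - exact: le_trans T0T.
  - by rewrite tau0 subr0 (le_trans tauN).
(* Each time t has its own uniform grids, ending exactly at t; the limit is thus defined at every t
   without extension from a dense set. *)
pose U t n := eul (uniform_grid 0 t n) n.+1.
have UG t n : 0 < t <= T0 -> is_grid T0 n.+1 (uniform_grid 0 t n).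
  case/andP=> t0 tT; split; rewrite ?uniform_grid0 ?uniform_grid_end //.
  by move=> j i /andP[ji _]; exact: uniform_grid_lt.
have Umesh t n i : 0 < t <= T0 -> uniform_grid 0 t n i.+1 - uniform_grid 0 t n i <= n.+1%:R^-1.
  case/andP=> t0 tT; rewrite uniform_grid_mesh subr0 ler_piMl ?invr_ge0 //.
  exact: le_trans T01.
pose A n := Cs * gap th n.
have A0 n : 0 <= A n by rewrite mulr_ge0 ?gap_ge0.
have UU t n m : 0 < t <= T0 -> ball_ eta (A n + A m) (U t n - U t m).
  move=> tT; have [N [tau [f1 [f2 [G [f10 f1N f1m] [f20 f2N f2m]]]]]] :=
    common_refinement (UG t n tT) (UG t m tT).
  have h1 := compare _ _ _ _ _ _ (UG t n tT) G (fun i _ => Umesh t n i tT) f10 f1N f1m _ (leqnn _).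
  have h2 := compare _ _ _ _ _ _ (UG t m tT) G (fun i _ => Umesh t m i tT) f20 f2N f2m _ (leqnn _).
  have E : f1 n.+1 = f2 m.+1.
    have [a1 b1] := f1N n.+1 (leqnn _); have [a2 b2] := f2N m.+1 (leqnn _).
    have e : tau (f1 n.+1) = tau (f2 m.+1) by rewrite b1 b2 !uniform_grid_end.
    have [_ _ mono] := G; case: (ltngtP (f1 n.+1) (f2 m.+1)) => // lt.
      by have := mono _ _ (introT andP (conj lt a2)); rewrite e ltxx.
    by have := mono _ _ (introT andP (conj lt a1)); rewrite e ltxx.
  rewrite E in h1; have := ballB h1 h2; congr ball_.
  by rewrite /U; apply/funext => k; rewrite !fctE; ring.
(* The limit is taken coefficient by coefficient, by [squeeze_sup]. The time 0 is set apart because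
   the grids of [0,t] require t > 0. *)
pose y t : coef R 1 := if t == 0 then psi else
  fun k => sup [set U t m k - A m | m in [set: nat]].
have Uy t n : 0 < t <= T0 -> ball_ eta (3 * A n) (U t n - y t).
  move=> tT; have [t0 _] := andP tT; rewrite /y gt_eqF //.
  have cf k m p : `|U t m k - U t p k| <= A m + A p.
    exact: (ball_coef k eta0 (UU t m p tT)).
  apply: (@ball_eps R) => [|e e0]; first by rewrite mulr_ge0.
  have := gap_small th0 (_ : 0 < e / (Cs + 1)).
  rewrite divr_gt0 // ?ltr_wpDl // => /(_ isT)[M _ HM].
  apply: (@ball_lim R eta 1 _ (fun m => U t n - U t (M + m)%N)) => [m|k].
    apply: ballW (UU t n (M + m)%N tT).
    have : A (M + m)%N <= (Cs + 1) * (e / (Cs + 1)).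
      by apply: ler_pM; rewrite ?gap_ge0 // ?lerDl //; apply: HM => /=; exact: leq_addr.
    rewrite mulrCA divff ?mulr1; last by rewrite gt_eqF // ltr_wpDl.
    by have := A0 n; lra.
  apply: cvgB; first exact: cvg_cst.
  apply/cvgrPdist_le => e' e'0.
  have e'1 : 0 < e' / (Cs + 1) by rewrite divr_gt0 // ltr_wpDl.
  have [M' _ HM'] := gap_small th0 e'1.
  exists M' => // m /= mM'; rewrite distrC.
  apply: le_trans (squeeze_sup (u := fun m => U t m k) (a := A) (cf k) (M + m)%N) _.
  have : A (M + m)%N <= (Cs + 1) * (e' / (Cs + 1)).
    apply: ler_pM; rewrite ?gap_ge0 // ?lerDl //; apply: HM' => /=.
    exact: leq_trans (leq_addl _ _).
  by rewrite mulrCA divff ?mulr1 // gt_eqF // ltr_wpDl.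
(* The limits at s and at t come from different grids; their common refinement
   carries one Euler path close to y at both times. *)
have two t s n : 0 <= s -> s < t -> t <= T0 -> exists ys yt,
    [/\ ball_ eta (4 * A n) (ys - y s), ball_ eta (4 * A n) (yt - y t),
        ball_ eta r ys /\ ball_ eta r yt,
        ball_ eta (K * (t - s) `^ (3 * c)) (flow t s ys - yt) &
        ball_ (- rho) (K * (t - s) `^ (gamma + 3 * c)) (flow t s ys - yt)].
  move=> s0 st tT.
  have t0 : 0 < t <= T0 by rewrite (le_lt_trans s0).
  have w4 : 3 * A n <= 4 * A n by have := A0 n; lra.
  move: s0; rewrite le_eqVlt => /orP[/eqP s0|s0].
    subst s; have [h1 h2] := ctl _ _ (UG t n t0).
    have [|a b] := h2 n.+1 0%N; first by rewrite leqnn.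
    rewrite /remainder uniform_grid0 uniform_grid_end in a b.
    exists psi, (U t n); split=> //.
    - by rewrite /y eqxx subrr; apply: ball0; rewrite mulr_ge0.
    - exact: ballW w4 (Uy t n t0).
    - by split; [exact: (h1 0%N)|exact: h1].
  have sT : 0 < s <= T0 by apply/andP; split=> //; apply: le_trans tT; exact: ltW.
  have [N [tau [f1 [f2 [G [f10 f1N f1m] [f20 f2N f2m]]]]]] :=
    common_refinement (UG s n sT) (UG t n t0).
  have k1 := compare _ _ _ _ _ _ (UG s n sT) G (fun i _ => Umesh s n i sT) f10 f1N f1m _ (leqnn _).
  have k2 := compare _ _ _ _ _ _ (UG t n t0) G (fun i _ => Umesh t n i t0) f20 f2N f2m _ (leqnn _).
  have [a1 b1] := f1N n.+1 (leqnn _); have [a2 b2] := f2N n.+1 (leqnn _).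
  rewrite uniform_grid_end in b1; rewrite uniform_grid_end in b2.
  have lt12 : (f1 n.+1 < f2 n.+1)%N.
    rewrite ltnNge; apply/negP => le; have := @is_grid_le _ _ _ _ G (f2 n.+1) (f1 n.+1).
    by rewrite le a1 b1 b2 => /(_ isT) /(lt_le_trans st); rewrite ltxx.
  have [h1 h2] := ctl _ _ G.
  have [|a b] := h2 (f2 n.+1) (f1 n.+1); first by rewrite lt12.
  rewrite /remainder b1 b2 in a b.
  exists (eul tau (f1 n.+1)), (eul tau (f2 n.+1)); split=> //.
  - have -> : eul tau (f1 n.+1) - y s = (U s n - y s) - (U s n - eul tau (f1 n.+1)).
      by apply/funext => k; rewrite !fctE; ring.
    by apply: ballW (ballB (Uy s n sT) k1); rewrite /A /gap; lra.
  - have -> : eul tau (f2 n.+1) - y t = (U t n - y t) - (U t n - eul tau (f2 n.+1)).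
      by apply/funext => k; rewrite !fctE; ring.
    by apply: ballW (ballB (Uy t n t0) k2); rewrite /A /gap; lra.
  - by split; exact: h1.
have y0 : y 0 = psi by rewrite /y eqxx.
have small e : 0 < e -> exists n, 4 * A n <= e.
  move=> e0; have [|n Hn] := gap_exists th0 (_ : 0 <= 4 * Cs) e0; first by rewrite mulr_ge0.
  by exists n; rewrite mulrA.
have yr t : 0 <= t <= T0 -> ball_ eta r (y t).
  case/andP; rewrite le_eqVlt => /orP[/eqP <- _|t0 tT].
    by rewrite y0; apply: ballW Hpsi; rewrite lerDl.
  apply: ball_eps => // e e0; have [n Hn] := small e e0.
  have [ys [yt [_ h2 [_ h3] _ _]]] := two t 0 n (lexx 0) t0 tT.
  have -> : y t = yt - (yt - y t) by rewrite subKr.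
  by apply: ballW (ballB h3 h2); rewrite lerD2l.
have [C HX] := Xbound_exists reg T1 k00 g0 ck; have [C0 _] := HX.
exists T0, r, K, y; split=> //; first by rewrite T00.
move=> t s s0 st tT.
have ts2 : simplex2 T (t, s) by split => //=; [exact: ltW|exact: le_trans T0T].
have sT : 0 <= s <= T0 by rewrite s0 (le_trans (ltW st)).
set B := 8 * C * (1 + r) ^+ 4 * (t - s) `^ kappa0.
have B0 : 0 <= B by rewrite mulr_ge0 ?powR_ge0 // mulr_ge0 ?exprn_ge0 ?addr_ge0 // mulr_ge0.
have K0 : 0 <= K := le_trans ler01 K11.
have err e : 0 < e -> exists ys yt, [/\
    ball_ eta e ((flow t s (y s) - y t) - (flow t s ys - yt)),
    ball_ eta (K * (t - s) `^ (3 * c)) (flow t s ys - yt) &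
    ball_ (- rho) (K * (t - s) `^ (gamma + 3 * c)) (flow t s ys - yt)].
  (* If the approximations are within d, the increments contribute 4 B d to the error, the semigroup
     d and the endpoint d. *)
  move=> e0; have e1 : 0 < e / (B * 4 + 2) by rewrite divr_gt0 // ltr_wpDl // mulr_ge0.
  have [n Hn] := small _ e1; set d := e / _ in e1 Hn.
  have [ys [yt [h1 h2 [h3 _] h4 h5]]] := two t s n s0 st tT.
  exists ys, yt; split=> //.
  have k1 := ballW Hn h1; have k2 := ballW Hn h2.
  have l0 : lip eta r d (y s) ys.
    split; [exact: yr|exact: h3|]; rewrite -opprB; apply: ballN; apply: ballW k1.
    by rewrite ler_peMl // ltW.
  have [_ _ hI] := lip_incr reg T1 HX ck ts2 (ltW e1) l0.
  have hS : ball_ eta d (sg (t - s) (ys - y s)).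
    by apply: ball_sg => //; rewrite subr_ge0 ltW.
  have -> : flow t s (y s) - y t - (flow t s ys - yt) =
      (incr X t s (y s) - incr X t s ys) - sg (t - s) (ys - y s) + (yt - y t).
    rewrite /flow sgB; move: (sg _ _) (sg _ _) (incr _ _ _ _) (incr _ _ _ _).
    by move=> *; apply/funext => k; rewrite !fctE; ring.
  apply: ballW (ballD (ballB hI hS) k2).
  have -> : e = d * (B * 4 + 2) by rewrite /d divfK // gt_eqF // ltr_wpDl // mulr_ge0.
  by rewrite -/B; lra.
split; (apply: ball_eps => [|e e0]).
- by rewrite mulr_ge0 ?powR_ge0.
- have [ys [yt [h1 h2 _]]] := err e e0.
  by rewrite addrC; have := ballD h1 h2; rewrite subrK.
- by rewrite mulr_ge0 ?powR_ge0.
- have [ys [yt [/(ball_le_alpha er) h1 _ h2]]] := err e e0.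
  by rewrite addrC; have := ballD h1 h2; rewrite subrK.
Qed.

End Existence.

(** * Continuity and the space Q *)

Section Continuity.
Context {R : realType}.

(** Balls carry membership together with size, whereas [nm] falls back to zero outside the
    carrier. *)
Definition ncont (alpha : R) n (U : topologicalType) (D : set U) (f : U -> coef R n) : Prop :=
  forall x, D x -> Bsp alpha n (f x) /\
    forall e, 0 < e -> \forall y \near x, D y -> ball_ alpha e (f y - f x).

Lemma ncont_cont_on (alpha : R) n (U : topologicalType) (D : set U) (f : U -> coef R n) :
  ncont alpha D f -> cont_on (Bsp alpha n) D f.
Proof.
move=> H; split=> [x /H[]//|x Dx].
apply/cvgrPdist_le => e e0; rewrite near_withinE.
have [_ /(_ e e0)] := H x Dx; apply: filterS => y h Dy.
by rewrite sub0r normrN ger0_norm ?nm_ge0 //; case: (ball_Bsp (h Dy)).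
Qed.

Lemma ncont_le (alpha beta : R) n (U : topologicalType) (D : set U) (f : U -> coef R n) :
  alpha <= beta -> ncont beta D f -> ncont alpha D f.
Proof.
move=> ab H x Dx; have [h1 h2] := H x Dx; split.
  by case: (ball_Bsp (ball_le_alpha ab (Bsp_ball h1))).
move=> e e0; apply: filterS (h2 e e0) => y h Dy.
exact: ball_le_alpha ab (h Dy).
Qed.

Variable alpha : R.

Section Pointwise.
Variables (U : topologicalType) (D : set U).

Lemma ncontD n (f g : U -> coef R n) :
  ncont alpha D f -> ncont alpha D g -> ncont alpha D (fun x => f x + g x).
Proof.
move=> Hf Hg x Dx; have [f1 f2] := Hf x Dx; have [g1 g2] := Hg x Dx.
split; first exact: BspD.
move=> e e0; have e2 : 0 < e / 2 by rewrite divr_gt0.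
apply: filterS2 (f2 _ e2) (g2 _ e2) => y hf hg Dy.
by rewrite opprD addrACA (splitr e); apply: ballD; [exact: hf|exact: hg].
Qed.

Lemma ncontN n (f : U -> coef R n) : ncont alpha D f -> ncont alpha D (fun x => - f x).
Proof.
move=> Hf x Dx; have [f1 f2] := Hf x Dx; split.
  by case: (ball_Bsp (ballN (Bsp_ball f1))).
move=> e e0; apply: filterS (f2 _ e0) => y hf Dy.
by rewrite -opprD; apply: ballN; exact: hf.
Qed.

Lemma ncontB n (f g : U -> coef R n) :
  ncont alpha D f -> ncont alpha D g -> ncont alpha D (fun x => f x - g x).
Proof. by move=> Hf /ncontN; exact: ncontD. Qed.

Lemma ncont_tens m n (f : U -> coef R m) (g : U -> coef R n) :
  ncont alpha D f -> ncont alpha D g -> ncont alpha D (fun x => tens (f x) (g x)).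
Proof.
move=> Hf Hg x Dx; have [f1 f2] := Hf x Dx; have [g1 g2] := Hg x Dx.
split; first exact: Bsp_tens.
move=> e e0; have Kf := Bsp_ball f1; have Kg := Bsp_ball g1.
set K := nm _ (f x) in Kf; set L := nm _ (g x) in Kg.
have K0 := ball_ge0 Kf; have L0 := ball_ge0 Kg.
have a0 : 0 < e / 2 / (L + 1) by rewrite !divr_gt0 // ltr_wpDl.
have b0 : 0 < e / 2 / (K + 1) by rewrite !divr_gt0 // ltr_wpDl.
apply: filterS3 (f2 _ a0) (g2 _ b0) (g2 _ ltr01) => y hf hg hg1 Dy.
have -> : tens (f y) (g y) - tens (f x) (g x) =
    tens (f y - f x) (g y) + tens (f x) (g y - g x).
  by rewrite tensBl tensBr addrA subrK.
have gy : ball_ alpha (L + 1) (g y).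
  by rewrite -(subrK (g x) (g y)) addrC; apply: ballD => //; exact: hg1.
apply: ballW (ballD (ball_tens (hf Dy) gy) (ball_tens Kf (hg Dy))).
rewrite divfK ?gt_eqF ?ltr_wpDl // [leRHS](splitr e) lerD2l.
by rewrite mulrCA -[leRHS]mulr1 ler_wpM2l ?divr_ge0 ?(ltW e0) // ler_pdivrMr ?ltr_wpDl // mul1r lerDl.
Qed.

Lemma ncont_sg n (a : U -> R) (f : U -> coef R n) :
  (forall x, D x -> 0 <= a x) -> (forall x, D x -> a y @[y --> x] --> a x) ->
  ncont alpha D f -> ncont alpha D (fun x => sg (a x) (f x)).
Proof.
move=> a0 ac Hf x Dx; have [f1 f2] := Hf x Dx; split.
  by apply: Bsp_sg => //; exact: a0.
move=> e e0; have e2 : 0 < e / 2 by rewrite divr_gt0.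
have near1 : \forall y \near x, 0 <= a y ->
    ball_ alpha (e / 2) (sg (a y) (f x) - sg (a x) (f x)).
  exact: ac x Dx _ (sg_cont f1 (a0 x Dx) e2).
apply: filterS2 near1 (f2 _ e2) => y h1 h2 Dy.
have -> : sg (a y) (f y) - sg (a x) (f x) =
    (sg (a y) (f x) - sg (a x) (f x)) + sg (a y) (f y - f x).
  by rewrite sgB [RHS]addrC addrA subrK.
rewrite (splitr e); apply: ballD; first exact: (h1 (a0 y Dy)).
by apply: ball_sg; [exact: a0|exact: h2].
Qed.

Lemma ncont_op n m (beta : R) (P : U -> coef R n -> coef R m) (f : U -> coef R n) :
  (forall x, D x -> Lsp (Bsp alpha n) (Bsp beta m) (P x)) ->
  (forall x, D x -> forall e, 0 < e -> \forall y \near x, D y ->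
     nm (Lsp (Bsp alpha n) (Bsp beta m)) (P y - P x) <= e) ->
  ncont alpha D f -> ncont beta D (fun x => P x (f x)).
Proof.
move=> HL HP Hf x Dx; have [f1 f2] := Hf x Dx; have Lx := HL x Dx; split.
  by case: Lx => + _ _; exact.
move=> e e0; have Kf := Bsp_ball f1.
set K := nm _ (f x) in Kf; have K0 := ball_ge0 Kf.
set L := Num.max 0 (nm (Lsp (Bsp alpha n) (Bsp beta m)) (P x)).
have L0 : 0 <= L by rewrite le_max lexx.
have PL : nm (Lsp (Bsp alpha n) (Bsp beta m)) (P x) <= L by rewrite le_max lexx orbT.
have a0 : 0 < e / 2 / (K + 1) by rewrite !divr_gt0 // ltr_wpDl.
have b0 : 0 < e / 2 / (L + 1) by rewrite !divr_gt0 // ltr_wpDl.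
apply: filterS3 (HP x Dx _ a0) (f2 _ b0) (f2 _ ltr01) => y h1 h2 h3 Dy.
have Ly := HL y Dy.
have fy : ball_ alpha (K + 1) (f y).
  by rewrite -(subrK (f x) (f y)) addrC; apply: ballD => //; exact: h3.
have Efy := (ball_Bsp fy).1.
have -> : P y (f y) - P x (f x) = (P y - P x) (f y) + P x (f y - f x).
  by rewrite (LspB Lx) // (_ : (P y - P x) (f y) = P y (f y) - P x (f y)) // addrA subrK.
have B1 := Lsp_ball (Lsp_sub Ly Lx) (h1 Dy) fy.
have B2 := Lsp_ball Lx PL (h2 Dy).
apply: ballW (ballD B1 B2).
rewrite divfK ?gt_eqF ?ltr_wpDl // [leRHS](splitr e) lerD2l.
by rewrite mulrCA -[leRHS]mulr1 ler_wpM2l ?divr_ge0 ?(ltW e0) // ler_pdivrMr ?ltr_wpDl // mul1r lerDl.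
Qed.

End Pointwise.

Lemma ncont_comp n (U V : topologicalType) (D : set U) (D' : set V) (p : U -> V)
    (f : V -> coef R n) :
  (forall x, D x -> D' (p x)) -> (forall x, D x -> p y @[y --> x] --> p x) ->
  ncont alpha D' f -> ncont alpha D (fun x => f (p x)).
Proof.
move=> DD pc Hf x Dx; have [f1 f2] := Hf _ (DD x Dx); split=> // e e0.
have : \forall y \near x, D' (p y) -> ball_ alpha e (f (p y) - f (p x)).
  exact: pc x Dx _ (f2 e e0).
apply: filterS => y h Dy.
exact: h (DD y Dy).
Qed.

(** The twisted increment compares a time only with an earlier one. Hence both f t and f t0 are
    compared with the evolution of f s0 for a common s0 slightly before them, and strong continuity
    of the semigroup at f s0 does the rest. *)
Lemma ncont_path n (T C p : R) (f : R -> coef R n) : 0 < p ->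
  (forall t, 0 <= t <= T -> Bsp alpha n (f t)) ->
  (forall t s, 0 <= s -> s < t -> t <= T -> ball_ alpha (C * (t - s) `^ p) (hdelta1 f t s)) ->
  ncont alpha [set t | 0 <= t <= T] f.
Proof.
move=> p0 fE Hd t0 /= t0T; split; first exact: fE.
have [t00 t0T'] := andP t0T.
move=> e e0; have e3 : 0 < e / 3 by rewrite divr_gt0.
have e4 : 0 < e / 3 / (`|C| + 1) by rewrite !divr_gt0 // ltr_wpDl.
have [d d0 Hd'] := powR_small p0 e4.
(* With d / 2 here and |t - t0| < d / 2 below, s0 <= t and t - s0 <= d. *)
pose s0 := Num.max 0 (t0 - d / 2).
have s00 : 0 <= s0 by rewrite le_max lexx.
have d20 : 0 < d / 2 by rewrite divr_gt0.
have s0t0 : s0 <= t0 by rewrite ge_max t00 /= gerBl ltW.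
have s0T : 0 <= s0 <= T by rewrite s00 (le_trans s0t0).
have small t : s0 <= t <= T -> t - s0 <= d -> ball_ alpha (e / 3) (hdelta1 f t s0).
  case/andP; rewrite le_eqVlt => /orP[/eqP <- _ _|st tT td].
    by rewrite /hdelta1 subrr sg0 subrr; apply: ball0; exact: ltW.
  apply: ballW (Hd t s0 s00 st tT).
  apply: (@le_trans _ _ ((`|C| + 1) * (e / 3 / (`|C| + 1)))); last first.
    by rewrite mulrCA divff ?mulr1 // gt_eqF // ltr_wpDl.
  apply: (@le_trans _ _ ((`|C| + 1) * (t - s0) `^ p)).
    by rewrite ler_wpM2r ?powR_ge0 // (le_trans (ler_norm _)) // lerDl.
  rewrite ler_wpM2l ?addr_ge0 //; apply: Hd'.
  by rewrite subr_ge0 (ltW st).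
have cs : continuous (fun t : R => t - s0).
  by move=> t; apply: cvgB; [exact: cvg_id|exact: cvg_cst].
have t0s0 : 0 <= t0 - s0 by rewrite subr_ge0.
have n1 : \forall t \near t0, 0 <= t - s0 ->
    ball_ alpha (e / 3) (sg (t - s0) (f s0) - sg (t0 - s0) (f s0)).
  exact: cs t0 _ (sg_cont (fE s0 s0T) t0s0 e3).
have n2 : \forall t \near t0, `|t0 - t| < d / 2.
  exact: (nbhsx_ballx t0 _ d20).
apply: filterS2 n1 n2 => t h1 h2 /= /andP[tp tT].
have [l1 l2] : s0 <= t /\ t - s0 <= d.
  move: h2; rewrite ltr_norml => /andP[h2 h3].
  have q : t0 - d / 2 <= s0 by rewrite le_max lexx orbT.
  split; last by lra.
  by rewrite ge_max tp /=; lra.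
have b1 : ball_ alpha (e / 3) (hdelta1 f t s0) by apply: small; rewrite ?l1.
have b2 : ball_ alpha (e / 3) (hdelta1 f t0 s0).
  apply: small; rewrite ?s0t0 //.
  have q : t0 - d / 2 <= s0 by rewrite le_max lexx orbT.
  by lra.
have b3 : ball_ alpha (e / 3) (sg (t - s0) (f s0) - sg (t0 - s0) (f s0)).
  by apply: h1; rewrite subr_ge0.
have -> : f t - f t0 = hdelta1 f t s0 - hdelta1 f t0 s0 +
    (sg (t - s0) (f s0) - sg (t0 - s0) (f s0)).
  rewrite /hdelta1; move: (sg _ _) (sg _ _) => a b.
  by apply/funext => k; rewrite !fctE; ring.
by apply: ballW (ballD (ballB b1 b2) b3); lra.
Qed.

End Continuity.

(** * The limit path solves the equation and belongs to Q *)

Section SolutionPath.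
Context {R : realType}.
Variables (T eta rho gamma kappa0 : R) (X : treeops (R := R)).
Arguments X : clear implicits.
Hypotheses (reg : regularity T eta X gamma kappa0 rho)
  (alg : algebraic_relations T eta X).
Hypotheses (T1 : 0 < T <= 1) (k00 : 0 < kappa0) (g1 : gamma <= 1)
  (kg : kappa0 < gamma) (Hg : gamma = kappa0 + eta + rho).

Local Notation flow := (flow X).

Let g0 : 0 < gamma. Proof. exact: lt_trans kg. Qed.
Let er : - rho <= eta.
Proof. by rewrite -subr_ge0; move: kg; rewrite Hg; lra. Qed.

Lemma C2_of_cnt (mu alpha C : R) n (g : R -> R -> coef R n) :
  ncont alpha (simplex2 T) (fun p => g p.1 p.2) ->
  (forall t s, 0 <= s -> s < t -> t <= T -> ball_ alpha (C * (t - s) `^ mu) (g t s)) ->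
  C2 T mu (Bsp alpha n) g.
Proof.
move=> /ncont_cont_on H1 H2; split=> //; exists C => t s s0 st tT.
by case: (ball_Bsp (H2 t s s0 st tT)).
Qed.

Lemma ncont_tpow (alpha : R) (U : topologicalType) (D : set U) (f : U -> coef R 1) n :
  ncont alpha D f -> ncont alpha D (fun x => tpow n.+1 (f x)).
Proof.
move=> Hf; elim: n => [|n IH].
  by rewrite (_ : (fun x => _) = f) //; apply/funext => x; rewrite tpow1.
rewrite (_ : (fun x => _) = fun x => tens (f x) (tpow n.+1 (f x)) : coef R (1 + n.+1)).
  exact: (@ncont_tens R alpha U D 1 n.+1 f (fun x => tpow n.+1 (f x)) Hf IH).
by apply/funext => x; rewrite -{2}(tpow1 (f x)); exact: (tpow_add 1 n.+1).
Qed.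

Lemma ncont_X tau (U : topologicalType) (D : set U) (pi_ : U -> R * R)
    (f : U -> coef R (leaves tau)) :
  (2 <= leaves tau <= 4)%N ->
  (forall x, D x -> simplex2 T (pi_ x)) ->
  (forall x, D x -> pi_ y @[y --> x] --> pi_ x) ->
  ncont eta D f -> ncont eta D (fun x => X tau (pi_ x).1 (pi_ x).2 (f x)).
Proof.
move=> lt DD pc; apply: (ncont_op (P := fun x => X tau (pi_ x).1 (pi_ x).2)).
  by move=> x Dx; apply: (reg_Lsp reg lt); rewrite -surjective_pairing; exact: DD.
move=> x Dx e e0; have [[[_ ct] _] _] := reg lt.
have /cvgrPdist_le /(_ e e0) := ct (pi_ x) (DD x Dx).
rewrite near_withinE => h.
have : \forall y \near x, simplex2 T (pi_ y) ->
    `|0 - nm (Lsp (Bsp eta (leaves tau)) (Bsp eta 1))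
       (X tau (pi_ y).1 (pi_ y).2 - X tau (pi_ x).1 (pi_ x).2)| <= e.
  exact: pc x Dx _ h.
apply: filterS => y hy /DD /hy; rewrite sub0r normrN.
exact: le_trans (ler_norm _).
Qed.

Lemma powR_gamma_nat (x c : R) n : 0 <= x -> 0 < c ->
  x `^ gamma * (x `^ c) ^+ n = x `^ (gamma + n%:R * c).
Proof.
move=> x0 c0; case: n => [|n]; first by rewrite expr0 mulr1 mul0r addr0.
rewrite powR_powR_nat -powR_add_ge0 ?(mulrC c) // ?mulr_gt0 ?ltr0n //.
Qed.

Variables (c r K : R) (y : R -> coef R 1) (psi : coef R 1).
Hypotheses (ck : 0 < c <= kappa0) (gc : 1 < gamma + 3 * c).
Hypotheses (y0 : y 0 = psi) (yr : forall t, 0 <= t <= T -> ball_ eta r (y t)).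
Hypothesis yM : forall t s, 0 <= s -> s < t -> t <= T ->
  ball_ eta (K * (t - s) `^ (3 * c)) (flow t s (y s) - y t) /\
  ball_ (- rho) (K * (t - s) `^ (gamma + 3 * c)) (flow t s (y s) - y t).

Let c0 : 0 < c. Proof. by case/andP: ck. Qed.

Let K0 : 0 <= K.
Proof.
case/andP: T1 => T0 _; have [h _] := yM (lexx 0) T0 (lexx T).
by have := ball_ge0 h; rewrite pmulr_lge0 // powR_gt0 // subr0.
Qed.

Let r0 : 0 <= r.
Proof. by case/andP: T1 => T0 _; apply: ball_ge0 (yr (t := 0) _); rewrite lexx ltW. Qed.

Let len t s : 0 <= s -> s <= t -> t <= T -> 0 <= t - s <= 1.
Proof.
case/andP: T1 => _ T1' s0 st tT; rewrite subr_ge0 st /= lerBlDr.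
by rewrite (le_trans tT) // (le_trans T1') // lerDl.
Qed.

Lemma hdelta1_flow t s :
  hdelta1 y t s = incr X t s (y s) - (flow t s (y s) - y t).
Proof.
rewrite /hdelta1 /flow; move: (sg _ _) (incr _ _ _ _) => a b.
by apply/funext => k; rewrite !fctE; ring.
Qed.

Lemma hdelta1_bound : exists2 C, 0 <= C & forall t s, 0 <= s -> s < t -> t <= T ->
  ball_ eta (C * (t - s) `^ c) (hdelta1 y t s).
Proof.
have [C HX] := Xbound_exists reg T1 k00 g0 ck; have [C0 _] := HX.
exists (8 * C * (1 + r) ^+ 4 + K).
  by rewrite addr_ge0 // mulr_ge0 ?exprn_ge0 ?addr_ge0 // mulr_ge0.
move=> t s s0 st tT; rewrite hdelta1_flow mulrDl.
have sT : 0 <= s <= T by rewrite s0 (le_trans (ltW st)).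
have ts : simplex2 T (t, s) by split=> //=; exact: ltW.
have [h _ _] := lip_incr reg T1 HX ck ts (lexx 0) (lip_refl (yr sT)).
have L1 := len s0 (ltW st) tT.
apply: ballB.
  apply: ballW h; rewrite ler_wpM2l; first by [].
    by rewrite mulr_ge0 ?exprn_ge0 ?addr_ge0 // mulr_ge0.
  by apply: powRB_le => //; case/andP: ck.
have [h2 _] := yM s0 st tT; apply: ballW h2; rewrite ler_wpM2l //.
by apply: powRB_le => //; move: c0; lra.
Qed.

Lemma ncont_y : ncont eta [set t | 0 <= t <= T] y.
Proof.
have [C C0 HC] := hdelta1_bound; apply: (ncont_path c0 _ HC).
by move=> t /yr /ball_Bsp [].
Qed.

Let fst_cvg (x : R * R) : p.1 @[p --> x] --> x.1.
Proof. by case: x => a b; exact: cvg_fst. Qed.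
Let snd_cvg (x : R * R) : p.2 @[p --> x] --> x.2.
Proof. by case: x => a b; exact: cvg_snd. Qed.

Let sub_cvg (x : R * R) : p.1 - p.2 @[p --> x] --> x.1 - x.2.
Proof. by apply: cvgB; [exact: fst_cvg|exact: snd_cvg]. Qed.

Let ncont_y1 : ncont eta (simplex2 T) (fun p => y p.1).
Proof.
apply: (ncont_comp (D' := [set t | 0 <= t <= T]) (p := fst)) ncont_y.
  by move=> [a b] [/= h1 h2 h3]; rewrite h3 andbT (le_trans h1).
by move=> x _; exact: fst_cvg.
Qed.

Let ncont_y2 : ncont eta (simplex2 T) (fun p => y p.2).
Proof.
apply: (ncont_comp (D' := [set t | 0 <= t <= T]) (p := snd)) ncont_y.
  by move=> [a b] [/= h1 h2 h3]; rewrite h1 /= (le_trans h2).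
by move=> x _; exact: snd_cvg.
Qed.

Let ncont_hdelta n (f : R -> coef R n) :
  ncont eta (simplex2 T) (fun p => f p.1) -> ncont eta (simplex2 T) (fun p => f p.2) ->
  ncont eta (simplex2 T) (fun p => hdelta1 f p.1 p.2).
Proof.
move=> f1 f2; apply: ncontB => //; apply: (ncont_sg (a := fun p => p.1 - p.2)) => //.
by move=> [a b] [/= _ h _]; rewrite subr_ge0.
Qed.

Let pow_le t s q : 0 <= s -> s < t -> t <= T -> q <= c -> (t - s) `^ c <= (t - s) `^ q.
Proof.
move=> s0 st tT qc; apply: ger_powR => //; have /andP[_ ->] := len s0 (ltW st) tT.
by rewrite subr_gt0 st.
Qed.

Lemma C1star_y q : q <= c -> C1star T q eta y.
Proof.
move=> qc; have [C C0 HC] := hdelta1_bound; split.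
- by move=> t /yr /ball_Bsp [].
- by exists r => t /yr /ball_Bsp [].
- apply: (C2_of_cnt (C := C)); first exact: ncont_hdelta.
  move=> t s s0 st tT; apply: ballW (HC t s s0 st tT).
  by rewrite ler_wpM2l // pow_le.
Qed.

(** Since the semigroup on 2-tensors is S (x) S, the twisted increment obeys a Leibniz rule: that of
    y tensored with y_t, plus S_{ts} y_s tensored with that of y. *)
Lemma C1star_yy q : q <= c -> C1star T q eta (fun t => tens (y t) (y t) : coef R 2).
Proof.
move=> qc; have [C C0 HC] := hdelta1_bound.
have yy t : 0 <= t <= T -> ball_ eta (r * r) (tens (y t) (y t) : coef R 2).
  by move=> tT; apply: (@ball_tens _ _ 1 1); exact: yr.
split.
- by move=> t /yy /ball_Bsp [].
- by exists (r * r) => t /yy /ball_Bsp [].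
- apply: (C2_of_cnt (C := C * r + r * C)).
    by apply: ncont_hdelta; exact: (@ncont_tens _ _ _ _ 1 1).
  move=> t s s0 st tT.
  have tT0 : 0 <= t <= T by rewrite tT (le_trans s0) // ltW.
  have sT0 : 0 <= s <= T by rewrite s0 (le_trans (ltW st)).
  have -> : hdelta1 (fun t => tens (y t) (y t) : coef R 2) t s =
      tens (hdelta1 y t s) (y t) + tens (sg (t - s) (y s)) (hdelta1 y t s).
    rewrite /hdelta1 (@sg_tens _ 1 1) tensBl tensBr.
    by rewrite addrA subrK.
  have hd := HC t s s0 st tT.
  have hs : ball_ eta r (sg (t - s) (y s)).
    by apply: ball_sg; [rewrite subr_ge0 ltW|exact: yr].
  apply: ballW (@ballD _ _ 2 _ _ _ _ (@ball_tens _ _ 1 1 _ _ _ _ hd (yr tT0))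
     (@ball_tens _ _ 1 1 _ _ _ _ hs hd)).
  have -> : C * (t - s) `^ c * r + r * (C * (t - s) `^ c) = (C * r + r * C) * (t - s) `^ c.
    by ring.
  by apply: ler_wpM2l; [rewrite addr_ge0 // mulr_ge0|exact: pow_le].
Qed.

Let ncont_X2 tau n : leaves tau = n.+1 -> (1 <= n <= 3)%N ->
  ncont eta (simplex2 T) (fun p => X tau p.1 p.2 (tpow (leaves tau) (y p.2))).
Proof.
move=> En n3; apply: (@ncont_X tau _ _ id) => //.
- by rewrite En !ltnS.
- by rewrite En; exact: ncont_tpow.
Qed.

Definition ysharp t s : coef R 1 := hdelta1 y t s -
  (X vee t s (tens (y s) (y s)) +
   X treeL t s (tens (tens (y s) (y s) : coef R 2) (y s)) +
   X treeR t s (tens (y s) (tens (y s) (y s) : coef R 2))).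

Lemma incr_expand t s x : incr X t s x =
  X vee t s (tpow 2 x) + X treeL t s (tpow 3 x) + X treeR t s (tpow 3 x) +
  (X (Node vee vee) t s (tpow 4 x) + X (Node treeL Leaf) t s (tpow 4 x) +
   X (Node treeR Leaf) t s (tpow 4 x) + X (Node Leaf treeL) t s (tpow 4 x) +
   X (Node Leaf treeR) t s (tpow 4 x)).
Proof.
have -> : incr X t s x = X vee t s (tpow 2 x) + (X treeL t s (tpow 3 x) +
    (X treeR t s (tpow 3 x) + (X (Node vee vee) t s (tpow 4 x) +
    (X (Node treeL Leaf) t s (tpow 4 x) + (X (Node treeR Leaf) t s (tpow 4 x) +
    (X (Node Leaf treeL) t s (tpow 4 x) + X (Node Leaf treeR) t s (tpow 4 x))))))).
  by rewrite /incr /trees !big_cons big_nil addr0.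
repeat match goal with |- context [X ?b ?c ?d ?z] => generalize (X b c d z) end.
by move=> *; apply/funext => k; rewrite !fctE; ring.
Qed.

(** The four-leaf terms and the remainder of y are all that is left after the two- and three-leaf
    terms are removed; both are of order 3 c. *)
Lemma C2_ysharp q : q <= c -> C2 T (3 * q) (Bsp eta 1) ysharp.
Proof.
move=> qc; have [C HX] := Xbound_exists reg T1 k00 g0 ck; have [C0 HXb] := HX.
have E2 (x : coef R 1) : tens x x = tpow 2 x :> coef R 2 by rewrite tpow2.
have E3 (x : coef R 1) : tens (tens x x : coef R 2) x = tpow 3 x :> coef R 3 by rewrite tpow3.
have E3' (x : coef R 1) : tens x (tens x x : coef R 2) = tpow 3 x :> coef R 3 by rewrite tpow3 tensA3.
have yE t s : ysharp t s = hdelta1 y t s -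
    (X vee t s (tpow 2 (y s)) + X treeL t s (tpow 3 (y s)) + X treeR t s (tpow 3 (y s))).
  rewrite /ysharp; congr (_ - (_ + _ + _)); congr (X _ _ _ _).
  - exact: E2.
  - exact: E3.
  - exact: E3'.
apply: (C2_of_cnt (C := 5 * (C * r ^+ 4) + K)).
  rewrite (_ : (fun p => _) = fun p : R * R => hdelta1 y p.1 p.2 -
    (X vee p.1 p.2 (tpow 2 (y p.2)) + X treeL p.1 p.2 (tpow 3 (y p.2)) +
     X treeR p.1 p.2 (tpow 3 (y p.2)))); last by apply/funext => p; rewrite yE.
  apply: ncontB; first exact: ncont_hdelta.
  apply: ncontD; first apply: ncontD.
  - exact: (@ncont_X2 vee 1).
  - exact: (@ncont_X2 treeL 2).
  - exact: (@ncont_X2 treeR 2).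
move=> t s s0 st tT; have Lp : 0 < t - s by rewrite subr_gt0.
have L1 := len s0 (ltW st) tT.
have ts : simplex2 T (t, s) by split=> //=; exact: ltW.
have sT : 0 <= s <= T by rewrite s0 (le_trans (ltW st)).
set L := (t - s) `^ (3 * c).
have H4 tau : leaves tau = 4%N -> ball_ eta (C * r ^+ 4 * L) (X tau t s (tpow (leaves tau) (y s))).
  move=> lt; have lt' : (2 <= leaves tau <= 4)%N by rewrite lt.
  have hp : ball_ eta (r ^+ 4) (tpow (leaves tau) (y s)).
    by rewrite lt; apply: ball_tpow; exact: yr.
  have [h _] := HXb tau t s lt' ts _ _ hp; apply: ballW h.
  rewrite [(leaves tau - 2)%N](_ : _ = 2%N) ?lt //.
  rewrite mulrAC ler_wpM2l ?mulr_ge0 ?exprn_ge0 // powR_powR_nat -powR_add //.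
  apply: ger_powR; first by rewrite Lp; case/andP: L1.
  by case/andP: ck => _; lra.
have [hM _] := yM s0 st tT.
rewrite yE hdelta1_flow incr_expand.
set a := X vee _ _ _ + _ + _; set b := _ + X (Node Leaf treeR) t s _.
set m := flow t s (y s) - y t in hM *.
have -> : a + b - m - a = b - m by apply/funext => k; rewrite !fctE; ring.
have hb : ball_ eta (5 * (C * r ^+ 4) * L) b.
  apply: ballW (ballD (ballD (ballD (ballD (H4 (Node vee vee) erefl)
    (H4 (Node treeL Leaf) erefl)) (H4 (Node treeR Leaf) erefl))
    (H4 (Node Leaf treeL) erefl)) (H4 (Node Leaf treeR) erefl)).
  by rewrite le_eqVlt; apply/orP; left; apply/eqP; ring.
apply: ballW (ballB hb hM); rewrite -mulrDl ler_wpM2l //.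
  by rewrite addr_ge0 // !mulr_ge0 ?exprn_ge0.
apply: ger_powR; first by rewrite Lp; case/andP: L1.
by lra.
Qed.

Lemma Qdecomp_y q1 q2 : q1 <= c -> q2 <= c ->
  Qdecomp T eta X c q1 q2 psi y y (fun t => tens (y t) (y t)) ysharp.
Proof.
move=> qc1 qc2; split=> //; first exact: C1star_y.
  by split; [exact: C1star_y|exact: C1star_yy|exact: C2_ysharp].
by move=> t s _; rewrite /ysharp addrC subrK.
Qed.

Let three : topologicalType := (R * R * R)%type.

Let cvg_1 (x : three) : fst p @[p --> x] --> fst x.
Proof. by case: x => a b; exact: cvg_fst. Qed.

Let cvg_tu (x : three) : (p.1.1, p.1.2) @[p --> x] --> (x.1.1, x.1.2).
Proof.
rewrite -surjective_pairing.
rewrite (_ : (fun p => _) = fst); last by apply/funext => -[[]].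
exact: cvg_1.
Qed.

Let cvg_u (x : three) : p.1.2 @[p --> x] --> x.1.2.
Proof. exact: (cvg_comp _ _ (@cvg_1 x) (@snd_cvg x.1)). Qed.

Let cvg_s (x : three) : p.2 @[p --> x] --> x.2.
Proof. by case: x => a b; exact: cvg_snd. Qed.

Let cvg_us (x : three) : (p.1.2, p.2) @[p --> x] --> (x.1.2, x.2).
Proof. exact: (cvg_pair (@cvg_u x) (@cvg_s x)). Qed.

Let s3_tu (x : three) : simplex3 T x -> simplex2 T (x.1.1, x.1.2).
Proof.
by case: x => -[t u] s [/= s0 su ut tT]; split=> //=; exact: le_trans su.
Qed.

Let s3_us (x : three) : simplex3 T x -> simplex2 T (x.1.2, x.2).
Proof.
by case: x => -[t u] s [/= s0 su ut tT]; split=> //=; exact: le_trans tT.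
Qed.

Let ncont3_us (f : R * R -> coef R 1) :
  ncont eta (simplex2 T) f -> ncont eta (simplex3 T) (fun p : three => f (p.1.2, p.2)).
Proof.
apply: (ncont_comp (U := three) (D' := simplex2 T) (p := fun p : three => (p.1.2, p.2))).
  exact: s3_us.
by move=> x _; exact: cvg_us.
Qed.

Let ncont3_tu tau (f : three -> coef R (leaves tau)) : (2 <= leaves tau <= 4)%N ->
  ncont eta (simplex3 T) f ->
  ncont eta (simplex3 T) (fun p : three => X tau p.1.1 p.1.2 (f p)).
Proof.
by move=> lt Hf; exact: (@ncont_X tau three _ (fun p => (p.1.1, p.1.2))).
Qed.

Let ncont3_p : ncont eta (simplex3 T) (fun p : three => sg (p.1.2 - p.2) (y p.2)).
Proof.
apply: (ncont3_us (f := fun p => sg (p.1 - p.2) (y p.2))).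
apply: (ncont_sg (a := fun p => p.1 - p.2)) => //.
by move=> [a b] [/= _ h _]; rewrite subr_ge0.
Qed.

Let ncont3_X tau n : leaves tau = n.+1 -> (1 <= n <= 3)%N ->
  ncont eta (simplex3 T) (fun p : three => X tau p.1.2 p.2 (tpow (leaves tau) (y p.2))).
Proof.
move=> e n3; apply: (ncont3_us (f := fun p => X tau p.1 p.2 (tpow (leaves tau) (y p.2)))).
exact: ncont_X2 e n3.
Qed.

Let ncont3_q : ncont eta (simplex3 T) (fun p : three => y p.1.2).
Proof. by apply: (ncont3_us (f := fun p => y p.1)). Qed.

Let cT2 (f g : three -> coef R 1) : ncont eta (simplex3 T) f -> ncont eta (simplex3 T) g ->
  ncont eta (simplex3 T) (fun p => tens (f p) (g p) : coef R 2).
Proof. exact: (@ncont_tens _ _ _ _ 1 1). Qed.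

Let cT3 (f : three -> coef R 2) (g : three -> coef R 1) :
  ncont eta (simplex3 T) f -> ncont eta (simplex3 T) g ->
  ncont eta (simplex3 T) (fun p => tens (f p) (g p) : coef R 3).
Proof. exact: (@ncont_tens _ _ _ _ 2 1). Qed.

Lemma ncont_coefV :
  ncont eta (simplex3 T) (fun p : three => coefV X p.1.2 p.2 (y p.2) (y p.1.2)).
Proof.
have v := @ncont3_X vee 1 erefl isT; have l := @ncont3_X treeL 2 erefl isT.
have r' := @ncont3_X treeR 2 erefl isT; have lr := ncontD l r'; have p := ncont3_p.
have q := ncont3_q.
exact: (ncontB (ncontD (ncontD (ncontD (ncontD (ncontD (cT2 v p) (cT2 p v)) (cT2 v v)) (cT2 lr p))
  (cT2 p lr)) (cT2 p p)) (cT2 q q)).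
Qed.

Lemma ncont_coefLR :
  ncont eta (simplex3 T) (fun p : three => coefLR X p.1.2 p.2 (y p.2) (y p.1.2)).
Proof.
have v := @ncont3_X vee 1 erefl isT; have p := ncont3_p; have q := ncont3_q.
exact: (ncontB (ncontD (ncontD (ncontD (cT3 (cT2 v p) p) (cT3 (cT2 p v) p)) (cT3 (cT2 p p) v))
  (cT3 (cT2 p p) p)) (cT3 (cT2 q q) q)).
Qed.

Lemma ncont_coef4 : ncont eta (simplex3 T)
  (fun p : three => tpow 4 (sg (p.1.2 - p.2) (y p.2)) - tpow 4 (y p.1.2)).
Proof. exact: ncontB (ncont_tpow 3 ncont3_p) (ncont_tpow 3 ncont3_q). Qed.

(** Grouping by number of leaves: index i collects the trees with i + 2 leaves, which carry the
    power gamma + i c of t - u and leave (3 - i) c to u - s. This is the splitting that [C3]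
    requires. *)
Definition rem3 (i : 'I_3) (t u s : R) : coef R 1 :=
  match val i with
  | 0%N => X vee t u (coefV X u s (y s) (y u))
  | 1%N => X treeL t u (coefLR X u s (y s) (y u)) + X treeR t u (coefLR X u s (y s) (y u))
  | _ => X (Node vee vee) t u (tpow 4 (sg (u - s) (y s)) - tpow 4 (y u)) +
         X (Node treeL Leaf) t u (tpow 4 (sg (u - s) (y s)) - tpow 4 (y u)) +
         X (Node treeR Leaf) t u (tpow 4 (sg (u - s) (y s)) - tpow 4 (y u)) +
         X (Node Leaf treeL) t u (tpow 4 (sg (u - s) (y s)) - tpow 4 (y u)) +
         X (Node Leaf treeR) t u (tpow 4 (sg (u - s) (y s)) - tpow 4 (y u))
  end.

Lemma flow_diag t : 0 <= t <= T -> flow t t (y t) - y t = 0.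
Proof.
move=> tT; have [t0 tT'] := andP tT.
have [C HX] := Xbound_exists reg T1 k00 g0 ck.
have tt : simplex2 T (t, t) by split.
have [h _ _] := lip_incr reg T1 HX ck tt (lexx 0) (lip_refl (yr tT)).
rewrite subrr powR0 ?gt_eqF // mulr0 in h.
by rewrite /flow subrr sg0 (ball0_eq0 h) addr0 subrr.
Qed.

Lemma yM_le t s : simplex2 T (t, s) ->
  ball_ eta (K * ((t - s) `^ c) ^+ 3) (flow t s (y s) - y t).
Proof.
case=> /= s0; rewrite le_eqVlt powR_cube => /orP[/eqP <- sT|st tT].
  by rewrite flow_diag ?s0 //; apply: ball0; rewrite mulr_ge0 ?powR_ge0.
by case: (yM s0 st tT).
Qed.

(** The second increment of the germ is the left side of [incr_defect] with q = y u, so the identity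
    valid for the flow gives the decomposition. *)
Lemma C3_germ : C3 T (gamma + 3 * c) (- rho) (hdelta2 (germ X y)).
Proof.
have [C HX] := Xbound_exists reg T1 k00 g0 ck; have [C0 HXb] := HX.
exists 3%N, rem3, (fun i => gamma + (val i)%:R * c), (stepB C r K).
have XL := fun tau t s => @reg_Lsp _ _ _ _ _ _ _ reg tau t s.
split.
- move=> i; rewrite ltr_wpDr ?mulr_ge0 ?ler0n ?(ltW c0) //= ltrD2l ltr_pM2r //.
  by rewrite ltr_nat.
- move=> i; apply: ncont_cont_on; apply: (ncont_le er); rewrite /rem3.
  case: i => [[|[|[|//]]] /= _].
  + exact: (ncont3_tu (tau := vee) isT ncont_coefV).
  + exact: (ncontD (ncont3_tu (tau := treeL) isT ncont_coefLR)
      (ncont3_tu (tau := treeR) isT ncont_coefLR)).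
  + exact: (ncontD (ncontD (ncontD (ncontD (ncont3_tu (tau := Node vee vee) isT ncont_coef4)
      (ncont3_tu (tau := Node treeL Leaf) isT ncont_coef4))
      (ncont3_tu (tau := Node treeR Leaf) isT ncont_coef4))
      (ncont3_tu (tau := Node Leaf treeL) isT ncont_coef4))
      (ncont3_tu (tau := Node Leaf treeR) isT ncont_coef4)).
- move=> i t u s tus; have [/= s0 su ut tT] := tus.
  have tu2 : simplex2 T (t, u) by split=> //=; exact: le_trans su.
  have us2 : simplex2 T (u, s) by split=> //=; exact: le_trans tT.
  have sT : 0 <= s <= T by rewrite s0 (le_trans su) // (le_trans ut).
  have uT : 0 <= u <= T by rewrite (le_trans s0) // (le_trans ut).
  have [[A1 _ _] [A3 _ _] [A4 _ _]] := coef_lip reg T1 ck HX tus (lexx 0) K0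
    (lip_refl (yr sT)) (lip_refl (yr uT)) (lip_refl (yM_le us2)).
  have B0 : 0 <= sizeB C r K by rewrite /sizeB !addr_ge0 ?mulr_ge0 ?exprn_ge0.
  set B := sizeB C r K in A1 A3 A4 B0; set lam := (u - s) `^ c in A1 A3 A4.
  have lam0 : 0 <= lam := powR_ge0 _ _.
  have tu0 : 0 <= t - u by rewrite subr_ge0.
  set P := (t - u) `^ gamma; set sig := (t - u) `^ c.
  have P0 : 0 <= P := powR_ge0 _ _.
  have sig0 : 0 <= sig := powR_ge0 _ _.
  have XB tau A z : (2 <= leaves tau <= 4)%N -> ball_ eta A z ->
      ball_ (- rho) (C * (P * sig ^+ (leaves tau - 2)) * A) (X tau t u z).
    by move=> lt Hz; case: (HXb tau t u lt tu2 A z Hz).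
  have S0 : 0 <= C * B ^+ 2 /\ 0 <= C * B ^+ 3 /\ 0 <= C * B ^+ 4.
    by rewrite !mulr_ge0 ?exprn_ge0.
  have [S2 [S3 S4]] := S0.
  have fin (k : nat) D x : (k < 3)%N -> ball_ (- rho) (D * (P * sig ^+ k * lam ^+ (3 - k))) x ->
      D <= stepB C r K ->
      nm (Bsp (- rho) 1) x <= stepB C r K *
        ((t - u) `^ (gamma + k%:R * c) * (u - s) `^ (gamma + 3 * c - (gamma + k%:R * c))).
    move=> k3 Hx DS; have [_ h] := ball_Bsp Hx; apply: le_trans h _.
    rewrite -powR_gamma_nat //.
    have -> : gamma + 3 * c - (gamma + k%:R * c) = c * (3 - k)%:R.
      by rewrite natrB; [ring|exact: ltnW].
    rewrite -powR_powR_nat -/lam -/P -/sig.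
    by apply: ler_wpM2r => //; rewrite !mulr_ge0 ?exprn_ge0.
  rewrite /rem3; case: i => [[|[|[|//]]] /= _].
  + apply: (fin 0%N (C * (7 * B ^+ 2))) => //.
      apply: ballW (XB vee _ _ isT A1); rewrite /= subnn subn0 expr0.
      by rewrite le_eqVlt; apply/orP; left; apply/eqP; ring.
    by rewrite /stepB -/B; move: S2 S3 S4; lra.
  + apply: (fin 1%N (C * (66 * B ^+ 3))) => //.
      apply: ballW (ballD (XB treeL _ _ isT A3) (XB treeR _ _ isT A3)); rewrite /= expr1.
      by rewrite le_eqVlt; apply/orP; left; apply/eqP; ring.
    by rewrite /stepB -/B; move: S2 S3 S4; lra.
  + apply: (fin 2%N (C * (60 * B ^+ 4))) => //.
      apply: ballW (ballD (ballD (ballD (ballD (XB (Node vee vee) _ _ isT A4)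
        (XB (Node treeL Leaf) _ _ isT A4)) (XB (Node treeR Leaf) _ _ isT A4))
        (XB (Node Leaf treeL) _ _ isT A4)) (XB (Node Leaf treeR) _ _ isT A4)).
      rewrite /= expr1.
      by rewrite le_eqVlt; apply/orP; left; apply/eqP; ring.
    by rewrite /stepB -/B; move: S2 S3 S4; lra.
- move=> t u s tus; have [/= s0 su ut tT] := tus.
  have sT : 0 <= s <= T by rewrite s0 (le_trans su) // (le_trans ut).
  have uT : 0 <= u <= T by rewrite (le_trans s0) // (le_trans ut).
  have ys := (ball_Bsp (yr sT)).1; have yu := (ball_Bsp (yr uT)).1.
  rewrite !big_ord_recl big_ord0 addr0 /rem3 /=.
  by rewrite [LHS](incr_defect alg XL tus ys yu) [RHS]addrA; congr (_ + _); rewrite addrA.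
Qed.

Lemma hdelta2_hdelta1 n (f : R -> coef R n) t u s : hdelta2 (hdelta1 f) t u s = 0.
Proof.
rewrite /hdelta2 /hdelta1 sgB sg_sg (_ : t - u + (u - s) = t - s); last by ring.
by apply/funext => k; rewrite !fctE (_ : (0 : coef R n) k = 0) //; ring.
Qed.

(** The remainder itself is the image under Lambda: it equals the germ minus the increment of y, the
    second increment kills the latter, and the exponent gamma + 3 c exceeds one. *)
Lemma solves_y : solves T X rho psi y.
Proof.
split=> //; pose M t s := germ X y t s - hdelta1 y t s.
have ME t s : M t s = flow t s (y s) - y t.
  rewrite /M /germ /hdelta1 /flow /incr; move: (sg _ _) (\sum_(_ <- _) _) => a b.
  by apply/funext => k; rewrite !fctE; ring.
exists M; split; last by move=> t s _; rewrite /M subKr.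
exists (gamma + 3 * c); split=> //; first exact: C3_germ.
  apply: (C2_of_cnt (C := K)).
    apply: (ncont_le er); rewrite (_ : (fun p => _) = fun p : R * R =>
      incr X p.1 p.2 (y p.2) - hdelta1 y p.1 p.2) //.
    apply: ncontB; last exact: ncont_hdelta.
    rewrite (_ : (fun p => _) = fun p : R * R =>
      X vee p.1 p.2 (tpow 2 (y p.2)) + X treeL p.1 p.2 (tpow 3 (y p.2)) +
      X treeR p.1 p.2 (tpow 3 (y p.2)) +
      (X (Node vee vee) p.1 p.2 (tpow 4 (y p.2)) + X (Node treeL Leaf) p.1 p.2 (tpow 4 (y p.2)) +
       X (Node treeR Leaf) p.1 p.2 (tpow 4 (y p.2)) + X (Node Leaf treeL) p.1 p.2 (tpow 4 (y p.2)) +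
       X (Node Leaf treeR) p.1 p.2 (tpow 4 (y p.2)))); last first.
      by apply/funext => p; exact: incr_expand.
    exact: (ncontD (ncontD (ncontD (@ncont_X2 vee 1 erefl isT) (@ncont_X2 treeL 2 erefl isT))
        (@ncont_X2 treeR 2 erefl isT))
      (ncontD (ncontD (ncontD (ncontD (@ncont_X2 (Node vee vee) 3 erefl isT)
        (@ncont_X2 (Node treeL Leaf) 3 erefl isT)) (@ncont_X2 (Node treeR Leaf) 3 erefl isT))
        (@ncont_X2 (Node Leaf treeL) 3 erefl isT)) (@ncont_X2 (Node Leaf treeR) 3 erefl isT))).
  by move=> t s s0 st tT; rewrite ME; case: (yM s0 st tT).
move=> t u s _.
have -> : hdelta2 M t u s = hdelta2 (germ X y) t u s - hdelta2 (hdelta1 y) t u s.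
  rewrite /hdelta2 /M sgB; move: (sg _ _) (sg _ _) => a b.
  by apply/funext => k; rewrite !fctE; ring.
by rewrite hdelta2_hdelta1 subr0.
Qed.

End SolutionPath.

(** * Uniqueness *)

Section Uniqueness.
Context {R : realType}.
Variables (T eta rho gamma kappa0 : R) (X : treeops (R := R)).
Arguments X : clear implicits.
Hypotheses (reg : regularity T eta X gamma kappa0 rho)
  (alg : algebraic_relations T eta X).
Hypotheses (T1 : 0 < T <= 1) (k00 : 0 < kappa0) (g1 : gamma <= 1)
  (kg : kappa0 < gamma) (Hg : gamma = kappa0 + eta + rho).

Local Notation flow := (flow X).

Let g0 : 0 < gamma. Proof. exact: lt_trans kg. Qed.
Let er : - rho <= eta.
Proof. by rewrite -subr_ge0; move: kg; rewrite Hg; lra. Qed.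

Definition solution_bounds (c r K : R) (y : R -> coef R 1) : Prop :=
  (forall t, 0 <= t <= T -> ball_ eta r (y t)) /\
  forall t s, 0 <= s -> s < t -> t <= T ->
    ball_ eta (K * (t - s) `^ (3 * c)) (flow t s (y s) - y t) /\
    ball_ (- rho) (K * (t - s) `^ (gamma + 3 * c)) (flow t s (y s) - y t).

Let len t s : 0 <= s -> s < t -> t <= T -> 0 < t - s <= 1.
Proof.
case/andP: T1 => _ T1' s0 st tT; rewrite subr_gt0 st /= lerBlDr.
by rewrite (le_trans tT) // (le_trans T1') // lerDl.
Qed.

Lemma solution_boundsW c c' r r' K K' y :
  c' <= c -> r <= r' -> 0 <= K <= K' -> solution_bounds c r K y ->
  solution_bounds c' r' K' y.
Proof.
move=> cc rr /andP[K0 KK] [h1 h2]; split=> [t /h1|t s s0 st tT]; first exact: ballW.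
have [a b] := h2 t s s0 st tT; have /andP[L0 L1] := len s0 st tT.
split; [apply: ballW a|apply: ballW b];
  by apply: ler_pM; rewrite ?powR_ge0 //; apply: ger_powR; rewrite ?L0 ?L1 //; lra.
Qed.

(* The remainder of a solution is a priori only small in B_{-rho}. Its exponent
   in B_eta is raised by kappa0 at each step: the older half of the interval is
   smoothed by the semigroup, and the defect gains kappa0 over the remainder. *)
Lemma bootstrap kappa r C Cm mu y : 0 < kappa <= kappa0 -> 1 < gamma + 3 * kappa ->
  1 < mu -> 0 <= C -> 0 <= Cm -> 0 <= r ->
  (forall t, 0 <= t <= T -> ball_ eta r (y t)) ->
  (forall t s, 0 <= s -> s < t -> t <= T ->
    ball_ eta (C * (t - s) `^ kappa) (hdelta1 y t s) /\
    ball_ (- rho) (Cm * (t - s) `^ mu) (flow t s (y s) - y t)) ->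
  exists c K, [/\ 0 < c <= kappa0, 1 < gamma + 3 * c, 0 <= K & solution_bounds c r K y].
Proof.
move=> /andP[ka0 kak] gk mu1 C0 Cm0 r0 yr H.
(* Small enough that gamma + 3 c' <= mu, yet gamma + 3 c' > 1 because gamma + 3 kappa and mu both
   exceed one. *)
pose c' := Num.min kappa ((mu - gamma) / 3).
have c'k : c' <= kappa by rewrite ge_min lexx.
have c'm : c' <= (mu - gamma) / 3 by rewrite ge_min lexx orbT.
have mg : 0 < (mu - gamma) / 3 by move: g1; lra.
have c'0 : 0 < c' by rewrite lt_min ka0 mg.
have gc : 1 < gamma + 3 * c' by rewrite /c'; case: (leP kappa) => _; move: gk mu1; lra.
have c'k0 : c' <= kappa0 := le_trans c'k kak.
(* B_eta exponent reached after n rounds, capped at the target 3 c'. *)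
pose q n := Num.min (3 * c') (kappa + n%:R * kappa0).
have q0 n : 0 < q n by rewrite lt_min mulr_gt0 //= ltr_wpDr // mulr_ge0 // ltW.
have q3 n : q n <= 3 * c' by rewrite ge_min lexx.
pose M t s := flow t s (y s) - y t.
have mid (t s : R) : s < t -> s < (t + s) / 2 < t by move=> st; apply/andP; split; lra.
have step n : exists2 K, 0 <= K & forall t s, 0 <= s -> s < t -> t <= T ->
    ball_ eta (K * (t - s) `^ q n) (M t s).
  elim: n => [|n [K K0 HK]].
    have kk : 0 < kappa0 <= kappa0 by rewrite k00 lexx.
    have [C1 HX] := Xbound_exists reg T1 k00 g0 kk; have [C10 _] := HX.
    have I0 : 0 <= 8 * C1 * (1 + r) ^+ 4.
      by rewrite mulr_ge0 ?exprn_ge0 ?addr_ge0 // mulr_ge0.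
    exists (8 * C1 * (1 + r) ^+ 4 + C); first exact: addr_ge0.
    move=> t s s0 st tT; have L := len s0 st tT.
    have sT : 0 <= s <= T by rewrite s0 (le_trans (ltW st)).
    have ts : simplex2 T (t, s) by split=> //=; exact: ltW.
    have [h _ _] := lip_incr reg T1 HX kk ts (lexx 0) (lip_refl (yr s sT)).
    have [hd _] := H t s s0 st tT.
    have -> : M t s = incr X t s (y s) - hdelta1 y t s.
      rewrite /M /flow /hdelta1; move: (sg _ _) (incr _ _ _ _) => a b.
      by apply/funext => k; rewrite !fctE; ring.
    apply: ballW (ballB h hd); rewrite [leRHS]mulrDl.
    have e1 : (t - s) `^ kappa <= (t - s) `^ q 0%N.
      by apply: ger_powR => //; rewrite ge_min mul0r addr0 lexx orbT.
    have e2 : (t - s) `^ kappa0 <= (t - s) `^ kappa by apply: ger_powR.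
    by apply: lerD; apply: ler_wpM2l => //; exact: le_trans e1.
  (* The current bound of order [q n] is read as a cube, as [step_lip] expects; the defect is then
     of order kappa0 + q n. *)
  have ck : 0 < q n / 3 <= kappa0.
    by rewrite divr_gt0 //=; have := q3 n; move: c'k0; lra.
  have [C1 HX] := Xbound_exists reg T1 k00 g0 ck.
  have B0 : 0 <= stepB C1 r K by exact: (stepB_ge0 HX).
  have hp := halfpow_lt1 (q0 n.+1).
  exists ((Cm + stepB C1 r K) / (1 - halfpow (q n.+1))).
    by apply: divr_ge0; [exact: addr_ge0|rewrite subr_ge0 ltW].
  have ME t s : 0 <= s -> s < t -> t <= T -> Bsp eta 1 (M t s).
    by move=> s0 st tT; case: (ball_Bsp (HK t s s0 st tT)).
  move=> t s s0 st tT; apply/ballP; split; first exact: ME.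
  (* The younger half is iterated. The older one enters through its smoothed B_{-rho} bound, of
     order mu - gamma + kappa0 >= 3 c', and through the defect. *)
  apply: (halving (T := T) (B := K) (q := q n) (f := fun t s => nm (Bsp eta 1) (M t s))) => //.
  - exact: addr_ge0.
  - by move=> {}t {}s {}s0 {}st {}tT; case: (ball_Bsp (HK t s s0 st tT)).
  - move=> {}t {}s {}s0 {}st {}tT; set m := (t + s) / 2.
    have /andP[sm mt] := mid t s st; rewrite -/m in sm mt.
    have m0 : 0 <= m := le_trans s0 (ltW sm).
    have mT : m <= T := le_trans (ltW mt) tT.
    have sT : 0 <= s <= T by rewrite s0 (le_trans (ltW st)).
    have mT0 : 0 <= m <= T by rewrite m0.
    have /andP[L0 L1] := len s0 st tT.
    have tms : simplex3 T (t, m, s) by split=> //=; exact: ltW.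
    have -> : M t s = M t m + (sg (t - m) (M m s) + defect X t m s (y s) (y m)).
      rewrite /M /defect; move: (sg _ (_ - _)) => a.
      by apply/funext => k; rewrite !fctE; ring.
    have [_ hr] := H m s s0 sm mT.
    have tm0 : 0 < t - m by rewrite subr_gt0.
    have e01 : 0 <= eta - - rho <= 1 by move: g1 kg k00; rewrite Hg => *; apply/andP; split; lra.
    have h1 := ball_smooth tm0 e01 hr.
    have Hm : lip eta (K * ((m - s) `^ (q n / 3)) ^+ 3) 0 (M m s) (M m s).
      apply: lip_refl; rewrite powR_cube [3 * _]mulrC divfK ?pnatr_eq0 //.
      exact: HK.
    have [[h2 _ _] _] := step_lip reg alg T1 k00 g0 ck HX tms (lexx 0) K0
      (lip_refl (yr s sT)) (lip_refl (yr m mT0)) Hm.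
    rewrite powR_mul_cube // in h2.
    have h0 := Bsp_ball (ME t m m0 mt tT).
    apply: le_trans (ball_Bsp (ballD h0 (ballD h1 h2))).2 _.
    rewrite lerD2l [leRHS]mulrDl; apply: lerD.
      have E : t - m = m - s by rewrite /m; field.
      rewrite E mulrCA -powR_add ?subr_gt0 //.
      apply: ler_wpM2l => //.
      apply: (@le_trans _ _ ((t - s) `^ (- (eta - - rho) + mu))).
        apply: powR_mono; last by apply/andP; split; rewrite ?subr_ge0 ?(ltW sm) // lerB // ltW.
        by move: c'm c'0; rewrite Hg; move: k00; lra.
      apply: ger_powR; first by rewrite L0.
      apply: le_trans (q3 _) _; move: c'm; rewrite Hg; move: k00; lra.
    apply: ler_wpM2l => //; apply: ger_powR; first by rewrite L0.
    rewrite [3 * _]mulrC divfK ?pnatr_eq0 //.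
    rewrite /q; case: (leP (3 * c') (kappa + n%:R * kappa0)) => _; rewrite ge_min.
      by rewrite lerDr (ltW k00).
    have -> : n.+1%:R * kappa0 = kappa0 + n%:R * kappa0 by rewrite -natr1; ring.
    by rewrite (addrCA kappa0) lexx orbT.
pose N := Num.bound (3 * c' / kappa0).
have qN : q N = 3 * c'.
  rewrite /q; apply/min_idPl.
  have : 3 * c' / kappa0 < N%:R by apply: archi_boundP; rewrite divr_ge0 ?mulr_ge0 // ltW.
  by rewrite ltr_pdivrMr // => /ltW h; apply: le_trans h _; rewrite lerDr ltW.
have [K K0 HK] := step N; rewrite qN in HK.
exists c', (K + Cm); split=> //; first by rewrite c'0.
  exact: addr_ge0.
split=> // t s s0 st tT; have /andP[L0 L1] := len s0 st tT; split.
  by apply: ballW (HK t s s0 st tT); rewrite ler_wpM2r ?powR_ge0 // lerDl.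
have [_ h] := H t s s0 st tT; apply: ballW h; apply: ler_pM; rewrite ?powR_ge0 // ?lerDr //.
by apply: ger_powR; rewrite ?L0 //; move: c'm; lra.
Qed.

(** Sampled on a uniform grid, two solutions that agree at its first node are closer than any power
    bound of the mesh allows them to differ, so they coincide over a length [Tl]. As r and K hold on
    all of [0,T], this length is the same at each restart, and finitely many cover the interval. *)
Lemma solution_unique c r K y y' : 0 < c <= kappa0 -> 1 < gamma + 3 * c -> 1 <= r -> 1 <= K ->
  solution_bounds c r K y -> solution_bounds c r K y' -> y 0 = y' 0 ->
  forall t, 0 <= t <= T -> y t = y' t.
Proof.
move=> /andP[c0 ck0] gc r1 K1 [Hy HM] [Hy' HM'] y0.
pose c1 := ((1 - gamma) / 3 + c) / 2.
have c10 : 0 < c1 by move: g1; rewrite /c1; lra.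
have c1c : c1 < c by rewrite /c1; lra.
have gc1 : 1 < gamma + 3 * c1 by rewrite /c1; lra.
have [Tl [Cs [/andP[Tl0 TlT] Cs0 HS]]] :=
  stability reg alg T1 k00 g1 kg Hg c10 c1c ck0 gc1 r1 K1.
set th := 3 * (c - c1) in HS.
have th0 : 0 < th by rewrite mulr_gt0 // subr_gt0.
suff key n t : 0 <= t <= T -> t <= n%:R * Tl -> y t = y' t.
  move=> t /[dup] tT /andP[t0 _]; apply: (key (Num.bound (t / Tl))) => //.
  have : t / Tl < (Num.bound (t / Tl))%:R by apply: archi_boundP; rewrite divr_ge0 // ltW.
  by rewrite ltr_pdivrMr // => /ltW.
elim: n t => [|n IH] t /andP[t0 tT].
  by rewrite mul0r => tle0; have -> : t = 0 by apply/eqP; rewrite eq_le tle0.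
move=> tn; pose s := Num.max 0 (t - Tl).
have s0 : 0 <= s by rewrite le_max lexx.
have s1 : t - Tl <= s by rewrite le_max lexx orbT.
have st : s <= t by rewrite ge_max t0 /= gerBl ltW.
have ys : y s = y' s.
  apply: IH; first by rewrite s0 (le_trans st).
  rewrite ge_max mulr_ge0 ?(ltW Tl0) //=.
  by move: tn; rewrite -natr1 mulrDl mul1r; lra.
move: st; rewrite le_eqVlt => /orP[/eqP <- //|st].
have L01 := len s0 st tT.
suff : y t - y' t = 0 by move/eqP; rewrite subr_eq0 => /eqP.
apply: (@ball_small R eta) => e e0.
have [m Hm] := gap_exists th0 Cs0 e0.
pose tau := uniform_grid s t m.
have tau0 : tau 0%N = s by exact: uniform_grid0.
have tauN : tau m.+1 = t by exact: uniform_grid_end.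
have mono j i : (j < i <= m.+1)%N -> tau j < tau i.
  by case/andP=> ji _; exact: uniform_grid_lt.
have mono' i : (i <= m.+1)%N -> s <= tau i <= t.
  move=> im; apply/andP; split.
    by rewrite -tau0; case: i im => [//|i] im; apply/ltW/mono; rewrite im.
  rewrite -tauN; move: im; rewrite leq_eqVlt => /orP[/eqP->//|im].
  by apply/ltW/mono; rewrite im leqnn.
have inT i : (i <= m.+1)%N -> 0 <= tau i <= T.
  by case/mono'/andP => a b; rewrite (le_trans s0) // (le_trans b).
have ctl z : (forall t, 0 <= t <= T -> ball_ eta r (z t)) ->
    (forall t s, 0 <= s -> s < t -> t <= T ->
    ball_ eta (K * (t - s) `^ (3 * c)) (flow t s (z s) - z t) /\
    ball_ (- rho) (K * (t - s) `^ (gamma + 3 * c)) (flow t s (z s) - z t)) ->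
    controlled eta rho gamma X c r K m.+1 tau (fun i => z (tau i)).
  move=> h1 h2; split=> [i im|i j /[dup] ij /andP[ji im]]; first exact/h1/inT.
  have jm : (j <= m.+1)%N by rewrite (leq_trans (ltnW ji)).
  have /andP[a _] := inT j jm; have /andP[_ b] := inT i im.
  exact: h2 a (mono j i ij) b.
have z0 : ball_ eta 0 (y (tau 0%N) - y' (tau 0%N)) by rewrite tau0 ys subrr; exact: ball0.
have := HS m.+1 tau (fun i => y (tau i)) (fun i => y' (tau i)) (m.+1%:R^-1) 0
  _ _ mono _ _ (ctl y Hy HM) (ctl y' Hy' HM') z0 m.+1 (leqnn _).
rewrite tauN tau0 add0r => HS'; apply: ballW Hm _; apply: HS' => //.
  by move: s1; lra.
move=> i im; rewrite /tau uniform_grid_mesh ler_piMl ?invr_ge0 //.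
by case/andP: L01.
Qed.

End Uniqueness.

(** * The case gamma > 1 *)

Section YoungRegime.
Context {R : realType}.
Variables (T eta rho gamma kappa0 : R) (X : treeops (R := R)).
Arguments X : clear implicits.
Hypotheses (reg : regularity T eta X gamma kappa0 rho)
  (alg : algebraic_relations T eta X) (T0 : 0 < T).

Let XL := fun tau t s => @reg_Lsp _ _ _ _ _ _ _ reg tau t s.

(** A family that is additive up to the semigroup and has exponent p > 1 vanishes by repeated
    halving. Additivity replaces x by its evolution on the younger half, so the bound is propagated
    for all x in a ball, which the semigroup preserves. *)
Lemma X_vanish tau : (2 <= leaves tau <= 4)%N ->
  1 < gamma + ((leaves tau).-1%:R - 1) * kappa0 ->
  (forall t u s x, simplex3 T (t, u, s) -> Bsp eta 1 x ->
     tdelta (X tau) t u s (tpow (leaves tau) x) = 0) ->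
  forall t s x, simplex2 T (t, s) -> Bsp eta 1 x -> X tau t s (tpow (leaves tau) x) = 0.
Proof.
move=> lt p1 td t s x ts /Bsp_ball; move: (nm _ x) => k Hx.
have [/= s0 st tT] := ts.
have [_ [_ [C HC]]] := reg lt; set p := gamma + _ in p1 HC.
move: st; rewrite le_eqVlt => /orP[/eqP E|st].
  have tus : simplex3 T (t, t, t) by split=> //=; rewrite -E.
  have := td _ _ _ _ tus (ball_Bsp Hx).1.
  by rewrite -E /tdelta subrr !sg0 subrr sub0r => /eqP; rewrite oppr_eq0 => /eqP.
set A := `|C| * k ^+ leaves tau.
have k0 : 0 <= k := ball_ge0 Hx.
have hp z : ball_ eta k z -> ball_ eta (k ^+ leaves tau) (tpow (leaves tau) z).
  by move: lt; case: (leaves tau) => [//|d] _; exact: ball_tpow.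
have key n : forall t s x, 0 <= s -> s < t -> t <= T -> ball_ eta k x ->
    ball_ (- rho) (A * (t - s) `^ p * (2 * halfpow p) ^+ n) (X tau t s (tpow (leaves tau) x)).
  elim: n => [|n IH] {s0 st tT ts Hx x}t {}s x s0 st tT Hx.
    have ts : simplex2 T (t, s) by split=> //=; exact: ltW.
    apply: ballW (Lsp_ball (reg_Lsp_rho reg lt ts) (HC t s s0 st tT) (hp _ Hx)).
    by rewrite expr0 mulr1 /A mulrAC ler_wpM2r ?powR_ge0 // ler_wpM2r ?ler_norm ?exprn_ge0.
  pose m := (t + s) / 2.
  have [sm mt] : s < m /\ m < t by split; rewrite /m; lra.
  have m0 : 0 <= m := le_trans s0 (ltW sm).
  have mT : m <= T := le_trans (ltW mt) tT.
  have tms : simplex3 T (t, m, s) by split=> //=; exact: ltW.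
  have := td _ _ _ _ tms (ball_Bsp Hx).1.
  rewrite /tdelta sg_tpow => /eqP; rewrite -addrA -opprD subr_eq0 => /eqP ->.
  have ms0 : 0 <= m - s by rewrite subr_ge0 ltW.
  have tm0 : 0 <= t - m by rewrite subr_ge0 ltW.
  have h1 := IH t m _ m0 mt tT (ball_sg ms0 Hx).
  have h2 := ball_sg tm0 (IH m s x s0 sm mT Hx).
  apply: ballW (ballD h1 h2).
  have -> : t - m = (t - s) / 2 by rewrite /m; field.
  have -> : m - s = (t - s) / 2 by rewrite /m; field.
  rewrite !powR_half ?subr_ge0 ?(ltW st) // exprS.
  by rewrite le_eqVlt; apply/orP; left; apply/eqP; ring.
apply: (@ball0_eq0 _ (- rho)).
have hB := key 0%N t s x s0 st tT Hx.
apply/ballP; split; first exact: (ball_Bsp hB).1.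
apply: (@geometric_le _ _ _ (A * (t - s) `^ p) (2 * halfpow p)).
  by rewrite mulr_ge0 ?halfpow_ge0 // halfpow_lt_half.
by move=> n; rewrite add0r; exact: (ball_Bsp (key n t s x s0 st tT Hx)).2.
Qed.

Hypotheses (gg : 1 < gamma) (gk : 1 < gamma + 2 * kappa0).

(** By increasing number of leaves: the right side of each relation contains smaller trees evaluated
    at powers of x, already known to vanish, so the tree itself is additive. *)
Lemma X_zero tau : (2 <= leaves tau <= 4)%N -> forall t s x, simplex2 T (t, s) ->
  Bsp eta 1 x -> X tau t s (tpow (leaves tau) x) = 0.
Proof.
have ex d : (2 <= d <= 4)%N -> 1 < gamma + (d.-1%:R - 1) * kappa0.
  by case: d => [|[|[|[|[|d]]]]] //= _; move: gg gk; lra.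
have s3 t u s : simplex3 T (t, u, s) -> simplex2 T (t, u) /\ simplex2 T (u, s).
  case=> /= s0 su ut tT; split; split => //=; [exact: le_trans su|exact: le_trans tT].
have X0 tau' t s : (2 <= leaves tau' <= 4)%N -> simplex2 T (t, s) -> X tau' t s 0 = 0.
  by move=> lt ts; exact: Lsp0 (XL lt ts).
have t0l m n (z : coef R n) : tens (0 : coef R m) z = 0.
  by apply/funext => k; exact: mul0r.
have t0r m n (z : coef R m) : tens z (0 : coef R n) = 0.
  by apply/funext => k; exact: mulr0.
have hV t s x : simplex2 T (t, s) -> Bsp eta 1 x -> X vee t s (tpow 2 x) = 0.
  apply: (@X_vanish vee isT (ex 2%N isT)) => t' u s' x' tus x'E.
  exact: (rel_vee alg tus x'E).
have hL t s x : simplex2 T (t, s) -> Bsp eta 1 x -> X treeL t s (tpow 3 x) = 0.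
  apply: (@X_vanish treeL isT (ex 3%N isT)) => t' u s' x' tus x'E.
  have [tu us] := s3 _ _ _ tus.
  by rewrite [LHS](rel_L alg XL tus x'E) /= (hV _ _ _ us x'E) t0l (X0 vee).
have hR t s x : simplex2 T (t, s) -> Bsp eta 1 x -> X treeR t s (tpow 3 x) = 0.
  apply: (@X_vanish treeR isT (ex 3%N isT)) => t' u s' x' tus x'E.
  have [tu us] := s3 _ _ _ tus.
  by rewrite [LHS](rel_R alg XL tus x'E) /= (hV _ _ _ us x'E) t0r (X0 vee).
move=> /treesP [<-|[<-|[<-|[<-|[<-|[<-|[<-|[<-|[]]]]]]]]].
- exact: hV.
- exact: hL.
- exact: hR.
- apply: (@X_vanish (Node vee vee) isT (ex 4%N isT)) => t' u s' x' tus x'E.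
  have [tu us] := s3 _ _ _ tus.
  rewrite [LHS](rel_VV alg XL tus x'E) /= (hV _ _ _ us x'E) !(t0l, t0r).
  by rewrite (X0 vee) // (X0 treeR) // (X0 treeL) // !addr0.
- apply: (@X_vanish (Node treeL Leaf) isT (ex 4%N isT)) => t' u s' x' tus x'E.
  have [tu us] := s3 _ _ _ tus.
  rewrite [LHS](rel_4L alg XL tus x'E) /= (hV _ _ _ us x'E) (hL _ _ _ us x'E) !(t0l, t0r).
  by rewrite (X0 vee) // (X0 treeL) // !addr0.
- apply: (@X_vanish (Node treeR Leaf) isT (ex 4%N isT)) => t' u s' x' tus x'E.
  have [tu us] := s3 _ _ _ tus.
  rewrite [LHS](rel_4R alg XL tus x'E) /= (hV _ _ _ us x'E) (hR _ _ _ us x'E) !(t0l, t0r).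
  by rewrite (X0 vee) // (X0 treeL) // !addr0.
- apply: (@X_vanish (Node Leaf treeL) isT (ex 4%N isT)) => t' u s' x' tus x'E.
  have [tu us] := s3 _ _ _ tus.
  rewrite [LHS](rel_L4 alg XL tus x'E) /= (hV _ _ _ us x'E) (hL _ _ _ us x'E) !(t0l, t0r).
  by rewrite (X0 vee) // (X0 treeR) // !addr0.
- apply: (@X_vanish (Node Leaf treeR) isT (ex 4%N isT)) => t' u s' x' tus x'E.
  have [tu us] := s3 _ _ _ tus.
  rewrite [LHS](rel_R4 alg XL tus x'E) /= (hV _ _ _ us x'E) (hR _ _ _ us x'E) !(t0l, t0r).
  by rewrite (X0 vee) // (X0 treeR) // !addr0.
Qed.

Lemma germ_zero (y : R -> coef R 1) t s : simplex2 T (t, s) -> Bsp eta 1 (y s) ->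
  germ X y t s = 0.
Proof.
move=> ts yE; rewrite /germ.
have : forall tau, List.In tau trees -> X tau t s (tpow (leaves tau) (y s)) = 0.
  by move=> tau /treesP lt; exact: X_zero.
elim: trees => [|tau l IH] H; first by rewrite big_nil.
rewrite big_cons H; last by left.
by rewrite add0r; apply: IH => t' ht'; apply: H; right.
Qed.

Lemma nm0 alpha n : nm (Bsp alpha n) (0 : coef R n) = 0.
Proof. by apply/eqP; rewrite eq_le nm_ge0 (ball_Bsp (ball0 alpha n (lexx 0))).2. Qed.

Lemma C2_zero mu alpha n : C2 T mu (Bsp alpha n) (fun _ _ => 0).
Proof.
have E0 : Bsp alpha n 0 by exact: (ball_Bsp (ball0 alpha n (lexx 0))).1.
split; last by exists 0 => t s _ _ _; rewrite nm0 mul0r.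
split=> // x _; rewrite subrr; under eq_fun do rewrite nm0.
exact: cvg_cst.
Qed.

(** For any solution the germ vanishes, so its M has zero second increment and exponent above one;
    [halving0] gives M = 0, which leaves the pure semigroup evolution of psi. *)
Lemma heat_young kappa kappa1 kappa2 psi : Bsp eta 1 psi ->
  exists y : R -> coef R 1,
    [/\ solves T X rho psi y,
      exists ysharp, Qdecomp T eta X kappa kappa1 kappa2 psi y y
        (fun t => tens (y t) (y t)) ysharp &
      forall y' : R -> coef R 1, Qspace T eta X kappa kappa1 kappa2 psi y' ->
        solves T X rho psi y' -> forall t, 0 <= t <= T -> y' t = y t].
Proof.
move=> /[dup] Epsi /Bsp_ball; set r := nm _ psi => Hpsi.
pose y t := sg t psi.
have yr t : 0 <= t <= T -> ball_ eta r (y t) by case/andP=> t0 _; exact: ball_sg.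
have d0 : hdelta1 y = fun _ _ => 0.
  apply/funext => t; apply/funext => s; rewrite /hdelta1 /y sg_sg subrK.
  exact: subrr.
have dd0 : hdelta1 (fun t => tens (y t) (y t) : coef R 2) = fun _ _ => 0.
  apply/funext => t; apply/funext => s; rewrite /hdelta1 /y (@sg_tens _ 1 1) sg_sg subrK.
  exact: subrr.
have yE s : 0 <= s <= T -> Bsp eta 1 (y s) by move/yr/ball_Bsp => [].
have y2r t : 0 <= t <= T -> ball_ eta (r * r) (tens (y t) (y t) : coef R 2).
  by move=> tT; apply: (@ball_tens _ _ 1 1); exact: yr.
have s2 t s : simplex2 T (t, s) -> 0 <= s <= T.
  by case=> /= a b d; rewrite a (le_trans b).
have h0 (z : R -> coef R 1) t u s : (forall s, 0 <= s <= T -> Bsp eta 1 (z s)) ->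
    simplex3 T (t, u, s) -> hdelta2 (germ X z) t u s = 0.
  move=> zE [/= s0 su ut tT].
  have sT : 0 <= s <= T by rewrite s0 (le_trans su) // (le_trans ut).
  have uT : 0 <= u <= T by rewrite (le_trans s0) // (le_trans ut).
  rewrite /hdelta2 !germ_zero ?sg_zero ?subrr //; try exact: zE.
  - by split=> //=; exact: le_trans tT.
  - by split=> //=; exact: le_trans su.
  - by split=> //=; exact: le_trans ut.
have C1y q : C1star T q eta y.
  split; [exact: yE|by exists r => t /yr/ball_Bsp[]|rewrite d0; exact: C2_zero].
have C1yy q : C1star T q eta (fun t => tens (y t) (y t) : coef R 2).
  split; [by move=> t /y2r/ball_Bsp[]|by exists (r * r) => t /y2r/ball_Bsp[]|].
  by rewrite dd0; exact: C2_zero.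
exists y; split.
- split; first by rewrite /y sg0.
  exists (fun _ _ => 0); split.
    exists 2; split; [by rewrite ltr1n| |exact: C2_zero|].
      (* The zero family is the empty sum. *)
      exists 0%N, (fun _ _ _ _ => 0), (fun _ => 0), 0; split; try by case.
      by move=> t u s tus; rewrite big_ord0 h0.
    by move=> t u s tus; rewrite h0 // /hdelta2 sg_zero !subr0.
  move=> t s ts; rewrite germ_zero ?subr0 ?d0 //; exact/yE/s2/ts.
- exists (fun _ _ => 0); split=> //; first by rewrite /y sg0.
    by split; [exact: C1y|exact: C1yy|exact: C2_zero].
  move=> t s ts; rewrite d0; have ys := yE s (s2 _ _ ts).
  have E2 : tens (y s) (y s) = tpow 2 (y s) :> coef R 2 by rewrite tpow2.
  have E3 : tens (tens (y s) (y s) : coef R 2) (y s) = tpow 3 (y s) :> coef R 3 by rewrite tpow3.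
  have E3' : tens (y s) (tens (y s) (y s) : coef R 2) = tpow 3 (y s) :> coef R 3.
    by rewrite tpow3 tensA3.
  have -> : X vee t s (tens (y s) (y s)) = 0.
    by have := @X_zero vee isT t s _ ts ys; rewrite -[RHS]/(0) => <-; congr (X _ _ _ _); exact: E2.
  have -> : X treeL t s (tens (tens (y s) (y s) : coef R 2) (y s)) = 0.
    by have := @X_zero treeL isT t s _ ts ys => <-; congr (X _ _ _ _); exact: E3.
  have -> : X treeR t s (tens (y s) (tens (y s) (y s) : coef R 2)) = 0.
    by have := @X_zero treeR isT t s _ ts ys => <-; congr (X _ _ _ _); exact: E3'.
  by rewrite !addr0.
- move=> y' [w [wv [ysh [y0' [yE' _ _] _ _]]]] [_ [M [[mu [mu1 _ [[ME _] [C HC]] hM]] Hs]]].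
  have MZ t s : 0 <= s -> s < t -> t <= T -> nm (Bsp (- rho) 1) (M t s) <= 0.
    apply: (halving0 (T := T) mu1 HC) => {}t {}s s0 st tT.
    set m := (t + s) / 2.
    have [sm mt] : s < m /\ m < t by split; rewrite /m; lra.
    have tms : simplex3 T (t, m, s) by split=> //=; exact: ltW.
    have := hM _ _ _ tms; rewrite h0 // /hdelta2 => /eqP.
    rewrite -addrA -opprD subr_eq0 => /eqP ->.
    have [[/= a1 a2 a3] [b1 b2]] : simplex2 T (t, m) /\ (s <= m) /\ (m <= T).
      by case: tms => /= ? ? ? ?; split; [split=> //=; exact: le_trans s0 _|split=> //; exact: le_trans tT].
    have h1 := Bsp_ball (ME (t, m) (And3 a1 a2 a3)).
    have h2 := Bsp_ball (ME (m, s) (And3 s0 b1 b2)).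
    have tm0 : 0 <= t - m by rewrite subr_ge0.
    exact: (ball_Bsp (ballD h1 (ball_sg tm0 h2))).2.
  move=> t /andP[]; rewrite le_eqVlt => /orP[/eqP <- _|t0 tT].
    by rewrite y0' /y sg0.
  have ts : simplex2 T (t, 0) by split=> //=; exact: ltW.
  have M0 : M t 0 = 0.
    apply: (@ball0_eq0 _ (- rho)); apply/ballP; split; first exact: (ME (t, 0)).
    exact: MZ.
  have := Hs t 0 ts; rewrite M0 germ_zero //; last by apply: yE'; rewrite lexx ltW.
  by rewrite /hdelta1 y0' !subr0 => /eqP; rewrite subr_eq0 => /eqP.
Qed.

End YoungRegime.

(** * Restriction of the data to a shorter interval *)

Section Restriction.
Context {R : realType}.
Variables (T T' eta rho gamma kappa0 : R) (X : treeops (R := R)).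
Arguments X : clear implicits.
Hypothesis TT : T' <= T.

Lemma simplex2_sub : simplex2 T' `<=` simplex2 T.
Proof. by move=> p [h1 h2 h3]; split=> //; exact: le_trans TT. Qed.

Lemma simplex3_sub : simplex3 T' `<=` simplex3 T.
Proof. by move=> p [h1 h2 h3 h4]; split=> //; exact: le_trans TT. Qed.

Lemma C2_sub mu (V : lmodType R) (E : nspace V) g : C2 T mu E g -> C2 T' mu E g.
Proof.
move=> [[h1 h2] [C HC]]; split; last first.
  by exists C => t s s0 st tT; apply: HC => //; exact: le_trans TT.
split=> [x /simplex2_sub|x xD]; first exact: h1.
apply/cvgrPdist_le => e e0; rewrite near_withinE.
have /cvgrPdist_le /(_ e e0) := h2 x (simplex2_sub xD); rewrite near_withinE.
by apply: filterS => p hp /simplex2_sub; exact: hp.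
Qed.

Lemma regularity_sub : regularity T eta X gamma kappa0 rho ->
  regularity T' eta X gamma kappa0 rho.
Proof. by move=> H tau lt; have [h1 h2] := H tau lt; split; exact: C2_sub. Qed.

Lemma algebraic_relations_sub : algebraic_relations T eta X -> algebraic_relations T' eta X.
Proof.
have sub n (P Q : R -> R -> R -> coef R n -> coef R 1) : opeq3 T eta P Q -> opeq3 T' eta P Q.
  by move=> H t u s z /simplex3_sub; exact: H.
move=> [/sub h1 [/sub h2 [/sub h3 [/sub h4 [/sub h5 [/sub h6 [/sub h7 /sub h8]]]]]]].
by do ! split.
Qed.

End Restriction.

(** * Uniqueness in Q when gamma <= 1 *)

Section RoughRegime.
Context {R : realType}.
Variables (T eta rho gamma kappa0 : R) (X : treeops (R := R)).
Arguments X : clear implicits.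
Hypotheses (reg : regularity T eta X gamma kappa0 rho)
  (alg : algebraic_relations T eta X).
Hypotheses (T1 : 0 < T <= 1) (k00 : 0 < kappa0) (g1 : gamma <= 1)
  (kg : kappa0 < gamma) (Hg : gamma = kappa0 + eta + rho).
Variables (kappa kappa1 kappa2 : R) (psi : coef R 1).
Hypotheses (kak : 0 < kappa <= kappa0) (gk : 1 < gamma + 3 * kappa).

(** The equation identifies M with the remainder phi_{ts} y_s - y_t, and membership in Q supplies
    the B_eta bound and the order kappa of the increment: these are the inputs of [bootstrap]. *)
Lemma solution_bounds_exist y : Qspace T eta X kappa kappa1 kappa2 psi y ->
  solves T X rho psi y ->
  exists c r K, [/\ 0 < c <= kappa0, 1 < gamma + 3 * c, 0 <= K &
    solution_bounds T eta rho gamma X c r K y].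
Proof.
have T0 : 0 < T by case/andP: T1.
move=> [w [wv [ysh [y0 [yE [r Hr] [[dE _] [C HC]]] _ _]]]] [_ [M [[mu [mu1 _ [[ME _] [Cm HCm]] _]] Hs]]].
have yr t : 0 <= t <= T -> ball_ eta r (y t).
  by move=> tT; apply/ballP; split; [exact: yE|exact: Hr].
have r0 : 0 <= r by apply: ball_ge0 (yr 0 _); rewrite lexx ltW.
have [c [K [ck gc K0 H]]] : exists c K, [/\ 0 < c <= kappa0, 1 < gamma + 3 * c, 0 <= K &
    solution_bounds T eta rho gamma X c r K y].
  apply: (bootstrap reg alg T1 k00 g1 kg Hg (C := `|C|) (Cm := `|Cm|) kak gk mu1) => //.
  move=> t s s0 st tT; have ts : simplex2 T (t, s) by split=> //=; exact: ltW.
  split.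
    apply: (@ballW _ _ _ (C * (t - s) `^ kappa)).
      by rewrite ler_wpM2r ?powR_ge0 // ler_norm.
    by apply/ballP; split; [exact: (dE (t, s))|exact: HC].
  have -> : flow X t s (y s) - y t = M t s.
    have := Hs t s ts; rewrite /hdelta1 /flow /germ /incr.
    move: (sg _ _) (\sum_(_ <- _) _) => a b h.
    have -> : M t s = b - (y t - a) by rewrite h subKr.
    by apply/funext => k; rewrite !fctE; ring.
  apply: (@ballW _ _ _ (Cm * (t - s) `^ mu)).
    by rewrite ler_wpM2r ?powR_ge0 // ler_norm.
  by apply/ballP; split; [exact: (ME (t, s))|exact: HCm].
by exists c, r, K.
Qed.

Lemma Qspace_unique y y' :
  Qspace T eta X kappa kappa1 kappa2 psi y -> solves T X rho psi y ->
  Qspace T eta X kappa kappa1 kappa2 psi y' -> solves T X rho psi y' ->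
  forall t, 0 <= t <= T -> y' t = y t.
Proof.
move=> Qy Sy Qy' Sy'.
have [c [r [K [/andP[c0 ck] gc K0 H]]]] := solution_bounds_exist Qy Sy.
have [c' [r' [K' [/andP[c'0 c'k] gc' K'0 H']]]] := solution_bounds_exist Qy' Sy'.
(* Each solution brings its own constants. The worst of them hold for both, and the maximum with 1
   meets the requirements of the stability estimate. *)
pose cc := Num.min c c'; pose rr := Num.max 1 (Num.max r r').
pose KK := Num.max 1 (Num.max K K').
have ccc : cc <= c by rewrite ge_min lexx.
have ccc' : cc <= c' by rewrite ge_min lexx orbT.
have rrr : r <= rr by rewrite !le_max lexx !orbT.
have rrr' : r' <= rr by rewrite !le_max lexx !orbT.
have KKK : 0 <= K <= KK by rewrite K0 !le_max lexx !orbT.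
have KKK' : 0 <= K' <= KK by rewrite K'0 !le_max lexx !orbT.
apply: (solution_unique reg alg T1 k00 g1 kg Hg (c := cc) (r := rr) (K := KK)).
- by rewrite lt_min c0 c'0 (le_trans ccc).
- by rewrite /cc; case: (leP c c').
- by rewrite le_max lexx.
- by rewrite le_max lexx.
- exact: (solution_boundsW T1 ccc' rrr' KKK' H').
- exact: (solution_boundsW T1 ccc rrr KKK H).
- by case: Sy' => -> _; case: Sy => ->.
Qed.

End RoughRegime.

Theorem theorem6p8 (R : realType)
    (gamma kappa0 kappa kappa1 kappa2 eta rho T : R)
    (X : @treeops R) (psi : 'rV[int]_1 -> R)
    (Hkappa : kappa < kappa0) (Hkappa0 : kappa0 < gamma)
    (Hgamma : 1 < gamma + 3 * kappa) (Heta : 1 / 4 < eta)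
    (Hrho : gamma = kappa0 + eta + rho)
    (Hkappa1 : kappa1 < kappa) (Hkappa2 : kappa2 < kappa1)
    (Hgap : kappa - kappa1 = kappa1 - kappa2)
    (Hgamma2 : 1 < gamma + 3 * kappa2)
    (HT : 0 < T)
    (HXreg : regularity T eta X gamma kappa0 rho)
    (HXalg : algebraic_relations T eta X)
    (Hpsi : Bsp eta 1 psi) :
  exists T0 : R, 0 < T0 <= T /\
  exists y : R -> 'rV[int]_1 -> R,
    [/\ Qspace T0 eta X kappa kappa1 kappa2 psi y,
        solves T0 X rho psi y,
        exists ysharp : R -> R -> 'rV[int]_1 -> R,
          Qdecomp T0 eta X kappa kappa1 kappa2 psi y y
            (fun t => tens (y t) (y t)) ysharp &
        forall y' : R -> 'rV[int]_1 -> R,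
          Qspace T0 eta X kappa kappa1 kappa2 psi y' ->
          solves T0 X rho psi y' ->
          forall t, 0 <= t <= T0 -> y' t = y t].
Proof.
have [g1|g1] := leP gamma 1; last first.
  (* If kappa0 is negative, then 2 kappa0 > 3 kappa0 > 3 kappa. *)
  have gk0 : 1 < gamma + 2 * kappa0.
    by have [k0|k0] := leP 0 kappa0; lra.
  have [y [Sy [ysh Qy] Uy]] :=
    heat_young HXreg HXalg HT g1 gk0 kappa kappa1 kappa2 Hpsi.
  exists T; split; first by rewrite HT lexx.
  exists y; split=> //; last by exists ysh.
  by exists y, (fun t => tens (y t) (y t)), ysh.
have ka0 : 0 < kappa by lra.
have k00 : 0 < kappa0 by lra.
have kak : 0 < kappa <= kappa0 by rewrite ka0 ltW.
have eta0 : 0 <= eta by lra.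
(* On lengths at most one, exponents may be lowered at no cost. *)
pose T' := Num.min T 1.
have T'1 : 0 < T' <= 1 by rewrite lt_min HT ltr01 ge_min lexx orbT.
have T'T : T' <= T by rewrite ge_min lexx.
have reg' := regularity_sub T'T HXreg; have alg' := algebraic_relations_sub T'T HXalg.
have [T0 [r [K [y [/andP[T00 T0T'] y0 yr yM]]]]] :=
  path_exists reg' alg' T'1 k00 g1 Hkappa0 Hrho eta0 kak Hgamma Hpsi.
have reg := regularity_sub T0T' reg'; have alg := algebraic_relations_sub T0T' alg'.
have T01 : 0 < T0 <= 1 by rewrite T00 (le_trans T0T') //; case/andP: T'1.
have Qy := Qdecomp_y reg T01 k00 Hkappa0 kak y0 yr yM (ltW Hkappa1)
  (ltW (lt_trans Hkappa2 Hkappa1)).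
have Sy := solves_y reg alg T01 k00 Hkappa0 Hrho kak Hgamma y0 yr yM.
exists T0; split; first by rewrite T00 (le_trans T0T').
have Qs : Qspace T0 eta X kappa kappa1 kappa2 psi y by exists y, (fun t => tens (y t) (y t)); eexists; exact: Qy.
exists y; split=> //; first by eexists; exact: Qy.
move=> y' Qy' Sy'.
exact: (Qspace_unique reg alg T01 k00 g1 Hkappa0 Hrho kak Hgamma Qs Sy Qy' Sy').
Qed.
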